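(* Let $V$ and $H$ be complex Hilbert spaces with a dense continuous embedding $\jmath:V\hookrightarrow H$, and let $d,k,g$ be bounded sesquilinear forms on $V$ such that, for all $u,v\in V$ and some constants $d_0>0$, $C_k,C_g$, $$d[u,v]=\overline{d[v,u]},\quad d[u,u]\ge d_0\|u\|_V^2;\qquad k[u,v]=\overline{k[v,u]},\quad |k[u,v]|\le C_k\|u\|_V\|v\|_V;$$ $$g[u,v]=-\overline{g[v,u]},\quad |g[u,v]|\le C_g\|u\|_V\|v\|_V.$$ Assume $n^-(k)<\infty$. Then the spectrum in $\mathbb C_+=\{\operatorname{Re}\lambda>0\}$ of the operator $\mathscr A$ defined in the context consists of finitely many isolated eigenvalues of finite algebraic multiplicity, and $$N_+(\mathscr A)=n^-(k).$$
   Context: Inner products are linear in the first argument; $V^*$ is the continuous antidual. $\iota:H\to V^*$ is $\langle\iota h,w\rangle=(h,\jmath w)_H$. The form operators $\mathsf D,\mathsf K,\mathsf G\in\mathcal L(V,V^* )$ are $\langle\mathsf Du,w\rangle=d[u,w]$, $\langle\mathsf Ku,w\rangle=k[u,w]$, $\langle\mathsf Gu,w\rangle=g[u,w]$. On $\mathscr X=V\times H$ define $$\operatorname{Dom}(\mathscr A)=\{(u,v)\in V\times V:\ \mathsf Ku+\mathsf Dv+\mathsf Gv\in\iota(H)\},\qquad \mathscr A(u,v)=\bigl(v,-\iota^{-1}(\mathsf Ku+\mathsf Dv+\mathsf Gv)\bigr).$$ This is the first-order generator of the weak second-order equation $\iota\jmath u_{tt}+\mathsf Du_t+\mathsf Gu_t+\mathsf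 Ku=0$. $n^-(k)$ is the maximal dimension of a subspace of $V$ on which $k$ is negative definite. For an isolated eigenvalue $\lambda$ of $\mathscr A$, its algebraic multiplicity is the rank of its Riesz projection, and $N_+(\mathscr A)$ is the sum of the algebraic multiplicities over $\lambda\in\sigma(\mathscr A)$ with $\operatorname{Re}\lambda>0$. *)

(* Defs.v *)
From HB Require Import structures.
From mathcomp Require Import all_boot all_order all_algebra sesquilinear.
From mathcomp Require Import all_classical all_reals all_analysis.
From mathcomp Require Import complex.

Set Implicit Arguments.
Unset Strict Implicit.
Unset Printing Implicit Defensive.

Import Order.TTheory GRing.Theory Num.Theory numFieldNormedType.Exports.

Local Open Scope ring_scope.
Local Open Scope complex_scope.
Local Open Scope classical_set_scope.

Section Inverse.
Variables (T : pointedType) (U : Type).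

(* The inverse of an injective map on its range; unspecified elsewhere. *)
Definition inverse_on_range (f : T -> U) (y : U) : T := get [set x | f x = y].

End Inverse.

Section Dimension.
Variable R : realType.

Definition lin_indep (E : lmodType R[i]) (n : nat) (e : 'I_n -> E) : Prop :=
  forall c : 'I_n -> R[i], \sum_(i < n) c i *: e i = 0 -> forall i, c i = 0.

Definition lin_subspace (E : lmodType R[i]) (W : set E) : Prop :=
  W 0 /\ forall (a : R[i]) (x y : E), W x -> W y -> W (a *: x + y).

(* Dimension of a linear subspace, [+oo] in the infinite-dimensional case. *)
Definition dimension (E : lmodType R[i]) (W : set E) : \bar R :=
  ereal_sup [set n%:R%:E | n in
    [set n : nat | exists e : 'I_n -> E, lin_indep e /\ forall i, W (e i)]].

Definition negative_definite_on (E : lmodType R[i]) (q : E -> E -> R[i])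
    (W : set E) : Prop :=
  forall u, W u -> u != 0 -> q u u < 0.

Definition neg_index (E : lmodType R[i]) (q : E -> E -> R[i]) : \bar R :=
  ereal_sup [set dimension W | W in
    [set W : set E | lin_subspace W /\ negative_definite_on q W]].

End Dimension.

Section RiemannIntegral.
Variables (R : realType) (E : normedModType R[i]).

Definition riemann_sum (f : R -> E) (a : R) (s : seq R) (tag : nat -> R) : E :=
  \sum_(0 <= k < size s)
    (nth a s k - nth a (a :: s) k)%:C *: f (tag k).

(* [s] lists the points of a subdivision of [a, b] other than [a] itself; its
   cells are the intervals from [nth a (a :: s) k] to [nth a s k]. *)
Definition is_riemann_integral (f : R -> E) (a b : R) (I : E) : Prop :=
  forall eps : R, 0 < eps -> exists2 delta : R, 0 < delta &
    forall (s : seq R) (tag : nat -> R), itv_partition a b s ->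
      (forall k, (k < size s)%N ->
        nth a s k - nth a (a :: s) k < delta /\
        nth a (a :: s) k <= tag k <= nth a s k) ->
      `|riemann_sum f a s tag - I| < eps%:C.

Definition riemann_integral (f : R -> E) (a b : R) : E :=
  get [set I | is_riemann_integral f a b I].

(* The integral of [f z dz] over the positively oriented circle [|z - c| = r]. *)
Definition circle_integral (f : R[i] -> E) (c : R[i]) (r : R) : E :=
  riemann_integral
    (fun t => let w := r%:C * (cos t +i* sin t) in ('i%C * w) *: f (c + w))
    0 (2 * pi).

End RiemannIntegral.

(* An operator in [E] with domain [op_dom]; the values of [op_fun] outside the
   domain are irrelevant. *)
Record operator (E : Type) := Operator { op_dom : set E ; op_fun : E -> E }.

Definition open_right_half_plane (R : realType) : set R[i] :=
  [set z | 0 < complex.Re z].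

Section Spectrum.
Variables (R : realType) (X : normedModType R[i]) (A : operator X).

Definition is_resolvent (z : R[i]) (S : X -> X) : Prop :=
  [/\ linear S, continuous S,
      forall x, op_dom A (S x) /\ z *: S x - op_fun A (S x) = x &
      forall x, op_dom A x -> S (z *: x - op_fun A x) = x].

Definition resolvent_set : set R[i] := [set z | exists S, is_resolvent z S].

Definition resolvent (z : R[i]) : X -> X := get [set S | is_resolvent z S].

Definition spectrum : set R[i] := ~` resolvent_set.

Definition op_eigenvalue (z : R[i]) : Prop :=
  exists x, [/\ op_dom A x, x != 0 & op_fun A x = z *: x].

(* [R[i]^o] is [R[i]] with the topology of the modulus. *)
Definition isolated_eigenvalue (z : R[i]) : Prop :=
  op_eigenvalue z /\ isolated (spectrum : set R[i]^o) z.

(* A radius for which the closed disc around [z] meets the spectrum at most in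
   its centre; one exists when [z] is isolated in the spectrum. *)
Definition separating_radius (z : R[i]) : R :=
  get [set r : R | 0 < r /\
    forall w, 0 < `|w - z| <= r%:C -> resolvent_set w].

(* (2 pi i)^-1 times the integral of the resolvent around [z]; since the
   resolvent is norm-continuous, the strong integral used here is also the
   operator-norm one. *)
Definition riesz_projection (z : R[i]) (x : X) : X :=
  ((2 * pi)%:C * 'i%C)^-1 *:
    circle_integral (fun w => resolvent w x) z (separating_radius z).

Definition alg_mult (z : R[i]) : \bar R :=
  dimension (range (riesz_projection z)).

Definition N_plus : \bar R :=
  \esum_(z in spectrum `&` @open_right_half_plane R) alg_mult z.

End Spectrum.

Section SecondOrder.
Variables (R : realType) (V H : normedModType R[i]).
Variables (ipH : {dot H for Num.conj}) (j : {linear V -> H}).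
Variables d k g : {bilinear V -> V -> R[i] | *%R & Num.conj \; *%R}.

(* Elements of the continuous antidual of [V] are represented by the underlying
   functions [V -> R[i]]; thus the form operators are [d], [k], [g] themselves,
   in curried form. *)
Definition antidual_embedding (h : H) : V -> R[i] := fun w => ipH h (j w).

Definition stiffness_damping (u v : V) : V -> R[i] :=
  fun w => k u w + d v w + g v w.

(* A pair (u, v) in V * V is identified with (u, j v) in V * H. The product norm
   of [V * H] is the maximum norm, equivalent to the Hilbert norm. *)
Definition generator : operator (V * H)%type := {|
  op_dom := [set x | exists2 v, j v = x.2 &
    range antidual_embedding (stiffness_damping x.1 v)] ;
  op_fun := fun x =>
    let v := inverse_on_range j x.2 in
    (v, - inverse_on_range antidual_embedding (stiffness_damping x.1 v)) |}.

End SecondOrder.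

(* Main.v *)
(* Write X = V * H and E(x, x') = k[x_1, x'_1] + (x_2, x'_2)_H. On the graph of A one
   has E(Ax, x') + E(x, Ax') = - 2 d[(Ax)_1, (Ax')_1], so by Lyapunov's theorem E is
   negative definite on every finite-dimensional A-invariant subspace on which A has
   its spectrum in Re z > 0. Such a subspace has dimension at most n = n^-(k); let Y
   be one of maximal dimension m. By maximality the operator induced by A on X / Y has
   no eigenvalue with Re z > 0.

   Let e_1, ..., e_n be k-orthonormal negative vectors and beta_i(u) = - k[u, e_i]. The
   form k + sum_i beta_i conj(beta_i) is nonnegative, so the Lax-Milgram lemma solves the
   modified resolvent equation for all Re z > 0, and a finite bordered linear system then
   yields the resolvent of A wherever z is not an eigenvalue, and that of the operator
   induced on X / Y at every z with Re z > 0. Hence the spectrum of A in the half-plane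
   is that of A on Y.

   m >= n is a Rouché-type argument. The n x n matrix function z - Q(z), with Q the
   transfer matrix of the modified problem, satisfies (z - Q) beta(u) = beta(f) whenever
   u is the first component of (z - A)^-1 (f, 0) and f lies in the span of the e_i. On a
   suitable circle |z - a| = rho one has |Q(z) - a| <= theta < rho. If m < n there is
   eta <> 0 orthogonal to beta(Y). Put b(z) = (z - Q(z))^-1 eta; the function (b(z), eta)
   factors through X / Y and is thus holomorphic in the disc, so the mean of
   (z - a) (b(z), eta) over the circle vanishes. But |(z - a) b - eta| = |(Q - a) b| <=
   theta |b| gives |eta|^2 <= 2 Re (z - a) (b(z), eta), a contradiction.

   The same holomorphy on X / Y shows that the Riesz projection at an eigenvalue z has
   its range in the generalized eigenspace of A on Y at z, on which it is the identity.
   Cauchy's theorem is only needed for functions satisfying the resolvent identity, and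
   takes the form that their means over the (N+1)-st roots of unity on two concentric
   circles differ by O(1/N). *)

From HB Require Import structures.
From mathcomp Require Import all_boot all_order all_algebra sesquilinear.
From mathcomp Require Import all_classical all_reals all_analysis.
From mathcomp Require Import complex mxred ring lra.
Require Import Defs.

Set Implicit Arguments.
Unset Strict Implicit.
Unset Printing Implicit Defensive.

Import Order.TTheory GRing.Theory Num.Theory numFieldNormedType.Exports.
Local Open Scope ring_scope.
Local Open Scope complex_scope.
Local Open Scope classical_set_scope.

(** * Real parts, real-valued norms and sequential limits *)

Section RealNorm.
Variable R : realType.
Local Notation C := R[i].
Local Notation re := (@complex.Re R).
Local Notation im := (@complex.Im R).

Lemma reD (x y : C) : re (x + y) = re x + re y. Proof. by case: x; case: y. Qed.
Lemma reN (x : C) : re (- x) = - re x. Proof. by case: x. Qed.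
Lemma reB (x y : C) : re (x - y) = re x - re y. Proof. by rewrite reD reN. Qed.
Lemma reM (x y : C) : re (x * y) = re x * re y - im x * im y.
Proof. by case: x; case: y. Qed.
Lemma reZ (a : R) (x : C) : re (a%:C * x) = a * re x.
Proof. by rewrite reM /= mul0r subr0. Qed.
Lemma re_conj (x : C) : re (Num.conj x) = re x. Proof. by case: x. Qed.
Lemma im_conj (x : C) : im (Num.conj x) = - im x. Proof. by case: x. Qed.
Lemma conj_realE (a : R) : Num.conj a%:C = a%:C :> C.
Proof. exact: conjc_real. Qed.
Lemma re_sum I (r : seq I) (P : pred I) (F : I -> C) :
  re (\sum_(i <- r | P i) F i) = \sum_(i <- r | P i) re (F i).
Proof. by apply: (big_morph _ reD). Qed.

(** The norm over [R[i]] takes values in [R[i]], which is only partially ordered; its real part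
    lives in [R], where [lra] and [nra] apply. *)
Definition nm (E : normedZmodType C) (x : E) : R := re `|x|.

Section ZmodNorm.
Variable E : normedZmodType C.
Implicit Types x y : E.

Lemma nmE x : `|x| = (nm x)%:C.
Proof.
rewrite /nm; have := normr_ge0 x; case: `|x| => a b.
by rewrite lecE /= => /andP[/eqP -> _].
Qed.
Lemma nm_ge0 x : 0 <= nm x. Proof. by rewrite -lecR -nmE; exact: normr_ge0. Qed.
Lemma nm0 : nm (0 : E) = 0. Proof. by rewrite /nm normr0. Qed.
Lemma nmN x : nm (- x) = nm x. Proof. by rewrite /nm normrN. Qed.
Lemma nmB x y : nm (x - y) = nm (y - x). Proof. by rewrite /nm distrC. Qed.
Lemma nm_triangle x y : nm (x + y) <= nm x + nm y.
Proof. by rewrite -lecR rmorphD /= -!nmE ler_normD. Qed.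
Lemma nm_triangleB x y : nm (x - y) <= nm x + nm y.
Proof. by rewrite -[nm y]nmN nm_triangle. Qed.
Lemma nm_dist x y z : nm (x - z) <= nm (x - y) + nm (y - z).
Proof. by rewrite -{1}[x](subrK y) -addrA nm_triangle. Qed.
Lemma nm_eq0 x : (nm x == 0) = (x == 0).
Proof. by rewrite -(normr_eq0 x) nmE (inj_eq (@complexI _)). Qed.
Lemma nm_gt0 x : (0 < nm x) = (x != 0).
Proof. by rewrite lt_def nm_ge0 andbT nm_eq0. Qed.
Lemma nm_sum I (r : seq I) (P : pred I) (F : I -> E) :
  nm (\sum_(i <- r | P i) F i) <= \sum_(i <- r | P i) nm (F i).
Proof.
apply: (big_rec2 (fun (a : E) (b : R) => nm a <= b)) => [|i x y _ h]; first by rewrite nm0.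
by apply: le_trans (nm_triangle _ _) _; rewrite lerD2l.
Qed.
End ZmodNorm.

Lemma nmZ (E : normedModType C) (a : C) (x : E) : nm (a *: x) = nm a * nm x.
Proof. by apply: complexI; rewrite rmorphM /= -!nmE normrZ. Qed.
Lemma nmM (a b : C) : nm (a * b) = nm a * nm b.
Proof. by apply: complexI; rewrite rmorphM /= -!nmE normrM. Qed.
Lemma nmC (a : R) : nm (a%:C) = `|a|.
Proof. by rewrite /nm normc_def /= expr0n addr0 sqrtr_sqr. Qed.
Lemma nm_sqr (a : C) : nm a ^+ 2 = re a ^+ 2 + im a ^+ 2.
Proof. by apply: complexI; rewrite rmorphXn /= -nmE -add_Re2_Im2. Qed.
Lemma nm_sqrE (a : C) : nm a ^+ 2 = re (a * Num.conj a).
Proof. by rewrite nm_sqr reM re_conj im_conj; ring. Qed.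
Lemma nm_conj (a : C) : nm (Num.conj a) = nm a.
Proof. by apply: complexI; rewrite -!nmE norm_conjC. Qed.
Lemma re_le_nm (a : C) : re a <= nm a.
Proof.
apply: le_trans (ler_norm _) _.
by rewrite -lecR -nmE; exact: normc_ge_Re.
Qed.
Lemma nm_le_re_im (a : C) : nm a <= `|re a| + `|im a|.
Proof.
rewrite -(@ler_sqr R) ?nnegrE ?nm_ge0 ?addr_ge0 // nm_sqr sqrrD !real_normK ?num_real //.
have := mulr_ge0 (normr_ge0 (re a)) (normr_ge0 (im a)); lra.
Qed.
Lemma re_eq_real (a : C) : im a = 0 -> a = (re a)%:C.
Proof. by case: a => x y /= ->. Qed.
Lemma herm_real (a : C) : a = Num.conj a -> a = (re a)%:C.
Proof.
move=> h; apply: re_eq_real; have := congr1 im h; rewrite im_conj => e; lra.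
Qed.

Section Limits.
Variable E : normedModType C.

Definition seq_lim (u : nat -> E) (l : E) : Prop :=
  forall eps : R, 0 < eps -> exists N, forall n, (N <= n)%N -> nm (u n - l) < eps.

(** A property of a [normedModType] rather than a structure, so that it passes to the product
    [V * H]. *)
Definition seq_complete : Prop := forall u : nat -> E,
  (forall eps : R, 0 < eps ->
     exists N, forall m n, (N <= m)%N -> (N <= n)%N -> nm (u m - u n) < eps) ->
  exists l, seq_lim u l.

Lemma seq_lim_unique u (l l' : E) : seq_lim u l -> seq_lim u l' -> l = l'.
Proof.
move=> h h'; apply/eqP; rewrite -subr_eq0 -nm_eq0; apply/eqP/le_anti.
rewrite nm_ge0 andbT; apply/ler_addgt0Pr => e e0; rewrite add0r.
have e2 : 0 < e / 2 by lra.
have [N hN] := h _ e2; have [M hM] := h' _ e2.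
have := hN (maxn N M) (leq_maxl _ _); have := hM (maxn N M) (leq_maxr _ _).
have := nm_dist l (u (maxn N M)) l'; rewrite (nmB l (u _)); lra.
Qed.

End Limits.

Lemma nm_complete (E : completeNormedModType C) : seq_complete E.
Proof.
move=> u hu.
have /cauchy_cvgP /cvg_ex [l ul] : cauchy (u n @[n --> \oo]).
  apply: cauchy_exP => eps eps0.
  have [e0 eE] : 0 < re eps /\ eps = (re eps)%:C.
    by move: eps0; case: eps => a b; rewrite ltcE /= => /andP[/eqP -> a0]; split.
  have [N hN] := hu _ e0; exists (u N); exists N => // n /= Nn.
  by rewrite -ball_normE /ball_ /= nmE eE ltcR; apply: hN.
exists l => eps e0.
move/cvgrPdist_lt : ul => /(_ eps%:C); rewrite ltcR => /(_ e0) [N _ hN].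
by exists N => n /hN /=; rewrite nmE ltcR nmB.
Qed.

End RealNorm.

(** * Sesquilinear forms and the Lax-Milgram lemma *)

Section Forms.
Variable R : realType.
Local Notation C := R[i].
Local Notation re := (@complex.Re R).
Local Notation im := (@complex.Im R).

Definition antilinear_form (E : lmodType C) (l : E -> C) : Prop :=
  forall a x y, l (a *: x + y) = Num.conj a * l x + l y.

Definition sesquilinear_form (E : lmodType C) (q : E -> E -> C) : Prop :=
  (forall a x y z, q (a *: x + y) z = a * q x z + q y z) /\
  (forall z, antilinear_form (q z)).

Definition bounded_by (E : normedModType C) (K : R) (q : E -> E -> C) : Prop :=
  forall x y, nm (q x y) <= K * nm x * nm y.

Lemma invS_small (e : R) : 0 < e -> exists N, forall n, (N <= n)%N -> n.+1%:R^-1 < e.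
Proof.
move=> e0; exists (Num.truncn e^-1) => n Nn.
rewrite -[e]invrK ltf_pV2 ?posrE ?invr_gt0 ?ltr0n //.
by apply: lt_le_trans (truncnS_gt _) _; rewrite ler_nat ltnS.
Qed.

Section AntilinearTheory.
Variables (E : lmodType C) (l : E -> C).
Hypothesis hl : antilinear_form l.

Lemma antilinD x y : l (x + y) = l x + l y.
Proof. by have := hl 1 x y; rewrite scale1r rmorph1 mul1r. Qed.
Lemma antilin0 : l 0 = 0.
Proof. by have := antilinD 0 0; rewrite addr0 -{1}[l 0]addr0 => /addrI. Qed.
Lemma antilinZ a x : l (a *: x) = Num.conj a * l x.
Proof. by rewrite -[a *: x]addr0 hl antilin0 addr0. Qed.
Lemma antilinN x : l (- x) = - l x.
Proof. by rewrite -scaleN1r antilinZ rmorphN1 mulN1r. Qed.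
Lemma antilinB x y : l (x - y) = l x - l y.
Proof. by rewrite antilinD antilinN. Qed.
Lemma antilin_sum I (r : seq I) (P : pred I) (F : I -> E) :
  l (\sum_(i <- r | P i) F i) = \sum_(i <- r | P i) l (F i).
Proof. exact: (big_morph _ antilinD antilin0). Qed.
End AntilinearTheory.

Section SesquiTheory.
Variables (E : lmodType C) (q : E -> E -> C).
Hypothesis hq : sesquilinear_form q.

Lemma sesDl x y z : q (x + y) z = q x z + q y z.
Proof. by have := hq.1 1 x y z; rewrite scale1r mul1r. Qed.
Lemma ses0l z : q 0 z = 0.
Proof. by have := sesDl 0 0 z; rewrite addr0 -{1}[q 0 z]addr0 => /addrI. Qed.
Lemma sesZl a x z : q (a *: x) z = a * q x z.
Proof. by rewrite -[a *: x]addr0 hq.1 ses0l addr0. Qed.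
Lemma sesNl x z : q (- x) z = - q x z.
Proof. by rewrite -scaleN1r sesZl mulN1r. Qed.
Lemma sesBl x y z : q (x - y) z = q x z - q y z.
Proof. by rewrite sesDl sesNl. Qed.
Lemma ses_suml I (r : seq I) (P : pred I) (F : I -> E) z :
  q (\sum_(i <- r | P i) F i) z = \sum_(i <- r | P i) q (F i) z.
Proof. exact: (big_morph (q^~ z) (fun x y => sesDl x y z) (ses0l z)). Qed.
Definition sesDr z := antilinD (hq.2 z).
Definition ses0r z := antilin0 (hq.2 z).
Definition sesZr z := antilinZ (hq.2 z).
Definition sesNr z := antilinN (hq.2 z).
Definition sesBr z := antilinB (hq.2 z).
Definition ses_sumr z := antilin_sum (hq.2 z).
End SesquiTheory.

Section Riesz.
Variables (V : completeNormedModType C) (q : V -> V -> C) (c K L : R) (l : V -> C).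
Hypothesis hq : sesquilinear_form q.
Hypothesis q_herm : forall u v, q u v = Num.conj (q v u).
Hypothesis c_gt0 : 0 < c.
Hypothesis q_coercive : forall u, c * nm u ^+ 2 <= re (q u u).
Hypothesis q_bounded : bounded_by K q.
Hypothesis hl : antilinear_form l.
Hypothesis l_bounded : forall u, nm (l u) <= L * nm u.

Let J u := re (q u u) - 2 * re (l u).

Let qD u v : re (q (u + v) (u + v)) = re (q u u) + re (q v v) + 2 * re (q u v).
Proof.
rewrite (sesDl hq) !(sesDr hq) !reD (q_herm v u) re_conj; ring.
Qed.

Let qZ (t : R) u : re (q (t%:C *: u) (t%:C *: u)) = t ^+ 2 * re (q u u).
Proof.
by rewrite (sesZl hq) (sesZr hq) conj_realE !reZ; ring.
Qed.

(** Direct method: a minimizing sequence of [J] is Cauchy by the parallelogram identity and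
    coercivity, and the first-order condition for a minimum passes to its limit. *)
Lemma riesz_representation : exists u, forall w, q u w = l w.
Proof.
have J_lb u : - (L ^+ 2 / c) <= J u.
  have h1 : re (l u) <= L * nm u := le_trans (re_le_nm _) (l_bounded u).
  have h2 := q_coercive u.
  have e : L ^+ 2 / c * c = L ^+ 2 by rewrite divfK ?gt_eqF.
  have : 0 <= c * (nm u - L / c) ^+ 2 by rewrite mulr_ge0 ?sqr_ge0 ?ltW.
  have -> : c * (nm u - L / c) ^+ 2 = c * nm u ^+ 2 - 2 * L * nm u + L ^+ 2 / c.
    by field; rewrite gt_eqF.
  rewrite /J; lra.
pose A := [set J u | u in setT].
have A_inf : has_inf A.
  by split; [exists (J 0), 0 | exists (- (L ^+ 2 / c)) => _ [u _ <-]].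
have inf_le u : inf A <= J u by apply: ge_inf; [exact: A_inf.2 | exists u].
have near_inf n : exists u, J u < inf A + n.+1%:R^-1.
  have n0 : 0 < n.+1%:R^-1 :> R by rewrite invr_gt0 ltr0n.
  by have [_ [u _ <-] ?] := inf_adherent n0 A_inf; exists u.
have [u Ju] := choice near_inf.
(* The infimum of [J] is compared with its value at the midpoint of [u p] and [u n]. *)
have cauchy_u p n : c * nm (u p - u n) ^+ 2 <= 2 * (p.+1%:R^-1 + n.+1%:R^-1).
  have m := inf_le ((1 / 2)%:C *: (u p + u n)).
  apply: le_trans (q_coercive _) _; move: m (Ju p) (Ju n); rewrite /J.
  rewrite qZ qD (antilinZ hl) conj_realE reZ (antilinD hl) reD.
  have -> : re (q (u p - u n) (u p - u n)) =
     re (q (u p) (u p)) + re (q (u n) (u n)) - 2 * re (q (u p) (u n)).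
    by rewrite qD (sesNl hq) !(sesNr hq) opprK reN; ring.
  by move: (p.+1%:R^-1 : R) (n.+1%:R^-1 : R) => a b; lra.
have [v uv] : exists v, seq_lim u v.
  apply: nm_complete => e e0.
  have ce0 : 0 < c * e ^+ 2 / 4 by rewrite divr_gt0 ?mulr_gt0 ?exprn_gt0.
  have [N hN] := invS_small ce0; exists N => m n Nm Nn.
  rewrite -(@ltr_sqr R) ?nnegrE ?nm_ge0 1?ltW //.
  rewrite -(ltr_pM2l c_gt0).
  move: (cauchy_u m n) (hN _ Nm) (hN _ Nn).
  by move: (m.+1%:R^-1 : R) (n.+1%:R^-1 : R) => x y; lra.
exists v => w0.
have key w : re (q v w - l w) = 0.
  set r := re _.
  (* For [n] so large that [J (u n)] is within [s^2] of the infimum and [u n] within [s] of [v],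
     moving [u n] by [- s sg w] leaves only errors of order [s^2]. The sign [sg] is later that of
     [r], and a small [s] forces [r = 0]. *)
  have est s sg : 0 < s -> sg ^+ 2 = 1 ->
      2 * s * (sg * r) <= s ^+ 2 * (re (q w w) + 1 + 2 * (`|K| * nm w)).
    move=> s0 sg1.
    have [N1 hN1] := invS_small (exprn_gt0 2 s0).
    have [N2 hN2] := uv _ s0.
    pose n := maxn N1 N2.
    have h1 := hN1 n (leq_maxl _ _); have h2 := hN2 n (leq_maxr _ _).
    have := inf_le (u n + (- (s * sg))%:C *: w); move: (Ju n); rewrite /J.
    rewrite qD qZ (sesZr hq) (antilinD hl) (antilinZ hl) !conj_realE reD !reZ.
    have -> : (- (s * sg)) ^+ 2 = s ^+ 2 by rewrite sqrrN exprMn sg1 mulr1.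
    have rE : r = re (q (u n) w) - re (l w) - re (q (u n - v) w).
      by rewrite /r reB (sesBl hq) reB; ring.
    have hb : `|re (q (u n - v) w)| <= `|K| * nm w * s.
      apply: le_trans (_ : nm (q (u n - v) w) <= _).
        by rewrite -lecR -nmE; exact: normc_ge_Re.
      apply: (le_trans (q_bounded _ _)).
      apply: le_trans (_ : `|K| * nm (u n - v) * nm w <= _).
        by rewrite ler_wpM2r ?nm_ge0 // ler_wpM2r ?nm_ge0 // ler_norm.
      by rewrite mulrAC ler_wpM2l ?mulr_ge0 ?nm_ge0 // ltW.
    have h3 : - (sg * re (q (u n - v) w)) <= `|K| * nm w * s.
      move: hb; rewrite ler_norml => /andP[hb1 hb2].
      by move/eqP: sg1; rewrite sqrf_eq1 => /orP[/eqP -> | /eqP ->]; lra.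
    have s2 : 0 <= 2 * s by lra.
    move: (ler_wpM2l s2 h3) h1; rewrite rE.
    by move: (n.+1%:R^-1 : R) => x; lra.
  apply/eqP/negPn/negP => r0.
  have M0 : 0 < re (q w w) + 1 + 2 * (`|K| * nm w).
    have : 0 <= re (q w w).
      by apply: le_trans (q_coercive w); rewrite mulr_ge0 ?sqr_ge0 ?ltW.
    have := mulr_ge0 (normr_ge0 K) (nm_ge0 w); lra.
  set M := (X in 0 < X) in M0.
  have r1 : 0 < `|r| by rewrite normr_gt0.
  have := est (`|r| / M) (Num.sg r) (divr_gt0 r1 M0).
  rewrite sqr_sg r0 -normrEsg => /(_ erefl); rewrite -/M.
  have -> : (`|r| / M) ^+ 2 * M = `|r| / M * `|r| by field; rewrite gt_eqF.
  rewrite -subr_ge0 -[_ - _]/(_ + _).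
  have := mulr_gt0 (divr_gt0 r1 M0) r1; lra.
(* Testing with [i w0] recovers the imaginary part. *)
have h1 := key w0; have h2 := key ('i%C *: w0).
apply/eqP; rewrite -subr_eq0 -nm_eq0; apply/eqP/le_anti; rewrite nm_ge0 andbT.
apply: (le_trans (nm_le_re_im _)); rewrite h1 normr0 add0r.
move: h2; rewrite (sesZr hq) (antilinZ hl) -mulrBr reM re_conj im_conj /=.
by rewrite mul0r add0r mulN1r opprK => ->; rewrite normr0.
Qed.
End Riesz.

Section InnerProduct.
Variables (V : normedModType C) (ip : V -> V -> C).
Hypothesis ipS : sesquilinear_form ip.
Hypothesis ip_herm : forall u v, ip u v = Num.conj (ip v u).
Hypothesis ip_norm : forall u, ip u u = (nm u ^+ 2)%:C.

(** Expand the squared norm of [|v|^2 u - (u, v) v] and cancel the factor [|v|^2]. *)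
Lemma cauchy_schwarz u v : nm (ip u v) <= nm u * nm v.
Proof.
have [->|v0] := eqVneq v 0; first by rewrite (ses0r ipS) !nm0 mulr0.
have b0 : 0 < nm v ^+ 2 by rewrite exprn_gt0 // nm_gt0.
set a := ip u v.
have := ip_norm ((nm v ^+ 2)%:C *: u - a *: v).
set w := _ - _; have w0 : 0 <= re (nm w ^+ 2)%:C by exact: sqr_ge0.
move=> h; move: w0; rewrite -h /w.
rewrite (sesBl ipS) !(sesBr ipS) !(sesZl ipS) !(sesZr ipS) conj_realE !ip_norm.
rewrite (ip_herm v u) -/a.
have -> : (nm v ^+ 2)%:C * ((nm v ^+ 2)%:C * (nm u ^+ 2)%:C)
     - (nm v ^+ 2)%:C * (Num.conj a * a)
     - (a * ((nm v ^+ 2)%:C * Num.conj a) - a * (Num.conj a * (nm v ^+ 2)%:C))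
   = (nm v ^+ 2)%:C * ((nm v ^+ 2)%:C * (nm u ^+ 2)%:C) - (nm v ^+ 2)%:C * (a * Num.conj a).
  by ring.
rewrite reB !reZ -nm_sqrE -mulrBr pmulr_rge0 // subr_ge0 => h2.
by rewrite -(@ler_sqr R) ?nnegrE ?mulr_ge0 ?nm_ge0 // exprMn mulrC.
Qed.

Lemma ip_separates x y : (forall w, ip x w = ip y w) -> x = y.
Proof.
move=> h; apply/eqP; rewrite -subr_eq0 -nm_eq0.
have /eqP : nm (x - y) ^+ 2 = 0; last by rewrite expf_eq0.
by apply: complexI; rewrite -ip_norm (sesBl ipS) h subrr.
Qed.
End InnerProduct.

Section LaxMilgram.
Variables (V : completeNormedModType C) (ip m : V -> V -> C) (c K L : R) (l : V -> C).
Hypothesis ipS : sesquilinear_form ip.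
Hypothesis ip_herm : forall u v, ip u v = Num.conj (ip v u).
Hypothesis ip_norm : forall u, ip u u = (nm u ^+ 2)%:C.
Hypothesis mS : sesquilinear_form m.
Hypothesis c_gt0 : 0 < c.
Hypothesis m_coercive : forall u, c * nm u ^+ 2 <= re (m u u).
Hypothesis K_ge0 : 0 <= K.
Hypothesis m_bounded : bounded_by K m.
Hypothesis hl : antilinear_form l.
Hypothesis l_bounded : forall u, nm (l u) <= L * nm u.

Let ip_rep (f : V -> C) (B : R) : antilinear_form f -> (forall u, nm (f u) <= B * nm u) ->
  exists x, forall w, ip x w = f w.
Proof.
move=> hf hB; apply: (@riesz_representation V ip 1 1 B f) => //.
  by move=> u; rewrite ip_norm mul1r.
by move=> u v; rewrite mul1r; exact: cauchy_schwarz.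
Qed.

(* With [T] representing [m], the least-squares problem [T u = h] is solved by
   the Riesz lemma for the form [(T u, T w)]; the residual [z] is then orthogonal
   to [T z], so [re (m z z) = 0]. *)
Lemma lax_milgram : exists u, forall w, m u w = l w.
Proof.
have rep u : exists x, forall w, ip x w = m u w.
  by apply: (ip_rep (mS.2 u)) => w; exact: m_bounded.
have [T hT] := choice rep; have [h hh] := ip_rep hl l_bounded.
have T_lin a x y : T (a *: x + y) = a *: T x + T y.
  apply: (ip_separates ipS ip_norm) => w.
  by rewrite hT mS.1 ipS.1 !hT.
have T_le u : nm (T u) <= K * nm u.
  have [->|T0] := eqVneq (T u) 0; first by rewrite nm0 mulr_ge0 ?nm_ge0.
  rewrite -(@ler_pM2r _ (nm (T u))) ?nm_gt0 // -expr2 -[leLHS]/(re (nm (T u) ^+ 2)%:C).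
  by rewrite -ip_norm hT; apply: le_trans (re_le_nm _) (m_bounded _ _).
have T_ge u : c * nm u <= nm (T u).
  have [->|u0] := eqVneq u 0; first by rewrite nm0 mulr0 nm_ge0.
  have u1 : 0 < nm u by rewrite nm_gt0.
  rewrite -(ler_pM2r u1) -mulrA -expr2; apply: (le_trans (m_coercive u)).
  apply: le_trans (re_le_nm _) _; rewrite -hT.
  exact: cauchy_schwarz.
have [u hu] : exists u, forall w, ip (T u) (T w) = ip h (T w).
  apply: (@riesz_representation V (fun x y => ip (T x) (T y)) (c ^+ 2) (K ^+ 2) (nm h * K)
           (fun w => ip h (T w))) => //.
  - split=> [a x y z|z a x y]; rewrite T_lin; first by rewrite ipS.1.
    by rewrite ipS.2.
  - by rewrite exprn_gt0.
  - move=> x; rewrite ip_norm /= -exprMn ler_sqr ?nnegrE ?nm_ge0 ?mulr_ge0 ?nm_ge0 //.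
    exact: ltW.
  - move=> x y; apply: (le_trans (cauchy_schwarz ipS ip_herm ip_norm _ _)).
    by apply: le_trans (ler_pM _ _ (T_le _) (T_le _)) _; rewrite ?nm_ge0 // mulrACA mulrA.
  - by move=> a x y; rewrite T_lin ipS.2.
  - move=> x; apply: (le_trans (cauchy_schwarz ipS ip_herm ip_norm _ _)).
    by rewrite -mulrA ler_wpM2l ?nm_ge0.
exists u => w; rewrite -hT -hh; suff -> : T u = h by [].
apply/eqP; rewrite -subr_eq0 -nm_eq0; set z := T u - h.
have : re (m z z) = 0.
  by rewrite -hT ip_herm (sesBl ipS) hu subrr rmorph0.
have := m_coercive z => h1 h2; move: h1; rewrite h2.
rewrite pmulr_rle0 // => h3.
have /eqP : nm z ^+ 2 = 0; last by rewrite expf_eq0.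
by apply/le_anti; rewrite h3 sqr_ge0.
Qed.
End LaxMilgram.
End Forms.

(** * Contour integrals as limits of means over roots of unity *)

Section RiemannLipschitz.
Variable R : realType.
Local Notation C := R[i].

Definition clamp (u v x : R) : R := Num.min (Num.max x u) v.

Ltac split_if := repeat match goal with
  |- context [if (?u < ?v)%O then _ else _] =>
    lazymatch u with context [if _ then _ else _] => fail | _ => idtac end;
    case: (ltP u v) => ?
  end.
Ltac clamp_lra := rewrite /clamp !minElt !maxElt; split_if; lra.

Lemma clamp_mono u v x x' : x <= x' -> clamp u v x <= clamp u v x'.
Proof. by move=> h; clamp_lra. Qed.

Lemma clamp_low u v x : x <= u -> u <= v -> clamp u v x = u.
Proof. by move=> h1 h2; rewrite /clamp (max_idPr h1) (min_idPl h2). Qed.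

Lemma clamp_high u v x : v <= x -> u <= v -> clamp u v x = v.
Proof.
by move=> h1 h2; rewrite /clamp (max_idPl (le_trans h2 h1)) (min_idPr h1).
Qed.

(** [clamp (y l) (y l.+1) x - y l] is the length of the part of cell [l] to the left of [x], and
    these lengths add up. *)
Lemma sum_clamp (y : nat -> R) N x :
  (forall l, (l < N)%N -> y l <= y l.+1) ->
  \sum_(l < N) (clamp (y l) (y l.+1) x - y l) = clamp (y 0%N) (y N) x - y 0%N.
Proof.
elim: N => [|N IH] hy.
  rewrite big_ord0 /clamp; case: (leP x (y 0%N)) => h; last first.
    by rewrite minElt; case: ltP; lra.
  by rewrite minxx subrr.
rewrite big_ord_recr /= IH; last by move=> l lN; apply: hy; rewrite ltnS ltnW.
have h0 : y 0%N <= y N.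
  have : forall l, (l <= N)%N -> y 0%N <= y l.
    elim=> // l h lN; apply: le_trans (h (ltnW lN)) _; apply: hy.
    by rewrite ltnS ltnW.
  by apply.
have h1 := hy N (ltnSn N).
clamp_lra.
Qed.

Definition tagged_partition (a b : R) (M : nat) (x tau : nat -> R) (delta : R) :=
  [/\ x 0%N = a, x M = b,
    forall k, (k < M)%N -> x k <= tau k <= x k.+1 &
    forall k, (k < M)%N -> x k.+1 - x k <= delta].

Section Sums.
Variables (E : normedModType C) (f : R -> E) (L a b : R).
Hypothesis ab : a <= b.
Hypothesis L_ge0 : 0 <= L.
Hypothesis f_lip : forall s t, nm (f s - f t) <= L * `|s - t|.

Definition tagged_sum M (x tau : nat -> R) : E :=
  \sum_(k < M) (x k.+1 - x k)%:C *: f (tau k).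

(* The weights [clamp (x k.+1) - clamp (x k)] are the lengths of the overlaps of
   the cells of the two partitions. *)
Lemma tagged_sum_dist M x tau delta N y sigma eta :
  tagged_partition a b M x tau delta -> tagged_partition a b N y sigma eta ->
  nm (tagged_sum M x tau - tagged_sum N y sigma) <= L * (delta + eta) * (b - a).
Proof.
move=> [x0 xM xtau xdelta] [y0 yN ysigma yeta].
have x_mono k : (k < M)%N -> x k <= x k.+1.
  by move=> /xtau/andP[h1 h2]; exact: le_trans h1 h2.
have y_mono k : (k < N)%N -> y k <= y k.+1.
  by move=> /ysigma/andP[h1 h2]; exact: le_trans h1 h2.
have mono (z : nat -> R) P : (forall k, (k < P)%N -> z k <= z k.+1) ->
    forall k, (k <= P)%N -> z 0%N <= z k <= z P.
  move=> hz k kP; apply/andP; split.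
    elim: k kP => // k IH kP; exact: le_trans (IH (ltnW kP)) (hz _ kP).
  suff h i : (k + i <= P)%N -> z k <= z (k + i)%N.
    by have := h (P - k)%N; rewrite subnKC //; exact.
  elim: i => [|i IH]; first by rewrite addn0.
  by rewrite addnS => iP; exact: le_trans (IH (ltnW iP)) (hz _ iP).
pose c l t := clamp (y l) (y l.+1) t.
pose w k l := c l (x k.+1) - c l (x k).
have w_ge0 k l : (k < M)%N -> 0 <= w k l.
  by move=> kM; rewrite subr_ge0; apply: clamp_mono; exact: x_mono.
have w_row k : (k < M)%N -> \sum_(l < N) w k l = x k.+1 - x k.
  move=> kM.
  have h t : \sum_(l < N) c l t = \sum_(l < N) y l + (clamp a b t - a).
    rewrite -y0 -yN -(sum_clamp t y_mono) -big_split /=.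
    by apply: eq_bigr => l _; rewrite addrC subrK.
  rewrite sumrB !h.
  have /andP[h1 h2] := mono x M x_mono k (ltnW kM).
  have /andP[h3 h4] := mono x M x_mono k.+1 kM.
  rewrite x0 xM in h1 h2 h3 h4.
  by rewrite /clamp !(max_idPl _) // !(min_idPl _) //; lra.
have w_col l : (l < N)%N -> \sum_(k < M) w k l = y l.+1 - y l.
  move=> lN; rewrite -(big_mkord xpredT (fun k => w k l)).
  rewrite (telescope_sumr (fun k => c l (x k)) (leq0n M)) x0 xM -y0 -yN.
  have /andP[h1 _] := mono y N y_mono l (ltnW lN).
  have /andP[_ h2] := mono y N y_mono l.+1 lN; have h3 := y_mono _ lN.
  by rewrite /c clamp_high // clamp_low.
have -> : tagged_sum M x tau - tagged_sum N y sigma =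
    \sum_(k < M) \sum_(l < N) (w k l)%:C *: (f (tau k) - f (sigma l)).
  rewrite /tagged_sum.
  under [in RHS]eq_bigr do under eq_bigr do rewrite scalerBr.
  under [in RHS]eq_bigr do rewrite sumrB.
  rewrite sumrB; congr (_ - _).
    apply: eq_bigr => k _; rewrite -scaler_suml -w_row // rmorph_sum //.
  rewrite exchange_big /=.
  by apply: eq_bigr => l _; rewrite -scaler_suml -w_col // rmorph_sum.
have -> : b - a = \sum_(k < M) \sum_(l < N) w k l.
  transitivity (\sum_(k < M) (x k.+1 - x k)); last by apply: eq_bigr => k _; rewrite w_row.
  by rewrite -(big_mkord xpredT (fun k => x k.+1 - x k)) telescope_sumr // x0 xM.
rewrite mulr_sumr; apply: (le_trans (nm_sum _ _ _)); apply: ler_sum => k _.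
rewrite mulr_sumr; apply: (le_trans (nm_sum _ _ _)); apply: ler_sum => l _.
rewrite nmZ nmC ger0_norm ?w_ge0 // mulrC.
have [w0|w_neq0] := eqVneq (w k l) 0; first by rewrite w0 !mulr0.
apply: ler_wpM2r; first exact: w_ge0.
apply: (le_trans (f_lip _ _)); apply: ler_wpM2l => //.
have /andP[t1 t2] := xtau _ (ltn_ord k); have dk := xdelta _ (ltn_ord k).
have /andP[s1 s2] := ysigma _ (ltn_ord l); have el := yeta _ (ltn_ord l).
(* A nonzero weight means that the two cells meet, so their tags are at most [delta + eta] apart. *)
have ov : (y l <= x k.+1) && (x k <= y l.+1).
  apply: contraT; rewrite negb_and -!ltNge => h.
  case/negP: w_neq0; apply/eqP; rewrite /w /c.
  have hx := x_mono _ (ltn_ord k); have hy := y_mono _ (ltn_ord l).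
  case/orP: h => /ltW h.
    by rewrite !clamp_low ?subrr // (le_trans hx).
  by rewrite !clamp_high ?subrr // (le_trans h).
case/andP: ov => o1 o2; rewrite ler_norml; apply/andP; split; lra.
Qed.

End Sums.

Definition unif (a b : R) (n k : nat) : R := a + (b - a) * k%:R / n.+1%:R.

Lemma unif_partition a b n : a <= b ->
  tagged_partition a b n.+1 (unif a b n) (unif a b n) ((b - a) / n.+1%:R).
Proof.
move=> ab; have n0 : 0 < n.+1%:R :> R by rewrite ltr0n.
have step k : unif a b n k.+1 = unif a b n k + (b - a) / n.+1%:R.
  rewrite /unif -[k.+1%:R]natr1; move: (n.+1%:R : R) n0 => N N0.
  by field; exact: lt0r_neq0.
have d0 : 0 <= (b - a) / n.+1%:R by rewrite divr_ge0 ?subr_ge0 ?ler0n.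
split.
- by rewrite /unif mulr0 mul0r addr0.
- by rewrite /unif mulfK ?gt_eqF // addrC subrK.
- by move=> k _; rewrite step lexx lerDl.
- by move=> k _; rewrite step addrAC subrr add0r.
Qed.

Definition unif_sum (E : normedModType C) (f : R -> E) a b n : E :=
  ((b - a) / n.+1%:R)%:C *: \sum_(k < n.+1) f (unif a b n k).

Lemma unif_sumE (E : normedModType C) (f : R -> E) a b n :
  unif_sum f a b n = tagged_sum f n.+1 (unif a b n) (unif a b n).
Proof.
rewrite /unif_sum scaler_sumr; apply: eq_bigr => k _; congr (_%:C *: _).
have n0 : 0 < n.+1%:R :> R by rewrite ltr0n.
rewrite /unif -[(nat_of_ord k).+1%:R]natr1; move: (n.+1%:R : R) n0 => N N0.
by field; exact: lt0r_neq0.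
Qed.

Section Integral.
Variables (E : normedModType C) (f : R -> E) (a b : R).
Hypothesis ab : a < b.

Lemma is_riemann_integral_unif I :
  is_riemann_integral f a b I -> seq_lim (unif_sum f a b) I.
Proof.
move=> hI e e0; have [delta d0 hd] := hI e e0.
have ba : 0 < b - a by rewrite subr_gt0.
have [N hN] := invS_small (divr_gt0 d0 ba); exists N => n /hN hn.
pose s := mkseq (fun k => unif a b n k.+1) n.+1.
have sz : size s = n.+1 by rewrite size_mkseq.
have u0 : unif a b n 0 = a by rewrite /unif mulr0 mul0r addr0.
have ns k : (k < n.+1)%N -> nth a s k = unif a b n k.+1 by move=> kn; rewrite nth_mkseq.
have nas k : (k <= n.+1)%N -> nth a (a :: s) k = unif a b n k.
  by case: k => [|k] // kn; rewrite /= ns.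
have n0 : 0 < n.+1%:R :> R by rewrite ltr0n.
have step k : unif a b n k.+1 - unif a b n k = (b - a) / n.+1%:R.
  rewrite /unif -[k.+1%:R]natr1; move: (n.+1%:R : R) n0 => P P0.
  by field; exact: lt0r_neq0.
have h0 : 0 < (b - a) / n.+1%:R by rewrite divr_gt0.
have := hd s (unif a b n).
have -> : riemann_sum f a s (unif a b n) = unif_sum f a b n.
  rewrite /riemann_sum sz big_mkord unif_sumE; apply: eq_bigr => k _.
  by rewrite ns // nas // ltnW.
rewrite nmE ltcR; apply.
  split.
    apply/(pathP a) => k; rewrite sz => kn; rewrite ns // nas; last exact: ltnW.
    by rewrite -subr_gt0 step.
  have -> : last a s = nth a (a :: s) (size s) by rewrite -last_nth.
  rewrite nas ?sz // /unif mulfK; last exact: lt0r_neq0.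
  by apply/eqP; ring.
move=> k; rewrite sz => kn; rewrite ns // nas; last exact: ltnW.
rewrite step lexx /= -subr_ge0 step ltW //; split=> //.
by rewrite mulrC -ltr_pdivlMr.
Qed.

Lemma riemann_integralE I : is_riemann_integral f a b I -> riemann_integral f a b = I.
Proof.
move=> hI; have h : is_riemann_integral f a b (riemann_integral f a b).
  by apply: (@getPex _ [set J | is_riemann_integral f a b J]); exists I.
exact: seq_lim_unique (is_riemann_integral_unif h) (is_riemann_integral_unif hI).
Qed.

(** Comparing tagged sums makes the uniform sums a Cauchy sequence, and then brings every sum of
    small mesh close to their limit. *)
Lemma riemann_integral_lipschitz L : seq_complete E -> 0 <= L ->
  (forall s t, nm (f s - f t) <= L * `|s - t|) ->
  seq_lim (unif_sum f a b) (riemann_integral f a b).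
Proof.
move=> E_complete L0 f_lip; have ba : 0 < b - a by rewrite subr_gt0.
have ab' := ltW ab.
have close M x tau delta n : tagged_partition a b M x tau delta ->
    nm (tagged_sum f M x tau - unif_sum f a b n) <=
    L * (b - a) * delta + L * (b - a) ^+ 2 * n.+1%:R^-1.
  move=> hp; rewrite unif_sumE.
  apply: le_trans (tagged_sum_dist L0 f_lip hp (unif_partition n ab')) _.
  by rewrite le_eqVlt; apply/orP; left; apply/eqP; ring.
(* The summand [1] keeps the divisor positive when [L = 0]; the same device recurs below. *)
pose K := L * (b - a) ^+ 2 + 1.
have K0 : 0 < K by rewrite ltr_wpDl // mulr_ge0 // sqr_ge0.
have small e : 0 < e -> exists N, forall n, (N <= n)%N ->
    L * (b - a) ^+ 2 * n.+1%:R^-1 < e.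
  move=> e0; have [N hN] := invS_small (divr_gt0 e0 K0); exists N => n /hN.
  rewrite ltr_pdivlMr // => h; apply: le_lt_trans h.
  by rewrite mulrC ler_wpM2l ?invr_ge0 // lerDl.
have [I hI] : exists I, seq_lim (unif_sum f a b) I.
  apply: E_complete => e e0; have e2 : 0 < e / 2 by rewrite divr_gt0.
  have [N hN] := small _ e2; exists N => m n /hN hm /hN hn.
  have := close _ _ _ _ n (unif_partition m ab'); rewrite -unif_sumE mulrA.
  move=> h; apply: (le_lt_trans h).
  rewrite -[L * (b - a) * (b - a)]mulrA -expr2 [ltRHS]splitr; exact: ltrD.
suff hI' : is_riemann_integral f a b I by rewrite (riemann_integralE hI').
move=> e e0; have e4 : 0 < e / 4 by rewrite divr_gt0.
have k0 : 0 < L * (b - a) + 1 by rewrite ltr_wpDl // mulr_ge0 // ltW.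
exists (e / 4 / (L * (b - a) + 1)); first by rewrite divr_gt0.
move=> s tag [ps /eqP ls] hs; rewrite nmE ltcR.
have [N1 hN1] := small _ e4; have [N2 hN2] := hI _ e4.
pose n := maxn N1 N2.
have h1 := hN1 n (leq_maxl _ _); have h2 := hN2 n (leq_maxr _ _).
have hp : tagged_partition a b (size s) (nth a (a :: s)) tag (e / 4 / (L * (b - a) + 1)).
  split=> //; first by rewrite -last_nth ls.
    by move=> k /hs[_]; rewrite /=.
  by move=> k /hs[/ltW]; rewrite /=.
have h3 := close _ _ _ _ n hp.
have h4 : L * (b - a) * (e / 4 / (L * (b - a) + 1)) <= e / 4.
  rewrite mulrCA; apply: ler_piMr; first exact: ltW.
  by rewrite ler_pdivrMr // mul1r lerDl.
have -> : riemann_sum f a s tag = tagged_sum f (size s) (nth a (a :: s)) tag.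
  by rewrite /riemann_sum big_mkord; apply: eq_bigr => k _.
apply: le_lt_trans (nm_dist _ (unif_sum f a b n) _) _.
move: h1 h2 h3 h4; move: (nm _) (nm _) (L * _ * _^-1) (L * _ * (_ / _)) => p q r t.
lra.
Qed.
End Integral.
End RiemannLipschitz.

Section CircleAverages.
Variable R : realType.
Local Notation C := R[i].
Local Notation re := (@complex.Re R).
Local Notation im := (@complex.Im R).

Definition circ (t : R) : C := cos t +i* sin t.

Lemma circD s t : circ (s + t) = circ s * circ t.
Proof.
by apply/eqP; rewrite eq_complex /= cosD sinD eqxx /= addrC; apply/eqP; ring.
Qed.

Lemma circ0 : circ 0 = 1. Proof. by rewrite /circ cos0 sin0. Qed.

Lemma circ2pi : circ (2 * pi) = 1.
Proof. by rewrite /circ mulr_natl cos2pi sin2pi. Qed.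

Lemma nm_circ t : nm (circ t) = 1.
Proof.
have h : nm (circ t) ^+ 2 = 1 by rewrite nm_sqr /= cos2Dsin2.
by apply/eqP; rewrite -(@eqrXn2 _ 2) ?nm_ge0 ?ler01 // h expr1n.
Qed.

Lemma sin_lipschitz (x y : R) : `|sin x - sin y| <= `|x - y|.
Proof.
wlog xy : x y / y <= x.
  by move=> h; have [/h //|/ltW/h] := leP y x; rewrite distrC [leRHS]distrC.
have [c _ ->] := @MVT_segment R sin cos y x xy (fun z _ => is_derive_sin z)
  (continuous_subspaceT (@continuous_sin R)).
by rewrite normrM; apply: ler_piMl => //; exact: cos_max.
Qed.

Lemma circ_lipschitz s t : nm (circ s - circ t) <= 2 * `|s - t|.
Proof.
apply: le_trans (nm_le_re_im _) _; rewrite /= mulr_natl mulr2n.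
apply: lerD; last exact: sin_lipschitz.
rewrite -!sinDpihalf; apply: le_trans (sin_lipschitz _ _) _.
by rewrite opprD addrACA subrr addr0.
Qed.

(** The [(n+1)]-st roots of unity in counterclockwise order, placed at the tags of the uniform
    Riemann sum over [[0, 2 pi]]. *)
Definition node (n k : nat) : C := circ (unif 0 (2 * pi) n k).

Lemma nodeE n k : node n k = circ (2 * pi * k%:R / n.+1%:R).
Proof. by rewrite /node /unif add0r subr0. Qed.

Lemma node0 n : node n 0%N = 1. Proof. by rewrite nodeE mulr0 mul0r circ0. Qed.

Lemma nodeX n k : node n k = node n 1%N ^+ k.
Proof.
elim: k => [|k IH]; first by rewrite node0.
rewrite exprS -IH !nodeE -circD; congr circ.
by rewrite -mulrDl -mulrDr -natrD add1n.
Qed.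

Lemma node_period n : node n n.+1 = 1.
Proof. by rewrite nodeE mulfK ?circ2pi // pnatr_eq0. Qed.

Lemma nm_node n k : nm (node n k) = 1. Proof. exact: nm_circ. Qed.

(** With [x = pi q / (n+1)] in [(0, pi)] one has [cos (2 x) = 1 - 2 sin^2 x < 1]. *)
Lemma node_neq1 n q : (0 < q <= n)%N -> node n q != 1.
Proof.
move=> /andP[q0 qn]; rewrite nodeE; apply/eqP => /(congr1 re) /=.
pose x : R := pi * (q%:R / n.+1%:R).
have -> : 2 * pi * q%:R / n.+1%:R = x *+ 2 by rewrite /x -mulr_natl; ring.
have n0 : 0 < n.+1%:R :> R by rewrite ltr0n.
have s0 : 0 < sin x.
  apply: sin_gt0_pi; rewrite /x mulr_gt0 ?pi_gt0 ?divr_gt0 ?ltr0n //=.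
  by rewrite gtr_pMr ?pi_gt0 // ltr_pdivrMr // mul1r ltr_nat ltnS.
rewrite cos_mulr2n -mulr_natl => h; have := cos2Dsin2 x.
have := exprn_gt0 2 s0; lra.
Qed.

(** A geometric sum whose ratio [node n q] is a root of unity other than [1]. *)
Lemma sum_node_pow n q : (0 < q <= n)%N -> \sum_(k < n.+1) node n k ^+ q = 0.
Proof.
move=> hq; have := subrX1 (node n q) n.+1.
have -> : node n q ^+ n.+1 = 1 by rewrite nodeX exprAC -(nodeX n n.+1) node_period expr1n.
rewrite subrr => /esym/eqP; rewrite mulf_eq0 subr_eq0 (negbTE (node_neq1 hq)) /=.
move=> /eqP h; rewrite -[RHS]h.
by apply: eq_bigr => k _; rewrite [node n k]nodeX [node n q]nodeX exprAC.
Qed.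

Lemma sum_node_powV n q : (0 < q <= n)%N -> \sum_(k < n.+1) (node n k)^-1 ^+ q = 0.
Proof.
move=> hq; have h0 : Num.conj (\sum_(k < n.+1) node n k ^+ q) = 0.
  by rewrite sum_node_pow // rmorph0.
rewrite -[RHS]h0 rmorph_sum; apply: eq_bigr => k _ /=; rewrite rmorphXn /=; congr (_ ^+ _).
have h : node n k * Num.conj (node n k) = 1 by rewrite -normCK nmE nm_node expr1n.
have n0 : node n k != 0 by rewrite -nm_eq0 nm_node oner_neq0.
by apply: (mulfI n0); rewrite mulfV.
Qed.

(** For [g w = w *: F (c + w)] this discretizes the integral of [F] over the circle of radius [s]
    about [c], divided by [2 pi i]. *)
Definition avg (E : lmodType C) (n : nat) (g : C -> E) (s : R) : E :=
  n.+1%:R^-1 *: \sum_(k < n.+1) g (s%:C * node n k).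

Lemma avgD (E : lmodType C) n (g h : C -> E) s :
  avg n (fun w => g w + h w) s = avg n g s + avg n h s.
Proof. by rewrite /avg big_split scalerDr. Qed.

Lemma avg_linear (E F : lmodType C) (f : E -> F) n (g : C -> E) s :
  linear f -> avg n (fun w => f (g w)) s = f (avg n g s).
Proof.
move=> hf; pose f' : {linear E -> F} := HB.pack f (GRing.isLinear.Build _ _ _ _ f hf).
by rewrite -[f (avg _ _ _)]/(f' (avg n g s)) /avg linearZ (linear_sum f').
Qed.

Lemma eq_avg (E : lmodType C) n (g h : C -> E) (s : R) : 0 <= s ->
  (forall w, nm w = s -> g w = h w) -> avg n g s = avg n h s.
Proof.
move=> s0 gh; congr (_ *: _); apply: eq_bigr => k _; apply: gh.
by rewrite nmM nm_node nmC ger0_norm ?mulr1.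
Qed.

Lemma avg0r (E : lmodType C) n (g : C -> E) : avg n g 0 = g 0.
Proof.
rewrite /avg; under eq_bigr do rewrite mul0r.
by rewrite sumr_const card_ord -[g 0 *+ _]scaler_nat scalerA mulVf ?scale1r // pnatr_eq0.
Qed.

Lemma nm_avg (E : normedModType C) n (h : 'I_n.+1 -> E) B :
  (forall k, nm (h k) <= B) -> nm ((n.+1%:R^-1 : C) *: \sum_k h k) <= B.
Proof.
move=> hB; rewrite nmZ.
have -> : (n.+1%:R^-1 : C) = (n.+1%:R^-1)%:C by rewrite fmorphV rmorph_nat.
rewrite nmC ger0_norm ?invr_ge0 ?ler0n // mulrC ler_pdivrMr ?ltr0n //.
apply: le_trans (nm_sum _ _ _) _; apply: le_trans (ler_sum _ (fun k _ => hB k)) _.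
by rewrite sumr_const card_ord mulr_natr.
Qed.

Section Contour.
Variables (E : normedModType C) (g g' : C -> E) (K s0 s1 : R).
Hypothesis K_ge0 : 0 <= K.
Hypothesis s0_ge0 : 0 <= s0.
Hypothesis g_taylor : forall v w : C, s0 <= nm v <= s1 -> s0 <= nm w <= s1 ->
  nm (g v - g w - (v - w) *: g' w) <= K * nm (v - w) ^+ 2.

(** To first order the difference is [- (s' - s) G], with [G] the mean of [w g'(s' w)] over the
    nodes. Up to a factor, [G] is a discrete integral of [g'] around the circle: the increments of
    [g] between adjacent nodes telescope to zero, so only the Taylor remainders contribute to it. *)
Lemma avg_step n s s' : (0 < n)%N -> s0 <= s -> s <= s' -> s' <= s1 -> 0 < s' ->
  nm (avg n g s - avg n g s') <=
  K * (s' - s) ^+ 2 + (s' - s) * (K * s' * nm (node n 1%N - 1)).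
Proof.
move=> n0 h0 h1 h2 s'0; set d := nm (node n 1%N - 1).
have s_ge0 : 0 <= s by apply: le_trans h0.
have s'1 := ltW s'0.
have nmn t k : 0 <= t -> nm (t%:C * node n k) = t.
  by move=> t0; rewrite nmM nm_node nmC ger0_norm ?mulr1.
pose G := (n.+1%:R^-1 : C) *: \sum_(k < n.+1) (node n k *: g' (s'%:C * node n k)).
have G_le : nm G <= K * s' * d.
  have d0 : 0 < d by rewrite /d nm_gt0 subr_eq0; apply: node_neq1; rewrite n0.
  have := @nm_avg E n (fun k => g (s'%:C * node n k.+1) - g (s'%:C * node n k)
      - (s'%:C * node n k.+1 - s'%:C * node n k) *: g' (s'%:C * node n k))
      (K * (s' * d) ^+ 2).
  have -> : \sum_(k < n.+1) (g (s'%:C * node n k.+1) - g (s'%:C * node n k)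
      - (s'%:C * node n k.+1 - s'%:C * node n k) *: g' (s'%:C * node n k)) =
      - (s'%:C * (node n 1%N - 1)) *: \sum_(k < n.+1) (node n k *: g' (s'%:C * node n k)).
    rewrite sumrB -(big_mkord xpredT
      (fun k => g (s'%:C * node n k.+1) - g (s'%:C * node n k))) telescope_sumr //.
    rewrite node0 node_period subrr sub0r scaleNr scaler_sumr; congr (- _).
    apply: eq_bigr => k _; rewrite scalerA; congr (_ *: _).
    by rewrite [node n k.+1]nodeX exprS -nodeX; ring.
  have e a : (n.+1%:R^-1 : C) *: (a *: \sum_(k < n.+1) (node n k *: g' (s'%:C * node n k)))
      = a *: G by rewrite /G !scalerA mulrC.
  rewrite e nmZ nmN [nm (s'%:C * (_ - _))]nmM nmC ger0_norm // -/d => h.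
  have p0 : 0 < s' * d by rewrite mulr_gt0.
  rewrite -(ler_pM2l p0).
  have -> : s' * d * (K * s' * d) = K * (s' * d) ^+ 2 by ring.
  apply: h => k.
  have h3 : s'%:C * node n k.+1 - s'%:C * node n k = s'%:C * node n k * (node n 1%N - 1).
    by rewrite [node n k.+1]nodeX exprS -nodeX; ring.
  apply: le_trans (g_taylor _ _) _; rewrite ?nmn ?(ltW s'0) ?h2 ?(le_trans h0) //.
  by rewrite h3 nmM nmn.
have -> : avg n g s - avg n g s' =
   (n.+1%:R^-1 : C) *: \sum_(k < n.+1) (g (s%:C * node n k) - g (s'%:C * node n k)
      - (s%:C * node n k - s'%:C * node n k) *: g' (s'%:C * node n k))
   - (s' - s)%:C *: G.
  have e : (n.+1%:R^-1 : C) *: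
      \sum_(k < n.+1) (s%:C * node n k - s'%:C * node n k) *: g' (s'%:C * node n k)
      = - ((s' - s)%:C *: G).
    rewrite /G scalerA [(s' - s)%:C * _]mulrC -scalerA -scalerN; congr (_ *: _).
    rewrite scaler_sumr -sumrN.
    apply: eq_bigr => k _; rewrite scalerA -scaleNr; congr (_ *: _).
    by rewrite rmorphB /=; ring.
  by rewrite sumrB scalerBr e opprK addrK sumrB scalerBr.
apply: le_trans (nm_triangleB _ _) _; apply: lerD.
  apply: nm_avg => k; apply: le_trans (g_taylor _ _) _; rewrite ?nmn ?(ltW s'0) ?h2 ?h0 ?(le_trans h0) ?(le_trans h1) //.
  rewrite -mulrBl nmM nm_node mulr1 -rmorphB /= nmC.
  by rewrite distrC ger0_norm ?subr_ge0.
rewrite nmZ nmC ger0_norm ?subr_ge0 //.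
by apply: ler_wpM2l; rewrite ?subr_ge0.
Qed.

(** Passing from [s0] to [s1] in [m + 1] equal steps makes the quadratic terms of [avg_step] add up
    to [O(1/m)], and [m] is arbitrary. *)
Lemma avg_contour n : (0 < n)%N -> s0 <= s1 ->
  nm (avg n g s0 - avg n g s1) <= (s1 - s0) * (K * s1 * nm (node n 1%N - 1)).
Proof.
move=> n0; rewrite le_eqVlt => /orP[/eqP ->|s01].
  by rewrite subrr nm0 subrr mul0r.
have s10 : 0 < s1 by apply: le_lt_trans s01.
set D := K * s1 * _.
have D0 : 0 <= D by rewrite !mulr_ge0 ?nm_ge0 // ltW.
have step m : nm (avg n g s0 - avg n g s1) <=
    (s1 - s0) * D + K * (s1 - s0) ^+ 2 * m.+1%:R^-1.
  have m0 : 0 < m.+1%:R :> R by rewrite ltr0n.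
  pose h := (s1 - s0) / m.+1%:R; have h0 : 0 < h by rewrite divr_gt0 ?subr_gt0.
  have m1 : s0 + m.+1%:R * h = s1 by rewrite mulrC divfK ?gt_eqF // addrC subrK.
  have ind i : (i <= m.+1)%N ->
      nm (avg n g s0 - avg n g (s0 + i%:R * h)) <= i%:R * (K * h ^+ 2 + h * D).
    elim: i => [|i IH] im; first by rewrite !mul0r addr0 subrr nm0.
    apply: le_trans (nm_dist _ (avg n g (s0 + i%:R * h)) _) _.
    rewrite -natr1 [leRHS]mulrDl mul1r; apply: lerD; first exact: IH (ltnW im).
    have ih0 : 0 <= i%:R * h by rewrite mulr_ge0 ?ler0n ?ltW.
    have ih1 : s0 + (i%:R + 1) * h <= s1.
      by rewrite -m1 lerD2l natr1 ler_wpM2r ?ler_nat // ltW.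
    have e : s0 + (i%:R + 1) * h - (s0 + i%:R * h) = h by ring.
    apply: le_trans (avg_step n0 _ _ ih1 _) _.
    - by rewrite lerDl.
    - by rewrite -subr_ge0 e ltW.
    - by rewrite mulrDl mul1r ltr_wpDl // ltr_wpDl.
    rewrite e lerD2l; apply: ler_wpM2l; first exact: ltW.
    apply: ler_wpM2r; first exact: nm_ge0.
    by apply: ler_wpM2l.
  have := ind m.+1 (leqnn _); rewrite m1 => H; apply: (le_trans H).
  rewrite le_eqVlt; apply/orP; left; apply/eqP; rewrite /h.
  by move: (m.+1%:R : R) m0 => P P0; field; exact: lt0r_neq0.
apply/ler_addgt0Pr => e e0.
have K1 : 0 < K * (s1 - s0) ^+ 2 + 1 by rewrite ltr_wpDl // mulr_ge0 // sqr_ge0.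
have [m /(_ m (leqnn m))] := invS_small (divr_gt0 e0 K1).
rewrite ltr_pdivlMr // => hm; apply: le_trans (step m) _; rewrite lerD2l.
apply: le_trans (ltW hm); rewrite [leRHS]mulrC ler_wpM2r ?invr_ge0 ?ler0n //.
by rewrite lerDl.
Qed.

Lemma avg_contour_lim eps : s0 <= s1 -> 0 < eps ->
  exists N, forall n, (N <= n)%N -> nm (avg n g s0 - avg n g s1) < eps.
Proof.
move=> s01 e0; have s1_ge0 : 0 <= s1 by apply: le_trans s01.
pose B := (s1 - s0) * (K * s1).
have B0 : 0 <= B by rewrite !mulr_ge0 ?subr_ge0.
have pi4 : 0 < 4 * pi * (B + 1) by rewrite !mulr_gt0 ?pi_gt0 // ltr_wpDl.
have [N hN] := invS_small (divr_gt0 e0 pi4); exists N.+1 => n Nn.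
have n0 : (0 < n)%N by apply: leq_trans Nn.
apply: le_lt_trans (avg_contour n0 s01) _.
have h1 : nm (node n 1%N - 1) <= 4 * pi * n.+1%:R^-1.
  rewrite -circ0 nodeE; apply: le_trans (circ_lipschitz _ _) _.
  rewrite subr0 mulr1 ger0_norm ?divr_ge0 ?mulr_ge0 ?pi_ge0 ?ler0n //.
  by rewrite le_eqVlt; apply/orP; left; apply/eqP; ring.
have h2 := hN n (ltnW Nn); rewrite ltr_pdivlMr // in h2.
apply: le_lt_trans h2.
have -> : (s1 - s0) * (K * s1 * nm (node n 1%N - 1)) = B * nm (node n 1%N - 1).
  by rewrite /B; ring.
apply: le_trans (_ : B * (4 * pi * n.+1%:R^-1) <= _); first by apply: ler_wpM2l.
have -> : n.+1%:R^-1 * (4 * pi * (B + 1)) = (B + 1) * (4 * pi * n.+1%:R^-1) by ring.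
by apply: ler_wpM2r; rewrite ?lerDl // !mulr_ge0 ?pi_ge0 ?invr_ge0 ?ler0n.
Qed.

End Contour.

(** The uniform Riemann sum of [i w F (c + w)] over [[0, 2 pi]] is exactly [2 pi i] times the mean;
    the two bounds on [F] make this integrand Lipschitz in the angle. *)
Lemma circle_integral_avg (E : normedModType C) (F : C -> E) c (r L B : R) :
  seq_complete E -> 0 < r -> 0 <= L -> 0 <= B ->
  (forall v w : C, nm v = r -> nm w = r -> nm (F (c + v) - F (c + w)) <= L * nm (v - w)) ->
  (forall v : C, nm v = r -> nm (F (c + v)) <= B) ->
  seq_lim (fun n => avg n (fun w => w *: F (c + w)) r)
    (((2 * pi)%:C * 'i%C)^-1 *: circle_integral F c r).
Proof.
move=> E_complete r0 L0 B0 F_lip F_le.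
have r1 := ltW r0.
have pi2 : 0 < 2 * pi :> R by rewrite mulr_gt0 ?pi_gt0.
pose f (t : R) := let w := r%:C * circ t in ('i%C * w) *: F (c + w).
have nmw t : nm (r%:C * circ t) = r by rewrite nmM nm_circ nmC ger0_norm ?mulr1 // ltW.
have nmi : nm ('i%C : C) = 1.
  by apply/eqP; rewrite -(@eqrXn2 _ 2) ?nm_ge0 ?ler01 // nm_sqr /= expr0n add0r !expr1n.
have f_lip s t : nm (f s - f t) <= ((B + r * L) * (r * 2)) * `|s - t|.
  have -> : f s - f t = ('i%C * (r%:C * circ s - r%:C * circ t)) *: F (c + r%:C * circ s)
     + ('i%C * (r%:C * circ t)) *: (F (c + r%:C * circ s) - F (c + r%:C * circ t)).
    by rewrite /f /= scalerBr addrA -scalerDl; congr (_ *: _ - _); ring.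
  have dw : nm (r%:C * circ s - r%:C * circ t) <= r * (2 * `|s - t|).
    rewrite -mulrBr nmM nmC ger0_norm //.
    by apply: ler_wpM2l; [exact: ltW | exact: circ_lipschitz].
  apply: le_trans (nm_triangle _ _) _; rewrite !nmZ ![nm ('i%C * _)]nmM nmi !mul1r nmw.
  have -> : (B + r * L) * (r * 2) * `|s - t| =
     r * (2 * `|s - t|) * B + r * (L * (r * (2 * `|s - t|))) by ring.
  apply: lerD.
    by apply: ler_pM; rewrite ?nm_ge0 //; exact: F_le.
  apply: ler_wpM2l; first exact: ltW.
  apply: le_trans (F_lip _ _ _ _) _ => //.
  by apply: ler_wpM2l.
have lim := @riemann_integral_lipschitz _ _ f _ _ pi2 _ E_complete _ f_lip.
have {}lim : seq_lim (unif_sum f 0 (2 * pi)) (circle_integral F c r).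
  by apply: lim; rewrite !mulr_ge0 // addr_ge0 // mulr_ge0.
set a := (2 * pi)%:C * 'i%C.
have nma : nm a = 2 * pi by rewrite nmM nmi nmC ger0_norm ?mulr1 // ltW.
have a0 : a != 0 by rewrite -nm_eq0 nma gt_eqF.
move=> e e0; have [N hN] := lim _ (mulr_gt0 pi2 e0); exists N => n /hN.
have -> : unif_sum f 0 (2 * pi) n = a *: avg n (fun w => w *: F (c + w)) r.
  rewrite /unif_sum /avg !scaler_sumr; apply: eq_bigr => k _.
  rewrite /f /= !scalerA; congr (_ *: _); rewrite -/(node n k) subr0 rmorphM fmorphV rmorph_nat /a.
  by ring.
set u := avg _ _ _; set I := circle_integral _ _ _.
have -> : a *: u - I = a *: (u - a^-1 *: I) by rewrite scalerBr [a *: (a^-1 *: _)]scalerA mulfV // scale1r.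
by rewrite nmZ nma ltr_pM2l.
Qed.

End CircleAverages.

(** * Finite-dimensional linear algebra *)

Section Lyapunov.
Variable R : realType.
Local Notation C := R[i].
Local Notation re := (@complex.Re R).

Lemma trig_shift_unit m (B : 'M[C]_m) (z : C) : is_trig_mx B ->
  (forall i, 0 < re (B i i)) -> 0 < re z -> B + (Num.conj z)%:M \in unitmx.
Proof.
move=> /is_trig_mxP hB hd z0; rewrite unitmxE det_trig; last first.
  apply/is_trig_mxP => i j ij; rewrite !mxE hB // add0r.
  by rewrite -val_eqE ltn_eqF // mulr0n.
rewrite unitfE; apply/prodf_neq0 => i _; rewrite !mxE eqxx mulr1n.
apply/negP => /eqP/(congr1 re); rewrite reD re_conj /= => h.
by have := hd i; rewrite lt_neqAle; lra.
Qed.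

(** Induction on the size, splitting off the left eigenvector [e0] of the lower triangular [B]. On a
    complement that is [E]-orthogonal to [e0], a graph over the remaining coordinates, the
    inequality descends to the block [B']. *)
Lemma lyapunov_trig m (B : 'M[C]_m) (E : 'rV[C]_m -> 'rV[C]_m -> C) :
  sesquilinear_form E -> (forall u v, E u v = Num.conj (E v u)) ->
  is_trig_mx B -> (forall i, 0 < re (B i i)) ->
  (forall y, re (E (y *m B) y) <= 0) -> forall y, re (E y y) <= 0.
Proof.
elim: m => [|m IH] in B E * => ES EH tB dB hB y.
  by rewrite thinmx0 (ses0l ES).
have tBP := tB; rewrite -[m.+1]/(1 + m)%N in B E ES EH tB tBP dB hB y *.
move/is_trig_mxP in tBP.
pose z := B 0 0; have z0 : 0 < re z := dB 0.
pose e0 : 'rV[C]_(1 + m) := row_mx 1%:M 0.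
pose c := dlsubmx B; pose B' := drsubmx B.
have BE (b : 'rV[C]_1) (x : 'rV[C]_m) : row_mx b x *m B = row_mx (z *: b + x *m c) (x *m B').
  rewrite -[B]submxK mul_row_block.
  have -> : ulsubmx B = z%:M.
    by apply/matrixP => i j; rewrite !ord1 !mxE eqxx mulr1n; congr (B _ _); apply/val_inj.
  have -> : ursubmx B = 0.
    by apply/matrixP => i j; rewrite !mxE; apply: tBP; rewrite /= ord1.
  by rewrite mulmx0 add0r mul_mx_scalar.
have e0E : e0 *m B = z *: e0.
  by rewrite BE !mul0mx addr0 scale_row_mx scaler0.
have tB' : is_trig_mx B'.
  by apply/is_trig_mxP => i j ij; rewrite !mxE; apply: tBP; rewrite /= !ltn_add2l.
have dB' i : 0 < re (B' i i) by rewrite !mxE; exact: dB.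
pose p := re (E e0 e0).
have pE : E e0 e0 = p%:C by apply: herm_real; exact: EH.
have p_le0 : p <= 0.
  have := hB e0; rewrite e0E (sesZl ES) pE mulrC reZ => h.
  by rewrite -(pmulr_lle0 _ z0).
(* A linear complement of the line of [e0] on which [E] is orthogonal to [e0]. *)
have [a [a_lin a_orth]] : exists a : 'rV[C]_m -> C,
    (forall k x x', a (k *: x + x') = k * a x + a x') /\
    (forall x, E (row_mx (a x)%:M x) e0 = 0).
  have rowE (k : C) (x : 'rV[C]_m) : row_mx k%:M x = k *: e0 + row_mx 0 x.
    by rewrite scale_row_mx scaler0 add_row_mx add0r addr0 scale_scalar_mx mulr1.
  have [p0|p_neq0] := eqVneq p 0; last first.
    have pC : p%:C != 0 by rewrite (inj_eq (@complexI _)).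
    exists (fun x => - E (row_mx 0 x) e0 / p%:C); split=> [k x x'|x].
      have -> : row_mx 0 (k *: x + x') = k *: row_mx (0 : 'rV_1) x + row_mx 0 x'.
        by rewrite scale_row_mx add_row_mx scaler0 addr0.
      rewrite ES.1; field; exact: pC.
    by rewrite rowE ES.1 pE divfK // addNr.
  exists (fun=> 0); split=> [k x x'|x]; first by rewrite mulr0 addr0.
  suff E0 x' : E x' e0 = 0 by rewrite E0.
  (* Since [E e0 e0 = 0], the hypothesis at [s k e0 + w] is affine in [s], with slope [|k|^2] where
     [k] is the quantity to be annihilated; validity for all real [s] forces [k = 0]. As [B] plus
     the conjugate of [z] is invertible, this reaches every vector. *)
  have key w : E (w *m (B + (Num.conj z)%:M)) e0 = 0.
    rewrite mulmxDr mul_mx_scalar addrC ES.1; set k := (X in X = 0).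
    have est (s : R) : s * nm k ^+ 2 <= - re (E (w *m B) w).
      have := hB ((s%:C * k) *: e0 + w).
      rewrite mulmxDl -scalemxAl e0E !(sesDl ES) !(sesDr ES) !(sesZl ES) !(sesZr ES).
      rewrite pE p0 (EH e0 w) !mulr0 add0r => h.
      have -> : nm k ^+ 2 = re (k * (z * Num.conj (E w e0))) + re (Num.conj k * E (w *m B) e0).
        rewrite -[re (Num.conj k * _)]re_conj rmorphM /= conjCK -reD -mulrDr nm_sqrE.
        by rewrite [in Num.conj k]/k rmorphD rmorphM /= conjCK.
      move: h; rewrite rmorphM /= conj_realE !reD -!mulrA !reZ.
      by rewrite mulrDr; lra.
    apply/eqP; rewrite -nm_eq0; apply/negPn/negP => k0.
    have q0 : 0 < nm k ^+ 2 by rewrite exprn_gt0 // lt_def k0 nm_ge0.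
    have := est ((`|re (E (w *m B) w)| + 1) / nm k ^+ 2).
    rewrite divfK ?gt_eqF //; have := ler_norm (- re (E (w *m B) w)).
    by rewrite normrN; lra.
  have u : B + (Num.conj z)%:M \in unitmx by apply: trig_shift_unit.
  by have := key (x' *m invmx (B + (Num.conj z)%:M)); rewrite mulmxKV.
pose phi x : 'rV[C]_(1 + m) := row_mx (a x)%:M x.
have rowE (k l : C) (x : 'rV[C]_m) : row_mx k%:M x = row_mx l%:M x + (k - l) *: e0.
  rewrite scale_row_mx scaler0 add_row_mx addr0 scale_scalar_mx mulr1 -raddfD /=.
  by rewrite addrC subrK.
have e0_phi x : E e0 (phi x) = 0 by rewrite EH a_orth rmorph0.
have phi_lin k x x' : phi (k *: x + x') = k *: phi x + phi x'.
  by rewrite /phi scale_row_mx add_row_mx a_lin raddfD /= scale_scalar_mx.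
have E'_le x : re (E (phi x) (phi x)) <= 0.
  apply: (IH B' (fun x x' => E (phi x) (phi x'))) => //.
  - by split=> [k u v w|w k u v]; rewrite phi_lin ?ES.1 ?ES.2.
  - move=> u; have := hB (phi u); rewrite BE [z *: _ + _]mx11_scalar.
    by rewrite (rowE _ (a (u *m B'))) (sesDl ES) (sesZl ES) e0_phi mulr0 addr0.
rewrite -[y]hsubmxK [lsubmx y]mx11_scalar (rowE _ (a (rsubmx y))) -/(phi _).
set s := _ - _; rewrite (sesDl ES) !(sesDr ES) !(sesZl ES) !(sesZr ES).
rewrite e0_phi a_orth !mulr0 addr0 add0r pE mulrA reD mulrC reZ -nm_sqrE.
have := E'_le (rsubmx y); have : p * nm s ^+ 2 <= 0 by rewrite mulr_le0_ge0 ?sqr_ge0.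
lra.
Qed.

(** Schur triangularization reduces to the triangular case, whose diagonal entries are eigenvalues
    of [B]. *)
Theorem lyapunov m (B : 'M[C]_m) (E : 'rV[C]_m -> 'rV[C]_m -> C) :
  sesquilinear_form E -> (forall u v, E u v = Num.conj (E v u)) ->
  (forall a, eigenvalue B a -> 0 < re a) ->
  (forall y, re (E (y *m B) y) <= 0) -> forall y, re (E y y) <= 0.
Proof.
case: m => [|m] in B E * => ES EH dB hB y; first by rewrite thinmx0 (ses0l ES).
have [P /unitarymx_unit uP] := Schur B (ltn0Sn m).
rewrite /similar_to conjumx // => tB.
set B' := P *m B *m invmx P in tB.
have Py x : (x *m invmx P) *m P = x by rewrite mulmxKV.
rewrite -(Py _ y).
apply: (@lyapunov_trig _ B' (fun u v => E (u *m P) (v *m P))) => //.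
- by split=> [k u v w|w k u v]; rewrite mulmxDl -scalemxAl ?ES.1 ?ES.2.
- move=> i; apply: dB; apply/eigenvalueP.
  have /eigenvalueP [v /= vB v0] : eigenvalue B' (B' i i).
    rewrite eigenvalue_root_char char_poly_trig // rootE horner_prod.
    by apply/eqP; rewrite (bigD1 i) //= hornerXsubC subrr mul0r.
  exists (v *m P).
    have e : P *m B = B' *m P by rewrite mulmxKV.
    by rewrite -mulmxA e mulmxA vB -scalemxAl.
  by apply: contra_neq v0 => /(congr1 (mulmx^~ (invmx P))); rewrite mulmxK // mul0mx.
- move=> u; rewrite -!mulmxA mulVmx // mulmx1 mulmxA; exact: hB.
Qed.
End Lyapunov.

Section LinearAlgebra.
Variable R : realType.
Local Notation C := R[i].
Local Notation re := (@complex.Re R).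

Section LinearMaps.
Variables (E F : lmodType C) (f : E -> F).
Hypothesis hf : linear f.

Lemma lin_D x y : f (x + y) = f x + f y.
Proof. by have := hf 1 x y; rewrite !scale1r. Qed.
Lemma lin_0 : f 0 = 0.
Proof. by have := lin_D 0 0; rewrite addr0 -{1}[f 0]addr0 => /addrI. Qed.
Lemma lin_Z a x : f (a *: x) = a *: f x.
Proof. by rewrite -[a *: x]addr0 hf lin_0 addr0. Qed.
Lemma lin_N x : f (- x) = - f x.
Proof. by rewrite -scaleN1r lin_Z scaleN1r. Qed.
Lemma lin_B x y : f (x - y) = f x - f y.
Proof. by rewrite lin_D lin_N. Qed.
Lemma lin_sum I (r : seq I) (P : pred I) (G : I -> E) :
  f (\sum_(i <- r | P i) G i) = \sum_(i <- r | P i) f (G i).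
Proof. exact: (big_morph _ lin_D lin_0). Qed.
End LinearMaps.

Definition comb (E : lmodType C) m (e : 'I_m -> E) (c : 'rV[C]_m) : E :=
  \sum_i c 0 i *: e i.

Section Combinations.
Variables (E : lmodType C) (m : nat) (e : 'I_m -> E).

Lemma comb_linear : linear (comb e).
Proof.
move=> a c c'; rewrite /comb scaler_sumr -big_split /=.
by apply: eq_bigr => i _; rewrite !mxE scalerDl scalerA.
Qed.

Lemma comb_mul p (c : 'rV[C]_p) (M : 'M[C]_(p, m)) :
  comb e (c *m M) = comb (fun i => comb e (row i M)) c.
Proof.
rewrite mulmx_sum_row (lin_sum comb_linear).
by apply: eq_bigr => i _; rewrite (lin_Z comb_linear).
Qed.

Lemma lin_comb (F : lmodType C) (f : E -> F) c : linear f ->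
  f (comb e c) = comb (f \o e) c.
Proof. by move=> hf; rewrite /comb (lin_sum hf); apply: eq_bigr => i _; rewrite (lin_Z hf). Qed.

Lemma lin_indepP : lin_indep e <-> forall c, comb e c = 0 -> c = 0.
Proof.
split=> h c hc.
  by apply/rowP => i; rewrite mxE; apply: (h (fun i => c 0 i)).
move=> i; have := h (\row_j c j); rewrite /comb.
under eq_bigr do rewrite mxE.
by move=> /(_ hc)/rowP/(_ i); rewrite !mxE.
Qed.

Lemma comb_inj : lin_indep e -> injective (comb e).
Proof.
move=> /lin_indepP h c c' hc; apply/eqP; rewrite -subr_eq0; apply/eqP/h.
by rewrite (lin_B comb_linear) hc subrr.
Qed.
End Combinations.

Lemma row_kernel_exists p n (M : 'M[C]_(p, n)) : (n < p)%N ->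
  exists2 c : 'rV[C]_p, c != 0 & c *m M = 0.
Proof.
move=> np; have : kermx M != 0.
  rewrite -mxrank_eq0 mxrank_ker -lt0n subn_gt0.
  exact: leq_ltn_trans (rank_leq_col M) np.
by move=> /rowV0Pn [c /sub_kermxP hc c0]; exists c.
Qed.

Lemma lin_indep_leq (E : lmodType C) p n (f : 'I_p -> E) (L : E -> 'rV[C]_n) :
  linear L -> lin_indep f -> (forall c, L (comb f c) = 0 -> comb f c = 0) -> (p <= n)%N.
Proof.
move=> hL /lin_indepP hf h; rewrite leqNgt; apply/negP.
move=> /(row_kernel_exists (\matrix_i L (f i))) [c c0 hc].
case/eqP: c0; apply: hf; apply: h; rewrite (lin_comb _ _ hL) -[RHS]hc mulmx_sum_row.
by apply: eq_bigr => i _; rewrite rowK.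
Qed.

Lemma dimension_comb (E : lmodType C) m p (e : 'I_m -> E) (Z : 'M[C]_(p, m)) :
  lin_indep e ->
  dimension [set comb e c | c in [set c : 'rV[C]_m | (c <= Z)%MS]] = (\rank Z)%:R%:E.
Proof.
move=> he; apply/eqP; rewrite eq_le; apply/andP; split.
  apply: ge_ereal_sup => _ [n [f [hf fZ]] <-]; rewrite lee_fin ler_nat.
  have /choice[c hc] : forall i, exists c : 'rV[C]_m, (c <= Z)%MS /\ comb e c = f i.
    by move=> i; have [c cZ <-] := fZ i; exists c.
  have /eqP <- : row_free (\matrix_i c i).
    rewrite -kermx_eq0; apply/rowV0P => v /sub_kermxP hv.
    apply: ((lin_indepP f).1 hf); rewrite -(lin_0 (comb_linear e)) -hv comb_mul.
    by apply: eq_bigr => i _; rewrite rowK (hc i).2.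
  apply: mxrankS; apply/row_subP => i; rewrite rowK; exact: (hc i).1.
apply: ereal_sup_ubound; exists (\rank Z) => //.
exists (fun i => comb e (row i (row_base Z))); split; last first.
  move=> i; exists (row i (row_base Z)) => //=.
  by apply: submx_trans (row_sub _ _) _; rewrite eq_row_base.
apply/lin_indepP => c; rewrite -comb_mul => /((lin_indepP e).1 he).
by move/eqP; rewrite mulmx_free_eq0 ?row_base_free // => /eqP.
Qed.

Lemma dimension_span (E : lmodType C) m (e : 'I_m -> E) :
  lin_indep e -> dimension (range (comb e)) = m%:R%:E.
Proof.
move=> he; rewrite -[in RHS](mxrank1 C m) -(dimension_comb 1%:M he); congr dimension.
by apply/seteqP; split=> [_ [c _ <-]|_ [c _ <-]]; exists c; rewrite //= submx1.
Qed.

Section NegativeIndex.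
Variables (V : lmodType C) (k : V -> V -> C).
Hypothesis kS : sesquilinear_form k.
Hypothesis k_herm : forall u v, k u v = Num.conj (k v u).
Hypothesis k_index : (neg_index k < +oo)%E.

Let orthonormal n (e : 'I_n -> V) := forall i j, k (e i) (e j) = - (i == j)%:R.

Let k_comb n (e : 'I_n -> V) c j : orthonormal e -> k (comb e c) (e j) = - c 0 j.
Proof.
move=> he; rewrite /comb (ses_suml kS) (bigD1 j) //= (sesZl kS) he eqxx mulrN1.
rewrite big1 ?addr0 // => i ij; rewrite (sesZl kS) he (negbTE ij) oppr0 mulr0 //.
Qed.

Let k_comb2 n (e : 'I_n -> V) c : orthonormal e ->
  k (comb e c) (comb e c) = - (\sum_j nm (c 0 j) ^+ 2)%:C.
Proof.
move=> he; rewrite {2}/comb (ses_sumr kS) rmorph_sum -sumrN; apply: eq_bigr => j _.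
rewrite (sesZr kS) k_comb // mulrN mulrC; congr (- _).
by rewrite rmorphXn /= -nmE normCK.
Qed.

(** Take a [k]-orthonormal negative family of maximal size, which exists because the index is
    finite. A negative vector orthogonal to it could be normalized and adjoined; hence [u] is
    determined by the values [k u (e i)] on any negative definite subspace, which bounds the
    dimension of the latter by [n]. *)
Theorem neg_index_basis : exists n (e : 'I_n -> V),
  [/\ neg_index k = n%:R%:E, forall i j, k (e i) (e j) = - (i == j)%:R &
      forall u, (forall i, k u (e i) = 0) -> 0 <= re (k u u)].
Proof.
have sub n (e : 'I_n -> V) : orthonormal e -> (n%:R%:E <= neg_index k)%E.
  move=> he; have indep : lin_indep e.
    apply/lin_indepP => c hc; apply/rowP => j; apply/eqP; rewrite mxE -oppr_eq0.
    by rewrite -(k_comb _ _ he) hc (ses0l kS).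
  rewrite -(dimension_span indep); apply: ereal_sup_ubound.
  exists (range (comb e)) => //; split.
    split; first by exists 0 => //; rewrite (lin_0 (comb_linear e)).
    by move=> a _ _ [c _ <-] [c' _ <-]; exists (a *: c + c') => //; rewrite comb_linear.
  move=> _ [c _ <-] c0; rewrite k_comb2 // oppr_lt0 ltcR.
  rewrite lt_def sumr_ge0 ?andbT => [|j _]; last exact: sqr_ge0.
  apply: contra c0; rewrite psumr_eq0 => [/allP h|j _]; last exact: sqr_ge0.
  have -> : c = 0.
    apply/rowP => j; rewrite mxE; apply/eqP; rewrite -nm_eq0.
    by have := h j (mem_index_enum _); rewrite /= expf_eq0.
  by rewrite (lin_0 (comb_linear e)).
have P0 : exists n, `[< exists e : 'I_n -> V, orthonormal e >].
  by exists 0%N; apply/asboolP; exists (fun i => 0) => - [].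
have [r r_eq] : exists r, neg_index k = r%:E.
  have := sub 0%N (fun=> 0); case: (neg_index k) k_index => [r _ _|//|_ h].
    by exists r.
  by have /h : orthonormal (fun _ : 'I_0 => 0 : V) by case.
have bound n : `[< exists e : 'I_n -> V, orthonormal e >] -> (n <= Num.truncn r)%N.
  move=> /asboolP[e /sub]; rewrite r_eq lee_fin => h.
  by rewrite truncn_ge_nat // (le_trans _ h).
case: (ex_maxnP P0 bound) => n /asboolP[e he] n_max.
have pos u : (forall i, k u (e i) = 0) -> 0 <= re (k u u).
  move=> hu; rewrite leNgt; apply/negP => neg.
  suff /n_max : `[< exists e : 'I_n.+1 -> V, orthonormal e >] by rewrite ltnn.
  apply/asboolP; pose t := (Num.sqrt (- re (k u u)))^-1.
  exists (fun i => if unlift ord_max i is Some j then e j else t%:C *: u) => i j.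
  have hu' l : k (e l) u = 0 by rewrite k_herm hu rmorph0.
  case: unliftP => [i'|] ->; case: unliftP => [j'|] ->.
  - by rewrite he (inj_eq lift_inj).
  - by rewrite (sesZr kS) hu' mulr0 eq_sym (negbTE (neq_lift _ _)) oppr0.
  - by rewrite (sesZl kS) hu mulr0 (negbTE (neq_lift _ _)) oppr0.
  rewrite (sesZl kS) (sesZr kS) conj_realE eqxx (herm_real (k_herm u u)).
  rewrite -!rmorphM /= /t mulrA -expr2 exprVn sqr_sqrtr ?oppr_ge0 ?ltW //.
  by rewrite invrN mulNr mulVf ?lt_eqF // rmorphN1.
exists n, e; split=> //; apply/eqP; rewrite eq_le (sub n e he) andbT.
apply: ge_ereal_sup => _ [W [Wsub Wneg] <-].
apply: ge_ereal_sup => _ [p [f [hf fW]] <-]; rewrite lee_fin ler_nat.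
apply: (@lin_indep_leq _ _ _ f (fun u => \row_i k u (e i))) => //.
  by move=> a u v; apply/rowP => i; rewrite !mxE kS.1.
move=> c hc; apply/eqP/negPn/negP => c0.
have fc : W (comb f c).
  rewrite /comb; elim/big_rec: _ => [|i x _ Wx]; first exact: Wsub.1.
  exact: Wsub.2.
have := Wneg _ fc c0; rewrite ltcE /= => /andP[_].
rewrite ltNge pos // => i; by have /rowP/(_ i) := hc; rewrite !mxE.
Qed.
End NegativeIndex.
End LinearAlgebra.

(** * Bounded maps and forms, bordered systems, products *)

Section BoundedMaps.
Variable R : realType.
Local Notation C := R[i].
Local Notation re := (@complex.Re R).

Definition bounded_map (E F : normedZmodType C) (f : E -> F) : Prop :=
  exists2 K : R, 0 <= K & forall x, nm (f x) <= K * nm x.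

Definition bounded_form (E : normedModType C) (q : E -> E -> C) : Prop :=
  exists2 K : R, 0 <= K & bounded_by K q.

Lemma bounded_mapD (E F : normedZmodType C) (f g : E -> F) :
  bounded_map f -> bounded_map g -> bounded_map (fun x => f x + g x).
Proof.
move=> [K K0 hK] [L L0 hL]; exists (K + L); first exact: addr_ge0.
by move=> x; rewrite mulrDl; apply: le_trans (nm_triangle _ _) _; exact: lerD.
Qed.

Lemma bounded_mapN (E F : normedZmodType C) (f : E -> F) :
  bounded_map f -> bounded_map (fun x => - f x).
Proof. by move=> [K K0 hK]; exists K => // x; rewrite nmN. Qed.

Lemma bounded_map0 (E F : normedZmodType C) : bounded_map (fun _ : E => 0 : F).
Proof. by exists 0 => // x; rewrite nm0 mul0r. Qed.

Lemma bounded_map_sum (E F : normedZmodType C) I (r : seq I) (f : I -> E -> F) :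
  (forall i, bounded_map (f i)) -> bounded_map (fun x => \sum_(i <- r) f i x).
Proof.
move=> hf; elim: r => [|i r IH].
  by have [K K0 hK] := bounded_map0 E F; exists K => // x; rewrite big_nil.
have [K K0 hK] := bounded_mapD (hf i) IH.
by exists K => // x; rewrite big_cons.
Qed.

Lemma bounded_map_comp (E F G : normedZmodType C) (f : F -> G) (g : E -> F) :
  bounded_map f -> bounded_map g -> bounded_map (f \o g).
Proof.
move=> [K K0 hK] [L L0 hL]; exists (K * L); first exact: mulr_ge0.
move=> x; apply: le_trans (hK _) _; rewrite -mulrA; exact: ler_wpM2l.
Qed.

Lemma bounded_map_scale (E F : normedModType C) (a : C) (f : E -> F) :
  bounded_map f -> bounded_map (fun x => a *: f x).
Proof.
move=> [K K0 hK]; exists (nm a * K); first by rewrite mulr_ge0 ?nm_ge0.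
by move=> x; rewrite nmZ -mulrA ler_wpM2l ?nm_ge0.
Qed.

Lemma bounded_map_mul (E : normedModType C) (a : C) (f : E -> C) :
  bounded_map f -> bounded_map (fun x => a * f x).
Proof.
move=> [K K0 hK]; exists (nm a * K); first by rewrite mulr_ge0 ?nm_ge0.
by move=> x; rewrite nmM -mulrA ler_wpM2l ?nm_ge0.
Qed.

Lemma bounded_map_vec (E F : normedModType C) (f : E -> C) (y : F) :
  bounded_map f -> bounded_map (fun x => f x *: y).
Proof.
move=> [K K0 hK]; exists (K * nm y); first by rewrite mulr_ge0 ?nm_ge0.
by move=> x; rewrite nmZ mulrAC ler_wpM2r ?nm_ge0.
Qed.

Lemma bounded_mapB (E F : normedZmodType C) (f g : E -> F) :
  bounded_map f -> bounded_map g -> bounded_map (fun x => f x - g x).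
Proof. by move=> hf hg; apply: bounded_mapD hf (bounded_mapN hg). Qed.

Lemma bounded_map_id (E : normedZmodType C) : bounded_map (@id E).
Proof. by exists 1 => // x; rewrite mul1r. Qed.

Lemma bounded_form_map (E : normedModType C) (q : E -> E -> C) y :
  bounded_form q -> bounded_map (q^~ y).
Proof.
move=> [K K0 hK]; exists (K * nm y); first by rewrite mulr_ge0 ?nm_ge0.
by move=> x; rewrite mulrAC; exact: hK.
Qed.

Lemma bounded_formD (E : normedModType C) (p q : E -> E -> C) :
  bounded_form p -> bounded_form q -> bounded_form (fun x y => p x y + q x y).
Proof.
move=> [K K0 hK] [L L0 hL]; exists (K + L); first exact: addr_ge0.
by move=> x y; rewrite !mulrDl; apply: le_trans (nm_triangle _ _) _; exact: lerD.
Qed.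

Lemma bounded_formZ (E : normedModType C) (a : C) (q : E -> E -> C) :
  bounded_form q -> bounded_form (fun x y => a * q x y).
Proof.
move=> [K K0 hK]; exists (nm a * K); first by rewrite mulr_ge0 ?nm_ge0.
by move=> x y; rewrite nmM -!mulrA ler_wpM2l ?nm_ge0 // mulrA; exact: hK.
Qed.

Lemma bounded_form_rank1 (E : normedModType C) (f h : E -> C) :
  bounded_map f -> bounded_map h -> bounded_form (fun x y => f x * Num.conj (h y)).
Proof.
move=> [K K0 hK] [L L0 hL]; exists (K * L); first exact: mulr_ge0.
move=> x y; rewrite nmM nm_conj.
apply: le_trans (ler_pM (nm_ge0 _) (nm_ge0 _) (hK x) (hL y)) _.
by rewrite mulrACA mulrA.
Qed.

Lemma bounded_form_sum (E : normedModType C) I (r : seq I) (q : I -> E -> E -> C) :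
  (forall i, bounded_form (q i)) -> bounded_form (fun x y => \sum_(i <- r) q i x y).
Proof.
move=> hq; elim: r => [|i r IH].
  by exists 0 => // x y; rewrite big_nil nm0 !mul0r.
have [K K0 hK] := bounded_formD (hq i) IH.
by exists K => // x y; rewrite big_cons.
Qed.

Lemma sesquilinear_formD (E : lmodType C) (p q : E -> E -> C) :
  sesquilinear_form p -> sesquilinear_form q -> sesquilinear_form (fun x y => p x y + q x y).
Proof.
move=> hp hq; split=> [a x y z|z a x y]; first by rewrite hp.1 hq.1 mulrDr addrACA.
by rewrite hp.2 hq.2 mulrDr addrACA.
Qed.

Lemma sesquilinear_formZ (E : lmodType C) (a : C) (q : E -> E -> C) :
  sesquilinear_form q -> sesquilinear_form (fun x y => a * q x y).
Proof.
move=> hq; split=> [b x y z|z b x y]; first by rewrite hq.1 mulrDr mulrCA.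
by rewrite hq.2 mulrDr mulrCA.
Qed.

Lemma sesquilinear_form_rank1 (E : lmodType C) (f h : E -> C) :
  (forall a x y, f (a *: x + y) = a * f x + f y) ->
  (forall a x y, h (a *: x + y) = a * h x + h y) ->
  sesquilinear_form (fun x y => f x * Num.conj (h y)).
Proof.
move=> hf hh; split=> [b x y z|z b x y]; first by rewrite hf mulrDl mulrA.
by rewrite hh rmorphD rmorphM mulrDr mulrCA.
Qed.

Lemma sesquilinear_form_sum (E : lmodType C) I (r : seq I) (q : I -> E -> E -> C) :
  (forall i, sesquilinear_form (q i)) -> sesquilinear_form (fun x y => \sum_(i <- r) q i x y).
Proof.
move=> hq; split=> [b x y z|z b x y]; rewrite mulr_sumr -big_split /=; apply: eq_bigr => i _.
  exact: (hq i).1.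
exact: (hq i).2.
Qed.

(* [Y0 x + Y1 z] solves a problem with [N] free parameters [z] and datum [x], and
   [T0 x + T1 z] are [N] further conditions imposed on the solution. *)
Lemma bordering (E F : normedModType C) N (Y0 : E -> F) (Y1 : 'rV[C]_N -> F)
    (T0 : E -> 'rV[C]_N) (T1 : 'rV[C]_N -> 'rV[C]_N) :
  bounded_map Y0 -> linear Y1 -> (forall i, bounded_map (fun x => T0 x 0 i)) ->
  linear T1 -> (forall z, T1 z = 0 -> z = 0) ->
  exists2 z : E -> 'rV[C]_N, forall x, T0 x + T1 (z x) = 0 &
    bounded_map (fun x => Y0 x + Y1 (z x)).
Proof.
move=> Y0b Y1l T0b T1l T1i.
pose M : 'M[C]_N := \matrix_i T1 (delta_mx 0 i).
have ME z : T1 z = z *m M.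
  rewrite {1}[z]row_sum_delta (lin_sum T1l) mulmx_sum_row.
  by apply: eq_bigr => i _; rewrite (lin_Z T1l) rowK.
have uM : M \in unitmx.
  rewrite -row_free_unit -kermx_eq0; apply/rowV0P => z /sub_kermxP hz.
  by apply: T1i; rewrite ME.
exists (fun x => - T0 x *m invmx M) => [x|]; first by rewrite ME mulmxKV // subrr.
apply: bounded_mapD Y0b _.
have zE x : Y1 (- T0 x *m invmx M) =
    \sum_i (- \sum_l invmx M l i * T0 x 0 l) *: Y1 (delta_mx 0 i).
  rewrite {1}[_ *m _]row_sum_delta (lin_sum Y1l); apply: eq_bigr => i _.
  rewrite (lin_Z Y1l); congr (_ *: _); rewrite mxE -sumrN.
  by apply: eq_bigr => l _; rewrite mxE mulNr mulrC.
have [K K0 hK] : bounded_map (fun x =>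
    \sum_i (- \sum_l invmx M l i * T0 x 0 l) *: Y1 (delta_mx 0 i)).
  apply: bounded_map_sum => i; apply: bounded_map_vec; apply: bounded_mapN.
  by apply: bounded_map_sum => l; apply: bounded_map_mul.
by exists K => // x; rewrite zE.
Qed.

Section Product.
Variables E F : normedModType C.
Implicit Types x : (E * F)%type.

Lemma nm_prod x : nm x = Num.max (nm x.1) (nm x.2).
Proof.
apply: complexI; rewrite -nmE prod_normE /Order.max !nmE ltcR.
by case: ifP.
Qed.
Lemma nm_fst x : nm x.1 <= nm x. Proof. by rewrite nm_prod le_max lexx. Qed.
Lemma nm_snd x : nm x.2 <= nm x. Proof. by rewrite nm_prod le_max lexx orbT. Qed.
Lemma nm_pair x : nm x <= nm x.1 + nm x.2.
Proof. by rewrite nm_prod ge_max lerDl lerDr !nm_ge0. Qed.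

Lemma bounded_map_fst : bounded_map (fun x => x.1).
Proof. by exists 1 => // x; rewrite mul1r nm_fst. Qed.
Lemma bounded_map_pair (G : normedZmodType C) (f : G -> E) (h : G -> F) :
  bounded_map f -> bounded_map h -> bounded_map (fun y => (f y, h y)).
Proof.
move=> [K K0 hK] [L L0 hL]; exists (K + L); first exact: addr_ge0.
by move=> y; rewrite mulrDl; apply: le_trans (nm_pair _) _; apply: lerD; [exact: hK|exact: hL].
Qed.

Lemma seq_complete_prod : seq_complete E -> seq_complete F ->
  seq_complete (E * F)%type.
Proof.
move=> hE hF u hu.
have [l1 hl1] : exists l, seq_lim (fun n => (u n).1) l.
  apply: hE => e e0; have [N hN] := hu _ e0; exists N => m n hm hn.
  exact: le_lt_trans (nm_fst (u m - u n)) (hN _ _ hm hn).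
have [l2 hl2] : exists l, seq_lim (fun n => (u n).2) l.
  apply: hF => e e0; have [N hN] := hu _ e0; exists N => m n hm hn.
  exact: le_lt_trans (nm_snd (u m - u n)) (hN _ _ hm hn).
exists (l1, l2) => e e0; have [N1 h1] := hl1 _ e0; have [N2 h2] := hl2 _ e0.
exists (maxn N1 N2) => n; rewrite geq_max => /andP[n1 n2].
by rewrite nm_prod gt_max h1 // h2.
Qed.
End Product.

End BoundedMaps.

(** * The generator and the modified resolvent equation *)

(* The data of the theorem as plain functions, with a maximal [k]-orthonormal family
   [pe] of negative vectors; [pn] is thus the negative index of [pk]. *)
Record damped_pencil (R : realType) := DampedPencil {
  pV : completeNormedModType R[i];
  pH : completeNormedModType R[i];
  ipV : pV -> pV -> R[i];
  ipH : pH -> pH -> R[i];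
  pj : pV -> pH;
  pd : pV -> pV -> R[i];
  pk : pV -> pV -> R[i];
  pg : pV -> pV -> R[i];
  pd0 : R;
  pn : nat;
  pe : 'I_pn -> pV;
  ipV_ses : sesquilinear_form ipV;
  ipV_herm : forall u v, ipV u v = Num.conj (ipV v u);
  ipV_norm : forall u, ipV u u = (nm u ^+ 2)%:C;
  ipH_ses : sesquilinear_form ipH;
  ipH_herm : forall u v, ipH u v = Num.conj (ipH v u);
  ipH_norm : forall u, ipH u u = (nm u ^+ 2)%:C;
  pj_lin : linear pj;
  pj_inj : injective pj;
  pj_bounded : bounded_map pj;
  pj_total : forall h, (forall w, ipH h (pj w) = 0) -> h = 0;
  pd_ses : sesquilinear_form pd;
  pd_herm : forall u v, pd u v = Num.conj (pd v u);
  pd0_gt0 : 0 < pd0;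
  pd_coercive : forall u, pd0 * nm u ^+ 2 <= complex.Re (pd u u);
  pd_bounded : bounded_form pd;
  pk_ses : sesquilinear_form pk;
  pk_herm : forall u v, pk u v = Num.conj (pk v u);
  pk_bounded : bounded_form pk;
  pg_ses : sesquilinear_form pg;
  pg_skew : forall u v, pg u v = - Num.conj (pg v u);
  pg_bounded : bounded_form pg;
  pe_orth : forall i j, pk (pe i) (pe j) = - (i == j)%:R;
  pe_max : forall u, (forall i, pk u (pe i) = 0) -> 0 <= complex.Re (pk u u) }.

Section Pencil.
Variables (R : realType) (P : damped_pencil R).
Local Notation C := R[i].
Local Notation re := (@complex.Re R).
Local Notation im := (@complex.Im R).
Local Notation V := (pV P).
Local Notation H := (pH P).
Local Notation X := (V * H)%type.
Local Notation n := (pn P).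
Local Notation e := (@pe R P).
Local Notation ip := (@ipH R P).
Local Notation j := (@pj R P).
Local Notation d := (@pd R P).
Local Notation k := (@pk R P).
Local Notation g := (@pg R P).
Local Notation d0 := (pd0 P).

(** The relation [y = A x], with the second component in weak form; being a linear relation, it
    avoids the domain and the chosen inverses in [generator]. *)
Definition graph (x y : X) : Prop :=
  x.2 = j y.1 /\ forall w, ip y.2 (j w) + k x.1 w + d y.1 w + g y.1 w = 0.

Lemma graph_lin a x y x' y' : graph x y -> graph x' y' -> graph (a *: x + x') (a *: y + y').
Proof.
move=> [h1 h2] [h1' h2']; split=> [|w] /=; first by rewrite h1 h1' (@pj_lin R P).
rewrite (ipH_ses P).1 (pk_ses P).1 (pd_ses P).1 (pg_ses P).1.
transitivity (a * (ip y.2 (j w) + k x.1 w + d y.1 w + g y.1 w) +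
  (ip y'.2 (j w) + k x'.1 w + d y'.1 w + g y'.1 w)); first by ring.
by rewrite h2 h2' mulr0 addr0.
Qed.

Lemma graph0 : graph 0 0.
Proof.
split=> [|w]; first by rewrite /= (lin_0 (@pj_lin R P)).
by rewrite /= (ses0l (ipH_ses P)) (ses0l (pk_ses P)) (ses0l (pd_ses P)) (ses0l (pg_ses P)) !addr0.
Qed.

Lemma graphD x y x' y' : graph x y -> graph x' y' -> graph (x + x') (y + y').
Proof. by move=> h h'; have := graph_lin 1 h h'; rewrite !scale1r. Qed.

Lemma graphZ a x y : graph x y -> graph (a *: x) (a *: y).
Proof. by move=> h; have := graph_lin a h graph0; rewrite !addr0. Qed.

Lemma graphB x y x' y' : graph x y -> graph x' y' -> graph (x - x') (y - y').
Proof. by move=> h /(graphZ (-1)) h'; have := graphD h h'; rewrite !scaleN1r. Qed.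

Lemma graph_comb m (f : 'I_m -> X) (h : 'I_m -> X) c :
  (forall i, graph (f i) (h i)) -> graph (comb f c) (comb h c).
Proof.
move=> fh; rewrite /comb.
by apply: (big_ind2 graph graph0 graphD) => i _; exact: graphZ.
Qed.

(** By [pe_orth] the sign makes these the coordinates on the span of the [e i]. *)
Definition beta (u : V) : 'rV[C]_n := \row_i (- k u (e i)).

Lemma beta_lin : linear beta.
Proof. by move=> a u v; apply/rowP => i; rewrite !mxE (pk_ses P).1 mulrN opprD. Qed.

Lemma beta_bounded i : bounded_map (fun u => beta u 0 i).
Proof.
have [K K0 hK] := bounded_mapN (bounded_form_map (e i) (pk_bounded P)).
by exists K => // u; rewrite mxE.
Qed.

(** The form [k] freed of its negative directions: the [e i] lie in its kernel, and it agrees with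
    [k] on their [k]-orthogonal complement. *)
Definition kpos (u w : V) : C := k u w + \sum_i beta u 0 i * Num.conj (beta w 0 i).

Lemma kpos_ses : sesquilinear_form kpos.
Proof.
apply: sesquilinear_formD (pk_ses P) _; apply: sesquilinear_form_sum => i.
by apply: sesquilinear_form_rank1 => a x y; rewrite beta_lin !mxE.
Qed.

Lemma kpos_bounded : bounded_form kpos.
Proof.
apply: bounded_formD (pk_bounded P) _; apply: bounded_form_sum => i.
by apply: bounded_form_rank1; exact: beta_bounded.
Qed.

Lemma beta_e i : beta (e i) = delta_mx 0 i.
Proof. by apply/rowP => l; rewrite !mxE pe_orth opprK eqxx eq_sym. Qed.

Lemma kpos_e i w : kpos (e i) w = 0.
Proof.
rewrite /kpos beta_e (bigD1 i) //= big1 => [|l li]; last first.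
  by rewrite mxE (negbTE li) andbF mul0r.
by rewrite !mxE !eqxx mul1r addr0 pk_herm -rmorphD subrr rmorph0.
Qed.

Lemma beta_comb_e c : beta (comb e c) = c.
Proof.
rewrite (lin_comb _ _ beta_lin) [RHS]row_sum_delta.
by apply: eq_bigr => i _; rewrite /= beta_e.
Qed.

(** Removing from [u] its component in the span of the [e i] does not change [kpos u u], and for the
    remainder [kpos] is [k], so [pe_max] applies. *)
Lemma kpos_ge0 u : 0 <= kpos u u.
Proof.
set u' := u - comb e (beta u).
have bu' : beta u' = 0 by rewrite (lin_B beta_lin) beta_comb_e subrr.
have ku' i : k u' (e i) = 0.
  by have /rowP/(_ i) := bu'; rewrite !mxE => /eqP; rewrite oppr_eq0 => /eqP.
have -> : kpos u u = k u' u'.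
  rewrite [RHS](_ : _ = kpos u' u'); last first.
    by rewrite /kpos bu' big1 ?addr0 // => i _; rewrite mxE mul0r.
  have kc w : kpos (comb e (beta u)) w = 0.
    rewrite (ses_suml kpos_ses) big1 // => i _.
    by rewrite (sesZl kpos_ses) kpos_e mulr0.
  have kc' w : kpos w (comb e (beta u)) = 0.
    have herm x y : kpos x y = Num.conj (kpos y x).
      rewrite /kpos rmorphD rmorph_sum; congr (_ + _); first exact: pk_herm.
      by apply: eq_bigr => i _; rewrite rmorphM /= conjCK mulrC.
    by rewrite herm kc rmorph0.
  by rewrite /u' (sesBl kpos_ses) !(sesBr kpos_ses) !kc !kc' !subr0.
rewrite (herm_real (pk_herm u' u')) ler0c; exact: pe_max.
Qed.

(** The quadratic pencil [z^2 + z (d + g) + k] divided by [z], with [kpos] in place of [k]. For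
    [re z > 0] each term has nonnegative real part on the diagonal, and [d] gives coercivity
    uniformly in [z]. *)
Definition ell (z : C) (u w : V) : C :=
  z * ip (j u) (j w) + d u w + g u w + z^-1 * kpos u w.

Lemma ell_ses z : sesquilinear_form (ell z).
Proof.
apply: sesquilinear_formD (sesquilinear_formZ _ kpos_ses).
apply: sesquilinear_formD (pg_ses P); apply: sesquilinear_formD (pd_ses P).
apply: sesquilinear_formZ; split=> [a x y w|w a x y]; rewrite (@pj_lin R P).
  exact: (ipH_ses P).1.
exact: (ipH_ses P).2.
Qed.

Lemma ipj_bounded : bounded_form (fun u w => ip (j u) (j w)).
Proof.
have [K K0 hK] := pj_bounded P; exists (K * K); first exact: mulr_ge0.
move=> x y; apply: le_trans (cauchy_schwarz (@ipH_ses R P) (@ipH_herm R P) (@ipH_norm R P) _ _) _.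
by apply: le_trans (ler_pM (nm_ge0 _) (nm_ge0 _) (hK _) (hK _)) _; rewrite mulrACA mulrA.
Qed.

Lemma ell_bounded z : bounded_form (ell z).
Proof.
apply: bounded_formD (bounded_formZ _ kpos_bounded).
apply: bounded_formD (pg_bounded P); apply: bounded_formD (pd_bounded P).
exact: bounded_formZ ipj_bounded.
Qed.

Lemma re_g0 u : re (g u u) = 0.
Proof. have := congr1 re (pg_skew u u); rewrite reN re_conj; lra. Qed.

Lemma ell_coercive z u : 0 < re z -> d0 * nm u ^+ 2 <= re (ell z u u).
Proof.
move=> z0; rewrite /ell !reD re_g0 addr0.
have h1 : 0 <= re (z * ip (j u) (j u)).
  by rewrite ipH_norm mulrC reZ mulr_ge0 ?sqr_ge0 // ltW.
have h2 : 0 <= re (z^-1 * kpos u u).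
  have := kpos_ge0 u; rewrite lecE /= => /andP[/eqP im0 re0].
  rewrite (re_eq_real im0) mulrC reZ mulr_ge0 //.
  by case: z z0 {h1} => a b /= a0; rewrite divr_ge0 ?addr_ge0 ?sqr_ge0 // ltW.
have := pd_coercive u; lra.
Qed.

Lemma ell_solvable z (l : V -> C) : 0 < re z -> antilinear_form l -> bounded_map l ->
  exists u, forall w, ell z u w = l w.
Proof.
move=> z0 hl [L L0 hL]; have [K K0 hK] := ell_bounded z.
apply: (lax_milgram (@ipV_ses R P) (@ipV_herm R P) (@ipV_norm R P) (ell_ses z)
  (pd0_gt0 P) _ K0 hK hl hL) => u.
exact: ell_coercive.
Qed.

Lemma ell_eq0 z u : 0 < re z -> ell z u u = 0 -> u = 0.
Proof.
move=> z0 h; have := ell_coercive u z0; rewrite h /= pmulr_rle0 ?pd0_gt0 // => h2.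
by apply/eqP; rewrite -nm_eq0 -sqrf_eq0 eq_le h2 sqr_ge0.
Qed.

Lemma ell_inj z u v : 0 < re z -> (forall w, ell z u w = ell z v w) -> u = v.
Proof.
move=> z0 h; apply/eqP; rewrite -subr_eq0; apply/eqP/(@ell_eq0 z) => //.
by rewrite (sesBl (ell_ses z)) h subrr.
Qed.

Section Solve.
Variable z : C.
Hypothesis z0 : 0 < re z.

(** The right-hand side of [(z - A) y = x] written for the velocity [v = z y.1 - x.1]; the free
    vector [xi] stands for [beta y.1], which carries the difference between [kpos] and [k]. *)
Definition load (x : X) (xi : 'rV[C]_n) (w : V) : C :=
  ip x.2 (j w) - z^-1 * kpos x.1 w + \sum_i xi 0 i * Num.conj (beta w 0 i).

Lemma load_antilinear x xi : antilinear_form (load x xi).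
Proof.
move=> a u v; rewrite /load (@pj_lin R P) (ipH_ses P).2 kpos_ses.2.
have -> : \sum_i xi 0 i * Num.conj (beta (a *: u + v) 0 i) =
  Num.conj a * (\sum_i xi 0 i * Num.conj (beta u 0 i)) + \sum_i xi 0 i * Num.conj (beta v 0 i).
  rewrite mulr_sumr -big_split /=; apply: eq_bigr => i _.
  by rewrite beta_lin !mxE rmorphD rmorphM mulrDr mulrCA.
by ring.
Qed.

Lemma load_bounded x xi : bounded_map (load x xi).
Proof.
apply: bounded_mapD.
  apply: bounded_mapB.
    have [K K0 hK] := pj_bounded P; exists (nm x.2 * K); first by rewrite mulr_ge0 ?nm_ge0.
    move=> u; apply: le_trans (cauchy_schwarz (@ipH_ses R P) (@ipH_herm R P) (@ipH_norm R P) _ _) _.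
    by rewrite -mulrA ler_wpM2l ?nm_ge0.
  apply: bounded_map_mul; have [K K0 hK] := kpos_bounded; exists (K * nm x.1) => //.
  by rewrite mulr_ge0 ?nm_ge0.
apply: bounded_map_sum => i; apply: bounded_map_mul.
by have [K K0 hK] := beta_bounded i; exists K => // u; rewrite nm_conj.
Qed.

Lemma velocity_ex (p : X * 'rV[C]_n) : exists v, forall w, ell z v w = load p.1 p.2 w.
Proof. by apply: ell_solvable => //; [exact: load_antilinear|exact: load_bounded]. Qed.

Definition velocity (p : X * 'rV[C]_n) : V := projT1 (cid (velocity_ex p)).

Lemma velocityE p w : ell z (velocity p) w = load p.1 p.2 w.
Proof. exact: (projT2 (cid (velocity_ex p))). Qed.

Lemma velocity_lin : linear velocity.
Proof.
move=> a p q; apply: (ell_inj z0) => w; rewrite (ell_ses z).1 !velocityE /load /=.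
rewrite (ipH_ses P).1 kpos_ses.1.
have -> : \sum_i (a *: p.2 + q.2) 0 i * Num.conj (beta w 0 i) =
  a * (\sum_i p.2 0 i * Num.conj (beta w 0 i)) + \sum_i q.2 0 i * Num.conj (beta w 0 i).
  by rewrite mulr_sumr -big_split /=; apply: eq_bigr => i _; rewrite !mxE mulrDl mulrA.
by ring.
Qed.

Lemma velocity_bounded : bounded_map (fun x => velocity (x, 0)).
Proof.
have [J J0 hJ] := pj_bounded P; have [K K0 hK] := kpos_bounded.
have B0 : 0 <= (J + nm z^-1 * K) / d0.
  by rewrite divr_ge0 ?(ltW (pd0_gt0 P)) // addr_ge0 ?mulr_ge0 ?nm_ge0.
exists ((J + nm z^-1 * K) / d0) => // x; set v := velocity _.
have [->|v0] := eqVneq v 0; first by rewrite nm0 mulr_ge0 ?nm_ge0.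
rewrite -(ler_pM2r (_ : 0 < nm v)) ?nm_gt0 // -(ler_pM2l (pd0_gt0 P)).
rewrite -expr2; apply: le_trans (ell_coercive _ z0) _; apply: le_trans (re_le_nm _) _.
rewrite velocityE /load big1 => [|i _]; last by rewrite mxE mul0r.
rewrite addr0; apply: le_trans (nm_triangleB _ _) _.
have -> : d0 * ((J + nm z^-1 * K) / d0 * nm x * nm v) =
   nm x * (J * nm v) + nm z^-1 * (K * nm x * nm v).
  by field; exact: lt0r_neq0 (pd0_gt0 P).
apply: lerD.
  apply: le_trans (cauchy_schwarz (@ipH_ses R P) (@ipH_herm R P) (@ipH_norm R P) _ _) _.
  by apply: ler_pM; rewrite ?nm_ge0 ?nm_snd.
rewrite nmM ler_wpM2l ?nm_ge0 //; apply: le_trans (hK _ _) _.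
by rewrite -!mulrA ler_wpM2l // ler_wpM2r ?nm_ge0 ?nm_fst.
Qed.

Definition solve (p : X * 'rV[C]_n) : X :=
  (z^-1 *: (velocity p + p.1.1), j (velocity p)).

Lemma solve_lin : linear solve.
Proof.
move=> a p q; apply: injective_projections; rewrite /= velocity_lin ?(@pj_lin R P) //.
rewrite [a *: (z^-1 *: _)]scalerA [a * _]mulrC -scalerA -scalerDr; congr (_ *: _).
by rewrite scalerDr addrACA.
Qed.

Lemma solve_bounded : bounded_map (fun x => solve (x, 0)).
Proof.
apply: bounded_map_pair.
  apply: bounded_map_scale; apply: bounded_mapD velocity_bounded _.
  exact: bounded_map_fst.
exact: bounded_map_comp (pj_bounded P) velocity_bounded.
Qed.

(** The finite-rank term added to [k] in [kpos] is compensated by the [xi] term of [load] as soon as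
    [xi] is [beta] of the solution. *)
Lemma solve_graph x xi : beta (solve (x, xi)).1 = xi ->
  graph (solve (x, xi)) (z *: solve (x, xi) - x).
Proof.
have zn0 : z != 0 by apply: contraTneq z0 => ->; rewrite ltxx.
set y := solve _; set v := velocity (x, xi) => hb.
have y1 : y.1 = z^-1 *: (v + x.1) by [].
have v1 : z *: y.1 - x.1 = v by rewrite y1 scalerA mulfV // scale1r addrK.
split=> [|w] /=; first by rewrite v1.
rewrite v1 (sesBl (ipH_ses P)) (sesZl (ipH_ses P)).
have := velocityE (x, xi) w; rewrite /ell /load /= -/v -hb => h.
have kE : k y.1 w = z^-1 * kpos v w + z^-1 * kpos x.1 w
     - \sum_i beta y.1 0 i * Num.conj (beta w 0 i).
  by rewrite -mulrDr -(sesDl kpos_ses) -(sesZl kpos_ses) -y1 /kpos addrK.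
have -> : z * ip (j v) (j w) = ip x.2 (j w) - z^-1 * kpos x.1 w +
     \sum_i beta y.1 0 i * Num.conj (beta w 0 i) - d v w - g v w - z^-1 * kpos v w.
  by rewrite -h; ring.
by rewrite kE; ring.
Qed.

End Solve.
End Pencil.

(** * Families satisfying the resolvent identity *)

Section Resolvents.
Variable R : realType.
Local Notation C := R[i].
Local Notation re := (@complex.Re R).
Local Notation im := (@complex.Im R).

Lemma abs_re_le_nm (z : C) : `|re z| <= nm z.
Proof. by rewrite -lecR -nmE; exact: normc_ge_Re. Qed.

Lemma abs_im_le_nm (z : C) : `|im z| <= nm z.
Proof.
rewrite -(@ler_sqr R) ?nnegrE ?nm_ge0 // nm_sqr real_normK ?num_real //.
by rewrite lerDr sqr_ge0.
Qed.

(** Compactness is applied to the square [[-s1, s1]^2] in [R * R]; a point off the annulus has a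
    neighbourhood off it, where nothing is to be shown. *)
Lemma annulus_bound (Q : R -> C -> Prop) (c : C) (s0 s1 : R) :
  (forall K K' z, K <= K' -> Q K z -> Q K' z) ->
  (forall z, s0 <= nm (z - c) <= s1 ->
     exists K, exists2 delta, 0 < delta & forall w, s0 <= nm (w - c) <= s1 ->
       nm (w - z) < delta -> Q K w) ->
  exists2 K, 0 <= K & forall z, s0 <= nm (z - c) <= s1 -> Q K z.
Proof.
move=> Qmono hloc.
pose pt (p : R * R) : C := c + (p.1 +i* p.2).
have pt_dist p q : nm (pt p - pt q) <= `|p.1 - q.1| + `|p.2 - q.2|.
  have -> : pt p - pt q = (p.1 - q.1) +i* (p.2 - q.2).
    by rewrite /pt opprD addrACA subrr add0r.
  exact: nm_le_re_im.
have ptB p : pt p - c = p.1 +i* p.2 by rewrite /pt addrAC subrr add0r.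
pose T (N : nat) (p : R * R) := s0 <= nm (pt p - c) <= s1 -> Q N%:R (pt p).
have /compact_near_coveringP cov : compact (`[- s1, s1] `*` `[- s1, s1]).
  by apply: compact_setX; exact: segment_compact.
have [] := cov nat \oo T _ _.
  move=> p _.
  have [K [delta d0 hK]] : exists K, exists2 delta, 0 < delta & forall q,
      s0 <= nm (pt q - c) <= s1 -> nm (pt q - pt p) < delta -> Q K (pt q).
    have [ann|] := boolP (s0 <= nm (pt p - c) <= s1).
      have [K [delta d0 h]] := hloc _ ann; exists K, delta => // q hq; exact: h.
    rewrite negb_and -!ltNge => /orP[lt|lt].
      exists 0, (s0 - nm (pt p - c)) => [|q /andP[h _] hq]; first by rewrite subr_gt0.
      by have := nm_dist (pt q) (pt p) c; lra.
    exists 0, (nm (pt p - c) - s1) => [|q /andP[_ h] hq]; first by rewrite subr_gt0.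
    by have := nm_dist (pt p) (pt q) c; rewrite (nmB (pt p) (pt q)); lra.
  have d2 : 0 < delta / 2 by rewrite divr_gt0.
  exists (ball p (delta / 2), [set N | (Num.truncn K).+1 <= N]%N).
    by split; [exact: nbhsx_ballx | exists (Num.truncn K).+1].
  move=> [q N] [[/= b1 b2] hN] hq.
  apply: (Qmono K).
    apply: le_trans (ltW (truncnS_gt K)) _; by rewrite ler_nat.
  apply: hK => //; apply: le_lt_trans (pt_dist _ _) _.
  rewrite -ball_normE /= in b1; rewrite -ball_normE /= in b2.
  by rewrite distrC (distrC q.2); lra.
move=> N _ hN; exists N%:R => // z hz.
have -> : z = pt (re (z - c), im (z - c)).
  by rewrite /pt; case: (z - c) (subrK c z) => a b /=; rewrite addrC.
apply: (hN N (leqnn N)) => /=.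
  case/andP: hz => _ hz; split; rewrite /= in_itv /= -ler_norml.
    exact: le_trans (abs_re_le_nm _) hz.
  exact: le_trans (abs_im_le_nm _) hz.
by rewrite ptB /=; move: hz; case: (z - c).
Qed.

Section Family.
Variables (E : normedModType C) (D : C -> Prop) (S : C -> E -> E).
Hypothesis S_id : forall z w x, D z -> D w -> S z x - S w x = (w - z) *: S z (S w x).
Hypothesis S_bounded : forall z, D z -> bounded_map (S z).

(** The identity gives [|S w x| <= K |x| + K |w - z| |S w x|], and for [w] near [z] the last term is
    absorbed into the left-hand side. *)
Lemma family_local z : D z -> exists K, exists2 delta, 0 < delta & forall w, D w ->
  nm (w - z) < delta -> forall x, nm (S w x) <= K * nm x.
Proof.
move=> Dz; have [K K0 hK] := S_bounded Dz.
have K1 : 0 < 2 * (K + 1) by rewrite mulr_gt0 // ltr_wpDl.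
exists (2 * K), (2 * (K + 1))^-1; first by rewrite invr_gt0.
move=> w Dw hw x.
have h1 : S w x = S z x - (w - z) *: S z (S w x) by rewrite -S_id // opprB addrC subrK.
have h2 : nm (S w x) <= K * nm x + nm (w - z) * (K * nm (S w x)).
  rewrite {1}h1; apply: le_trans (nm_triangleB _ _) _; rewrite nmZ; apply: lerD => //.
  by apply: ler_wpM2l => //; exact: nm_ge0.
have h3 : nm (w - z) * (K * nm (S w x)) <= nm (S w x) / 2.
  rewrite mulrA [leRHS]mulrC; apply: ler_wpM2r; first exact: nm_ge0.
  apply: le_trans (_ : (2 * (K + 1))^-1 * (K + 1) <= _); last first.
    by rewrite invfM -mulrA mulVf ?mulr1 // gt_eqF // ltr_wpDl.
  by apply: ler_pM; rewrite ?nm_ge0 ?lerDl // ltW.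
by move: h2 h3; lra.
Qed.

Lemma family_bound (c : C) (s0 s1 : R) : (forall z, s0 <= nm (z - c) <= s1 -> D z) ->
  exists2 K, 0 <= K & forall z, s0 <= nm (z - c) <= s1 -> forall x, nm (S z x) <= K * nm x.
Proof.
move=> hD; apply: (@annulus_bound (fun K z => forall x, nm (S z x) <= K * nm x)).
  move=> K K' z KK' h x; apply: le_trans (h x) _.
  by apply: ler_wpM2r => //; exact: nm_ge0.
move=> z hz; have [K [delta d0 h]] := family_local (hD _ hz).
by exists K, delta => // w hw; apply: h; exact: hD.
Qed.

Lemma family_lipschitz z w x K : D z -> D w ->
  (forall y, nm (S z y) <= K * nm y) -> (forall y, nm (S w y) <= K * nm y) -> 0 <= K ->
  nm (S z x - S w x) <= K ^+ 2 * nm x * nm (z - w).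
Proof.
move=> Dz Dw hz hw K0; rewrite S_id // nmZ nmB mulrC ler_wpM2r ?nm_ge0 //.
by apply: le_trans (hz _) _; rewrite expr2 -mulrA ler_wpM2l.
Qed.

(** Cauchy's theorem on a disc: the mean of [w S (c + w) x] is compared with its value [0] at radius
    zero. The derivative is [S x - w S (S x)] at [c + w], and using the resolvent identity twice
    bounds the Taylor remainder. *)
Lemma family_contour (c : C) (r : R) x eps : 0 <= r -> 0 < eps ->
  (forall z, nm (z - c) <= r -> D z) ->
  exists N, forall n, (N <= n)%N -> nm (avg n (fun w => w *: S (c + w) x) r) < eps.
Proof.
move=> r0 e0 hD.
have hD' w : nm w <= r -> D (c + w) by move=> h; apply: hD; rewrite addrC addKr.
have [|K K0 hK] := @family_bound c 0 r; first by move=> z /andP[_]; exact: hD.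
have hK' w : nm w <= r -> forall y, nm (S (c + w) y) <= K * nm y.
  by move=> h y; apply: hK; rewrite addrC addKr nm_ge0.
pose g w := w *: S (c + w) x.
pose g' w := S (c + w) x - w *: S (c + w) (S (c + w) x).
have [|||N hN] := @avg_contour_lim R E g g' ((K ^+ 2 + r * K ^+ 3) * nm x) 0 r _ _ _ eps r0 e0.
- by rewrite mulr_ge0 ?nm_ge0 // addr_ge0 ?mulr_ge0 ?exprn_ge0.
- by [].
- move=> v w /andP[_ hv] /andP[_ hw].
  have vw : c + v - (c + w) = v - w by rewrite opprD addrACA subrr add0r.
  have wv : c + w - (c + v) = w - v by rewrite opprD addrACA subrr add0r.
  have id1 y : S (c + v) y - S (c + w) y = (w - v) *: S (c + v) (S (c + w) y).
    by rewrite S_id ?wv //; exact: hD'.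
  have e2 : S (c + v) x - S (c + w) x + (v - w) *: S (c + w) (S (c + w) x)
      = (w - v) *: ((w - v) *: S (c + v) (S (c + w) (S (c + w) x))).
    by rewrite -id1 scalerBr -id1 -scaleNr opprB; congr (_ + _).
  have -> : g v - g w - (v - w) *: g' w =
     (v - w) *: (S (c + v) x - S (c + w) x) + w *: (S (c + v) x - S (c + w) x +
        (v - w) *: S (c + w) (S (c + w) x)).
    rewrite /g /g'; set A := S (c + v) x; set B := S (c + w) x; set B' := S _ B.
    rewrite [w *: (A - B + _)]scalerDr addrA -scalerDl subrK scalerA [w * _]mulrC -scalerA.
    have vB : v *: B = w *: B + (v - w) *: B by rewrite -scalerDl addrC subrK.
    rewrite [v *: (A - B)]scalerBr vB [(v - w) *: (B - _)]scalerBr opprB opprD.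
    by rewrite -!addrA; do 2! congr (_ + _); rewrite addrC.
  apply: le_trans (nm_triangle _ _) _; rewrite e2 id1 !nmZ (nmB w v).
  have h2 y : nm (S (c + v) (S (c + w) y)) <= K ^+ 2 * nm y.
    apply: le_trans (hK' _ hv _) _; rewrite expr2 -mulrA.
    by apply: ler_wpM2l => //; exact: hK'.
  have q0 := nm_ge0 (v - w).
  have -> : (K ^+ 2 + r * K ^+ 3) * nm x * nm (v - w) ^+ 2 =
     nm (v - w) * (nm (v - w) * (K ^+ 2 * nm x)) +
     r * (nm (v - w) * (nm (v - w) * (K ^+ 2 * (K * nm x)))) by ring.
  apply: lerD; first by do 2! apply: ler_wpM2l => //.
  apply: ler_pM; rewrite ?nm_ge0 ?mulr_ge0 ?nm_ge0 //.
  do 2! apply: ler_wpM2l => //; apply: le_trans (h2 _) _.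
  by apply: ler_wpM2l; rewrite ?exprn_ge0 //; exact: hK'.
exists N => n /hN; rewrite avg0r /g scale0r sub0r nmN; exact.
Qed.

End Family.
End Resolvents.

(** * The maximal unstable subspace *)

Section Energy.
Variables (R : realType) (P : damped_pencil R).
Local Notation C := R[i].
Local Notation re := (@complex.Re R).
Local Notation V := (pV P).
Local Notation H := (pH P).
Local Notation X := (V * H)%type.
Local Notation n := (pn P).
Local Notation e := (@pe R P).
Local Notation ip := (@ipH R P).
Local Notation j := (@pj R P).
Local Notation d := (@pd R P).
Local Notation k := (@pk R P).
Local Notation g := (@pg R P).
Local Notation d0 := (pd0 P).

Lemma graph_fun (x y y' : X) : graph x y -> graph x y' -> y = y'.
Proof.
move=> h h'; have := graphB h h'; rewrite subrr; set z := y - y' => -[z1 z2].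
have z10 : z.1 = 0 by apply: (@pj_inj R P); rewrite -z1 (lin_0 (@pj_lin R P)).
apply/eqP; rewrite -subr_eq0 -/z; apply/eqP.
apply: injective_projections => //=; apply: pj_total => w.
by have := z2 w; rewrite z10 (ses0l (pk_ses P)) (ses0l (pd_ses P)) (ses0l (pg_ses P)) !addr0.
Qed.

Definition energy (x y : X) : C := k x.1 y.1 + ip x.2 y.2.

Lemma energy_ses : sesquilinear_form energy.
Proof.
split=> [a x y z|z a x y]; rewrite /energy /=.
  by rewrite (pk_ses P).1 (ipH_ses P).1; ring.
by rewrite (pk_ses P).2 (ipH_ses P).2; ring.
Qed.

Lemma energy_herm x y : energy x y = Num.conj (energy y x).
Proof. by rewrite /energy rmorphD; congr (_ + _); [exact: pk_herm | exact: ipH_herm]. Qed.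

Lemma energy_bounded : bounded_form energy.
Proof.
have [K K0 hK] := pk_bounded P; exists (K + 1); first by rewrite addr_ge0.
move=> x y; rewrite mulrDl mulrDl mul1r; apply: le_trans (nm_triangle _ _) _.
apply: lerD.
  apply: le_trans (hK _ _) _; rewrite -!mulrA ler_wpM2l //.
  by apply: ler_pM; rewrite ?nm_ge0 ?nm_fst.
apply: le_trans (cauchy_schwarz (@ipH_ses R P) (@ipH_herm R P) (@ipH_norm R P) _ _) _.
by apply: ler_pM; rewrite ?nm_ge0 ?nm_snd.
Qed.

(* Dissipation identity: along [x' = y] the energy decays at the rate [2 d y y]. *)
Lemma energy_graph x y x' y' : graph x y -> graph x' y' ->
  energy y x' + energy x y' = - 2 * d y.1 y'.1.
Proof.
move=> [h1 h2] [h1' h2']; rewrite /energy h1 h1'.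
have e1 : ip y.2 (j y'.1) = - (k x.1 y'.1 + d y.1 y'.1 + g y.1 y'.1).
  by apply/eqP; rewrite -addr_eq0 -[X in _ == X](h2 y'.1); apply/eqP; ring.
have e2 : ip (j y.1) y'.2 = - (k y.1 x'.1 + d y.1 y'.1 - g y.1 y'.1).
  rewrite (ipH_herm _ y'.2).
  have -> : ip y'.2 (j y.1) = - (k x'.1 y.1 + d y'.1 y.1 + g y'.1 y.1).
    by apply/eqP; rewrite -addr_eq0 -[X in _ == X](h2' y.1); apply/eqP; ring.
  by rewrite (pk_herm y.1) (pd_herm y.1) (pg_skew y.1 y'.1) opprK rmorphN !rmorphD.
by rewrite e1 e2; ring.
Qed.

Lemma energy_decay x y : graph x y -> re (energy y x) = - re (d y.1 y.1).
Proof.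
move=> h; have := congr1 re (energy_graph h h).
rewrite (energy_herm x y) reD re_conj mulNr reN.
have -> : re (2 * d y.1 y.1) = 2 * re (d y.1 y.1).
  by rewrite mulr2n mulrDl mul1r reD; ring.
lra.
Qed.

Lemma d_ge0 u : 0 <= re (d u u).
Proof. by apply: le_trans (pd_coercive u); rewrite mulr_ge0 ?sqr_ge0 // ltW // pd0_gt0. Qed.

Lemma d_eq0 u : re (d u u) = 0 -> u = 0.
Proof.
move=> h; have := pd_coercive u; rewrite h pmulr_rle0 ?pd0_gt0 // => h2.
by apply/eqP; rewrite -nm_eq0 -sqrf_eq0 eq_le h2 sqr_ge0.
Qed.

(** At [s conj(q u v) u + v] the form is affine in [s] with slope [2 |q u v|^2]; being bounded above
    for all [s], it has slope zero. *)
Lemma semidef_radical (E : lmodType C) (q : E -> E -> C) :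
  sesquilinear_form q -> (forall u v, q u v = Num.conj (q v u)) ->
  (forall u, re (q u u) <= 0) -> forall u, re (q u u) = 0 -> forall v, q u v = 0.
Proof.
move=> qS qH qle u u0 v; have qu0 : q u u = 0 by rewrite (herm_real (qH u u)) u0.
apply/eqP; rewrite -nm_eq0; apply/negPn/negP => a0.
have q0 : 0 < nm (q u v) ^+ 2 by rewrite exprn_gt0 // lt_def a0 nm_ge0.
have est (s : R) : 2 * (s * nm (q u v) ^+ 2) <= - re (q v v).
  have := qle ((s%:C * Num.conj (q u v)) *: u + v).
  rewrite (sesDl qS) !(sesDr qS) !(sesZl qS) !(sesZr qS) qu0 !mulr0 add0r.
  rewrite (qH v u) !reD rmorphM /= conj_realE conjCK -!mulrA !reZ.
  rewrite [Num.conj (q u v) * _]mulrC -nm_sqrE; lra.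
have := est ((`|re (q v v)| + 1) / nm (q u v) ^+ 2).
rewrite divfK ?gt_eqF //; have := ler_norm (- re (q v v)).
by have := normr_ge0 (re (q v v)); rewrite normrN; lra.
Qed.

(* The span of [f] is invariant under the generator, which acts there by the
   matrix [B], with spectrum in the open right half-plane. *)
Definition unstable_family m (f : 'I_m -> X) (B : 'M[C]_m) : Prop :=
  [/\ lin_indep f, forall i, graph (f i) (comb f (row i B)) &
      forall a, eigenvalue B a -> 0 < re a].

Lemma unstable_graph m (f : 'I_m -> X) B c : unstable_family f B ->
  graph (comb f c) (comb f (c *m B)).
Proof. by move=> [_ h _]; rewrite comb_mul; exact: graph_comb. Qed.

Section Unstable.
Variables (m : nat) (f : 'I_m -> X) (B : 'M[C]_m).
Hypothesis fB : unstable_family f B.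

Let indep : lin_indep f. Proof. by case: fB. Qed.
Let q u v := energy (comb f u) (comb f v).

Let q_ses : sesquilinear_form q.
Proof.
split=> [a x y z|z a x y]; rewrite /q (comb_linear f); first exact: energy_ses.1.
exact: energy_ses.2.
Qed.

Let q_herm u v : q u v = Num.conj (q v u). Proof. exact: energy_herm. Qed.

Let q_le0 u : re (q u u) <= 0.
Proof.
apply: (lyapunov q_ses q_herm (B := B)); first by case: fB.
by move=> y; rewrite /q (energy_decay (unstable_graph _ fB)) oppr_le0 d_ge0.
Qed.

(** A vector of zero energy lies in the radical of [q]. By the dissipation identity its image under
    [B] has zero first component and lies in the radical too. Applying this twice gives
    [c *m B = 0], against the absence of the eigenvalue [0]. *)
Lemma unstable_energy c : c != 0 -> re (q c c) < 0.
Proof.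
move=> c0; rewrite lt_neqAle q_le0 andbT; apply/negP => /eqP qc0.
have rad u : (forall v, q u v = 0) ->
    (comb f (u *m B)).1 = 0 /\ (forall v, q (u *m B) v = 0).
  move=> hu; have gu := unstable_graph u fB.
  have d1 : d (comb f (u *m B)).1 (comb f (u *m B)).1 = 0.
    have := energy_graph gu gu; rewrite -/(q _ _) -/(q u _) hu q_herm hu rmorph0 add0r.
    by move/esym/eqP; rewrite mulf_eq0 oppr_eq0 pnatr_eq0 => /eqP.
  have y1 : (comb f (u *m B)).1 = 0 by apply: d_eq0; rewrite d1.
  split=> // v; have := energy_graph gu (unstable_graph v fB).
  by rewrite -/(q _ _) -/(q u _) hu addr0 y1 (ses0l (pd_ses P)) mulr0.
have [y1 hB] := rad c (semidef_radical q_ses q_herm q_le0 qc0).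
have [y2 _] := rad _ hB.
have cB0 : c *m B = 0.
  apply: (comb_inj indep); rewrite (lin_0 (comb_linear f)).
  apply: injective_projections => //=.
  have [-> _] := unstable_graph (c *m B) fB.
  by rewrite y2 (lin_0 (@pj_lin R P)).
have : eigenvalue B 0 by apply/eigenvalueP; exists c; rewrite // scale0r.
by case: fB => _ _ h /h; rewrite ltxx.
Qed.

Lemma unstable_orth c : (forall i, energy (comb f c) (f i) = 0) -> c = 0.
Proof.
move=> h; apply/eqP/negPn/negP => /unstable_energy; rewrite /q.
rewrite {2}/comb (ses_sumr energy_ses) big1 ?ltxx // => i _.
by rewrite (sesZr energy_ses) h mulr0.
Qed.

(** The energy is negative on the span but, by [pe_max], nonnegative where [beta] of the first
    component vanishes, so this map into [n] coordinates is injective on the span. *)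
Lemma unstable_dim : (m <= n)%N.
Proof.
apply: (@lin_indep_leq R _ _ _ f (fun x => beta x.1)) => //.
  by move=> a x y; rewrite /= beta_lin.
move=> c hc; have [->|/unstable_energy] := eqVneq c 0.
  by rewrite (lin_0 (comb_linear f)).
rewrite /q /energy reD ltNge addr_ge0 //.
  apply: pe_max => i; have /rowP/(_ i) := hc; rewrite !mxE => /eqP.
  by rewrite oppr_eq0 => /eqP.
by rewrite ipH_norm; exact: sqr_ge0.
Qed.

(** Adjoining [x] gives a block triangular matrix with diagonal blocks [z] and [B], whose
    eigenvalues are among [z] and those of [B]. *)
Lemma unstable_extend z x y c : 0 < re z -> graph x y -> z *: x - y = comb f c ->
  (forall c', x <> comb f c') ->
  exists f' : 'I_(1 + m) -> X, exists B', unstable_family f' B'.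
Proof.
move=> z0 xy hc nx.
exists (fun i : 'I_(1 + m) => match fintype.split i with inl _ => x | inr l => f l end).
set f' : 'I_(1 + m) -> X := fun i => _.
have f'l l : f' (lshift m l) = x by rewrite /f' (unsplitK (inl _ l)).
have f'r l : f' (rshift 1 l) = f l by rewrite /f' (unsplitK (inr _ l)).
have f'E (s : 'rV[C]_1) v : comb f' (row_mx s v) = s 0 0 *: x + comb f v.
  rewrite /comb big_split_ord /= big_ord1 row_mxEl f'l; congr (_ + _).
  by apply: eq_bigr => i _; rewrite row_mxEr f'r.
exists (block_mx z%:M (- c) 0 B); split.
- apply/lin_indepP => w; rewrite -[w]hsubmxK f'E => h.
  have s0 : lsubmx w 0 0 = 0.
    apply/eqP/negPn/negP => s0.
    apply: (nx ((- (lsubmx w 0 0)^-1) *: rsubmx w)).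
    rewrite (lin_Z (comb_linear f)); move/eqP: h; rewrite addrC addr_eq0 => /eqP ->.
    by rewrite scaleNr scalerN opprK scalerA mulVf // scale1r.
  move: h; rewrite s0 scale0r add0r => /((lin_indepP f).1 indep) ->.
  by rewrite [lsubmx w]mx11_scalar s0 raddf0 row_mx0.
- move=> i; case: (split_ordP i) => l ->; rewrite /block_mx.
    rewrite rowKu row_row_mx f'E f'l !mxE ord1 eqxx mulr1n.
    have -> : row 0 (- c) = - c by apply/rowP => i'; rewrite !mxE.
    by rewrite (lin_N (comb_linear f)) -hc opprB addrC subrK.
  rewrite rowKd row_row_mx f'E f'r !mxE scale0r add0r.
  by case: fB => _ h _; exact: h.
- move=> a /eigenvalueP [w]; rewrite -[w]hsubmxK => hw w0.
  move: hw; rewrite mul_row_block mulmx0 addr0 scale_row_mx => /eq_row_mx [h1 h2].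
  have [s0|s0] := eqVneq (lsubmx w 0 0) 0; last first.
    suff -> : a = z by [].
    move: h1; rewrite mul_mx_scalar => /matrixP/(_ 0 0); rewrite mxE [in RHS]mxE.
    by move/(mulIf s0).
  have u0 : lsubmx w = 0 by rewrite [lsubmx w]mx11_scalar s0 raddf0.
  case: fB => _ _; apply; apply/eigenvalueP; exists (rsubmx w).
    by rewrite -h2 u0 mul0mx add0r.
  by apply: contra_neq w0 => ->; rewrite u0 row_mx0.
Qed.
End Unstable.

(** This says that [z] is not an eigenvalue of the operator induced on the quotient by the span of
    [f]. *)
Definition saturated_at m (f : 'I_m -> X) (z : C) : Prop :=
  forall x y c, graph x y -> z *: x - y = comb f c -> exists c', x = comb f c'.

Theorem maximal_unstable : exists m (f : 'I_m -> X) B,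
  unstable_family f B /\ forall z, 0 < re z -> saturated_at f z.
Proof.
pose Q m := `[< exists (f : 'I_m -> X) B, unstable_family f B >].
have Q0 : exists m, Q m.
  exists 0%N; apply/asboolP; exists (fun=> 0), 0; split=> [c _ []//|[]//|a].
  by move=> /eigenvalueP[v _]; rewrite thinmx0 eqxx.
have bound m : Q m -> (m <= n)%N by move=> /asboolP[f [B /unstable_dim]].
case: (ex_maxnP Q0 bound) => m /asboolP[f [B fB]] m_max.
exists m, f, B; split=> // z z0 x y c xy hc; apply: contrapT => nx.
have [] := unstable_extend fB z0 xy hc.
  by move=> c' xc'; apply: nx; exists c'.
move=> f' [B' fB']; suff /m_max : Q (1 + m)%N by rewrite add1n ltnn.
by apply/asboolP; exists f', B'.
Qed.

(* [y] is the value at [x] of the resolvent at [z] of the operator induced on the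
   quotient by the span of [f], realised on the energy-orthogonal complement. *)
Definition compressed_resolvent m (f : 'I_m -> X) (z : C) (x y : X) : Prop :=
  (forall i, energy y (f i) = 0) /\ exists c, graph y (z *: y - x + comb f c).

Section Compressed.
Variables (m : nat) (f : 'I_m -> X) (B : 'M[C]_m).
Hypothesis fB : unstable_family f B.
Local Notation cres := (compressed_resolvent f).

Lemma cres_lin z a x y x' y' : cres z x y -> cres z x' y' ->
  cres z (a *: x + x') (a *: y + y').
Proof.
move=> [h1 [c h2]] [h1' [c' h2']]; split=> [i|].
  by rewrite energy_ses.1 h1 h1' mulr0 addr0.
exists (a *: c + c'); rewrite (comb_linear f); have := graph_lin a h2 h2'.
congr graph; rewrite [a *: (_ + comb f c)]scalerDr [a *: (_ - _)]scalerBr addrACA.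
rewrite [_ - _ + (_ - _)]addrACA -opprD [z *: (_ + _)]scalerDr; congr (_ + _ - _ + _).
by rewrite !scalerA mulrC.
Qed.

(** The resolvent identity at the level of the relation, where it holds before existence and
    uniqueness of the values are known. *)
Lemma cres_identity z w x y y' : cres z x y -> cres w x y' ->
  cres z ((w - z) *: y') (y - y').
Proof.
move=> [h1 [c h2]] [h1' [c' h2']]; split=> [i|].
  by rewrite (sesBl energy_ses) h1 h1' subr0.
exists (c - c'); rewrite (lin_B (comb_linear f)); have := graphB h2 h2'.
congr graph; rewrite opprD addrACA; congr (_ + _).
by rewrite opprB addrA subrK scalerBr scalerBl opprB addrA subrK.
Qed.

(** The difference of two values lies in the span by saturation and is energy-orthogonal to it,
    while the energy is definite there. *)
Lemma cres_unique z x y y' : saturated_at f z -> cres z x y -> cres z x y' -> y = y'.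
Proof.
move=> sat h h'; have [h1 [c h2]] := cres_identity h h'.
rewrite subrr scale0r subr0 in h2.
have [c' yc] : exists c', y - y' = comb f c'.
  apply: sat h2 _; rewrite opprD addrA subrr add0r -(lin_N (comb_linear f)).
  by [].
apply/eqP; rewrite -subr_eq0 yc.
rewrite (unstable_orth fB (c := c')) ?(lin_0 (comb_linear f)) // => i.
by rewrite -yc.
Qed.

(** Both vectors solve the same equation modulo the span of [f], so saturation applies to their
    difference. *)
Lemma resolvent_cres z x y y' : saturated_at f z -> graph y (z *: y - x) ->
  cres z x y' -> exists c, y - y' = comb f c.
Proof.
move=> sat h [_ [b hb]]; apply: (sat _ _ b (graphB h hb)).
have rearr (E : zmodType) (p q r t : E) : p - q - (p - r - (q - r + t)) = t.
  rewrite !opprB [q - r + t]addrC -[t + _ + _]addrA [q - r + (r - p)]addrA subrK.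
  by rewrite [p - q + _]addrCA -(opprB q p) addNr addr0.
by rewrite scalerBr rearr.
Qed.

(** An application of [bordering] with [n + m] parameters, the vector [xi] of [load] and the
    coefficients on [f]. The conditions are the [n] equations [beta y.1 = xi] and the [m]
    orthogonality relations; injectivity of this square system comes from [cres_unique] and the
    independence of [f]. *)
Theorem cres_exists z : 0 < re z -> saturated_at f z ->
  exists2 S : X -> X, bounded_map S & forall x, cres z x (S x).
Proof.
move=> z0 sat.
pose Y0 (x : X) : X := solve z0 (x, 0).
pose Y1 (q : 'rV[C]_(n + m)) : X := solve z0 (- comb f (rsubmx q), lsubmx q).
pose con (y : X) : 'rV[C]_m := \row_i energy y (f i).
pose T0 (x : X) : 'rV[C]_(n + m) := row_mx (beta (Y0 x).1) (con (Y0 x)).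
pose T1 (q : 'rV[C]_(n + m)) : 'rV[C]_(n + m) :=
  row_mx (beta (Y1 q).1 - lsubmx q) (con (Y1 q)).
have con_lin : linear con.
  by move=> a u v; apply/rowP => i; rewrite !mxE energy_ses.1.
have Y1_lin : linear Y1.
  move=> a u v; rewrite /Y1 -(solve_lin z0); congr (solve _ (_, _)).
    by rewrite !linearP /= (comb_linear f) opprD scalerN.
  by rewrite linearP.
have T1_lin : linear T1.
  move=> a u v; rewrite /T1 Y1_lin con_lin.
  have -> : (a *: Y1 u + Y1 v).1 = a *: (Y1 u).1 + (Y1 v).1 by [].
  rewrite (@beta_lin R P) [lsubmx (a *: u + v)]linearP.
  by rewrite scale_row_mx add_row_mx scalerBr opprD addrACA.
have YE x q : Y0 x + Y1 q = solve z0 (x - comb f (rsubmx q), lsubmx q).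
  have := solve_lin z0 1 (x, 0) (- comb f (rsubmx q), lsubmx q).
  rewrite !scale1r => <-; congr (solve _ (_, _)); exact: add0r.
have main x q : T0 x + T1 q = 0 -> cres z x (Y0 x + Y1 q) /\
    graph (Y0 x + Y1 q) (z *: (Y0 x + Y1 q) - x + comb f (rsubmx q)) /\
    beta (Y0 x + Y1 q).1 = lsubmx q.
  rewrite /T0 /T1 add_row_mx -[X in _ = X]row_mx0 => /eq_row_mx [h1 h2].
  have b : beta (Y0 x + Y1 q).1 = lsubmx q.
    have -> : (Y0 x + Y1 q).1 = (Y0 x).1 + (Y1 q).1 by [].
    by apply/eqP; rewrite -subr_eq0 (lin_D (@beta_lin R P)) -addrA h1.
  have gr : graph (Y0 x + Y1 q) (z *: (Y0 x + Y1 q) - x + comb f (rsubmx q)).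
    have := b; rewrite YE => /solve_graph; congr graph.
    by rewrite opprB addrA addrAC.
  split=> //; split; last by exists (rsubmx q).
  move=> i; move/rowP/(_ i): h2; rewrite !mxE => <-.
  by rewrite (sesDl energy_ses).
have Y00 : Y0 0 = 0 by rewrite /Y0; exact: (lin_0 (solve_lin z0)).
have T1_inj q : T1 q = 0 -> q = 0.
  move=> hq; have [] := main 0 q.
    by rewrite /T0 Y00 /= (lin_0 (@beta_lin R P)) (lin_0 con_lin) row_mx0 add0r.
  rewrite Y00 add0r subr0 => h1 [gr hb].
  have y0 : Y1 q = 0.
    apply: (cres_unique (z := z) (x := 0)) => //; split.
      by move=> i; rewrite (ses0l energy_ses).
    by exists 0; rewrite (lin_0 (comb_linear f)) scaler0 subr0 addr0; exact: graph0.
  rewrite y0 scaler0 add0r in gr; rewrite y0 in hb.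
  have c0 : rsubmx q = 0.
    by apply: ((lin_indepP f).1 _); [case: fB | exact: graph_fun gr (@graph0 R P)].
  by rewrite -[q]hsubmxK c0 -hb /= (lin_0 (@beta_lin R P)) row_mx0.
have T0_bounded i : bounded_map (fun x => T0 x 0 i).
  have Y0b := @solve_bounded R P z z0.
  case: (split_ordP i) => l ->.
    have [K K0 hK] := bounded_map_comp (beta_bounded l)
      (bounded_map_comp (bounded_map_fst _ _) Y0b).
    by exists K => // x; rewrite row_mxEl; exact: hK.
  have [K K0 hK] := bounded_map_comp (bounded_form_map (f l) energy_bounded) Y0b.
  by exists K => // x; rewrite row_mxEr mxE; exact: hK.
have [q hq hb] := bordering (@solve_bounded R P z z0) Y1_lin T0_bounded T1_lin T1_inj.
exists (fun x => Y0 x + Y1 (q x)); first exact: hb.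
by move=> x; have [] := main x (q x) (hq x).
Qed.
End Compressed.
End Energy.

(** * The lower bound on its dimension *)

Section LowerBound.
Variables (R : realType) (P : damped_pencil R).
Local Notation C := R[i].
Local Notation re := (@complex.Re R).
Local Notation V := (pV P).
Local Notation H := (pH P).
Local Notation X := (V * H)%type.
Local Notation n := (pn P).
Local Notation e := (@pe R P).
Local Notation ip := (@ipH R P).
Local Notation j := (@pj R P).
Local Notation d := (@pd R P).
Local Notation k := (@pk R P).
Local Notation g := (@pg R P).
Local Notation d0 := (pd0 P).

(** The case [m = 0] of [cres_exists]: the empty family is saturated at [z] when [z] is not an
    eigenvalue. *)
Lemma exact_resolvent (z : C) : 0 < re z ->
  (forall x : X, graph x (z *: x) -> x = 0) ->
  exists2 S : X -> X, bounded_map S & forall x, graph (S x) (z *: S x - x).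
Proof.
move=> z0 inj; pose f (i : 'I_0) : X := 0.
have f0 c : comb f c = 0 by rewrite /comb big_ord0.
have fB : unstable_family f 0.
  split=> [c _ []//|[]//|a]; by move=> /eigenvalueP[v _]; rewrite thinmx0 eqxx.
have sat : saturated_at f z.
  move=> x y c xy; rewrite f0 => /eqP; rewrite subr_eq0 => /eqP zx.
  by exists 0; rewrite f0; apply: inj; rewrite zx.
have [S Sb hS] := cres_exists fB z0 sat; exists S => // x.
by have [_ [c]] := hS x; rewrite f0 addr0.
Qed.

Definition hdot m (u v : 'rV[C]_m) : C := \sum_i u 0 i * Num.conj (v 0 i).
Definition sqn m (u : 'rV[C]_m) : R := \sum_i nm (u 0 i) ^+ 2.

Lemma hdot_ses m : sesquilinear_form (@hdot m).
Proof.
apply: sesquilinear_form_sum => i.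
by apply: sesquilinear_form_rank1 => a x y; rewrite !mxE.
Qed.

Lemma re_hdot m (u : 'rV[C]_m) : re (hdot u u) = sqn u.
Proof. by rewrite re_sum; apply: eq_bigr => i _; rewrite nm_sqrE. Qed.

Lemma hdot_herm m (u v : 'rV[C]_m) : hdot u v = Num.conj (hdot v u).
Proof.
by rewrite /hdot rmorph_sum; apply: eq_bigr => i _; rewrite rmorphM /= conjCK mulrC.
Qed.

Lemma sqn_ge0 m (u : 'rV[C]_m) : 0 <= sqn u.
Proof. by apply: sumr_ge0 => i _; exact: sqr_ge0. Qed.

Lemma sqn_gt0 m (u : 'rV[C]_m) : u != 0 -> 0 < sqn u.
Proof.
move=> u0; rewrite lt_def sqn_ge0 andbT; apply: contra u0.
rewrite psumr_eq0 => [/allP h|i _]; last exact: sqr_ge0.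
apply/eqP/rowP => i; rewrite mxE; apply/eqP; rewrite -nm_eq0.
by have := h i (mem_index_enum _); rewrite /= expf_eq0.
Qed.

Lemma sqnZ m a (u : 'rV[C]_m) : sqn (a *: u) = nm a ^+ 2 * sqn u.
Proof. by rewrite /sqn mulr_sumr; apply: eq_bigr => i _; rewrite mxE nmM exprMn. Qed.

Lemma sqnB m (u v : 'rV[C]_m) : sqn (u - v) = sqn u + sqn v - 2 * re (hdot u v).
Proof.
rewrite -!re_hdot (sesBl (@hdot_ses m)) !(sesBr (@hdot_ses m)) !reB.
by rewrite (hdot_herm v u) re_conj; ring.
Qed.

Section TransferMatrix.
Variables (z : C) (z0 : 0 < re z).

Definition response (xi : 'rV[C]_n) : V := velocity z0 (0, xi).

Lemma responseE xi w : ell z (response xi) w = hdot xi (beta w).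
Proof.
rewrite /response velocityE /load /= (ses0l (@ipH_ses R P)) (ses0l (kpos_ses P)).
by rewrite mulr0 subr0 add0r.
Qed.

(** The matrix [Q(z)] acting on row vectors, from the input [xi] to the coordinates [beta] of the
    velocity it excites. *)
Definition transfer (xi : 'rV[C]_n) : 'rV[C]_n := beta (response xi).

(** Data in the span of the [e i] are invisible to [kpos], so the only input left in the modified
    equation is [beta x.1]. *)
Lemma response_graph (x y : X) eta : graph x y -> z *: x - y = (comb e eta, 0) ->
  y.1 = response (beta x.1).
Proof.
move=> [h1 h2] hy; have zn0 : z != 0 by apply: contraTneq z0 => ->; rewrite ltxx.
have hy1 : y.1 = z *: x.1 - comb e eta.
  by move/(congr1 fst): hy => /= <-; rewrite opprB addrC subrK.
have hy2 : y.2 = z *: x.2.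
  by move/(congr1 snd): hy => /= /eqP; rewrite subr_eq0 => /eqP.
apply: (ell_inj z0) => w; rewrite responseE.
have kc : kpos (comb e eta) w = 0.
  rewrite (ses_suml (kpos_ses P)) big1 // => i _.
  by rewrite (sesZl (kpos_ses P)) kpos_e mulr0.
have ky : z^-1 * kpos y.1 w = k x.1 w + hdot (beta x.1) (beta w).
  by rewrite hy1 (sesBl (kpos_ses P)) (sesZl (kpos_ses P)) kc subr0 mulKf.
rewrite /ell ky; have := h2 w; rewrite hy2 h1 (sesZl (@ipH_ses R P)) => h.
by rewrite -[RHS]add0r -[X in _ = X + _]h; ring.
Qed.

Lemma transfer_graph (x y : X) eta : graph x y -> z *: x - y = (comb e eta, 0) ->
  z *: beta x.1 - eta = transfer (beta x.1).
Proof.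
move=> xy hy; rewrite /transfer -(response_graph xy hy).
have -> : y.1 = z *: x.1 - comb e eta.
  by move/(congr1 fst): hy => /= <-; rewrite opprB addrC subrK.
by rewrite (lin_B (@beta_lin R P)) (lin_Z (@beta_lin R P)) beta_comb_e.
Qed.

Lemma response0 : response 0 = 0.
Proof. exact: (lin_0 (@velocity_lin R P z z0)). Qed.

Lemma response_energy xi : d0 * nm (response xi) ^+ 2 <= re (hdot (transfer xi) xi).
Proof.
by rewrite hdot_herm re_conj /transfer -responseE; exact: ell_coercive.
Qed.

End TransferMatrix.

Lemma transfer_bound : exists2 K, 0 <= K & forall z (z0 : 0 < re z) xi,
  sqn (transfer z0 xi) <= K * nm (response z0 xi) ^+ 2.
Proof.
have /choice[K hK] : forall i, exists K, 0 <= K /\ forall u, nm (@beta R P u 0 i) <= K * nm u.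
  by move=> i; have [K K0 hK] := @beta_bounded R P i; exists K.
exists (\sum_i K i ^+ 2); first by apply: sumr_ge0 => i _; exact: sqr_ge0.
move=> z z0 xi; rewrite mulr_suml; apply: ler_sum => i _; have [K0 h] := hK i.
by rewrite -exprMn ler_sqr ?nnegrE ?nm_ge0 ?mulr_ge0 ?nm_ge0 //; exact: h.
Qed.

(** Testing the response with [e i] recovers the [i]-th entry of [xi]. There [kpos] vanishes, so the
    term with [z^-1] drops out and the constant depends on [z] only through [r]. *)
Lemma input_bound r : 0 <= r -> exists2 K, 0 <= K & forall z (z0 : 0 < re z) xi, nm z <= r ->
  sqn xi <= K * nm (response z0 xi) ^+ 2.
Proof.
move=> r0; have [J J0 hJ] := ipj_bounded P.
have [D D0 hD] := pd_bounded P; have [G G0 hG] := pg_bounded P.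
have rJ : 0 <= r * J + D + G by rewrite !addr_ge0 ?mulr_ge0.
exists (\sum_i ((r * J + D + G) * nm (e i)) ^+ 2).
  by apply: sumr_ge0 => i _; exact: sqr_ge0.
move=> z z0 xi zr; rewrite mulr_suml; apply: ler_sum => i _; set u := response z0 xi.
rewrite -exprMn ler_sqr ?nnegrE ?nm_ge0 ?mulr_ge0 ?nm_ge0 //.
have -> : xi 0 i = z * ip (j u) (j (e i)) + d u (e i) + g u (e i).
  have -> : xi 0 i = hdot xi (beta (e i)).
    rewrite beta_e /hdot (bigD1 i) //= mxE !eqxx rmorph1 mulr1 big1 ?addr0 // => l li.
    by rewrite mxE (negbTE li) andbF rmorph0 mulr0.
  rewrite -(responseE z0) -/u /ell.
  have -> : kpos u (e i) = 0.
    have herm a b : kpos a b = Num.conj (@kpos R P b a).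
      rewrite /kpos rmorphD rmorph_sum; congr (_ + _); first exact: pk_herm.
      by apply: eq_bigr => l _; rewrite rmorphM /= conjCK mulrC.
    by rewrite herm kpos_e rmorph0.
  by rewrite mulr0 addr0.
have p0 := mulr_ge0 (nm_ge0 u) (nm_ge0 (e i)).
apply: le_trans (nm_triangle _ _) _.
have -> : (r * J + D + G) * nm (e i) * nm u =
   r * (J * nm u * nm (e i)) + D * nm u * nm (e i) + G * nm u * nm (e i) by ring.
apply: lerD; last exact: hG.
apply: le_trans (nm_triangle _ _) _; apply: lerD; last exact: hD.
by rewrite nmM; apply: ler_pM; rewrite ?nm_ge0 //; exact: hJ.
Qed.

(* With [u] the response to [xi], one has [|transfer xi|^2 <= K |u|^2],
   [d0 |u|^2 <= re (transfer xi, xi)] and [|xi|^2 <= L' |u|^2]; for [a > K / d0] the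
   bound follows by expanding [|transfer xi - a xi|^2]. *)
Lemma transfer_circle : exists a rho theta : R,
  [/\ 0 < rho, rho < a, 0 <= theta < rho & forall z (z0 : 0 < re z) xi,
      nm (z - a%:C) <= rho -> sqn (transfer z0 xi - a%:C *: xi) <= theta ^+ 2 * sqn xi].
Proof.
have [K K0 hK] := transfer_bound; have d0_gt0 := pd0_gt0 P.
pose a := K / d0 + 1; have a0 : 0 < a by rewrite ltr_wpDl // divr_ge0 // ltW.
have [L' L'0 hL'] := @input_bound (2 * a) (mulr_ge0 (ler0n _ 2) (ltW a0)).
(* The summand [d0 / a] makes [L] positive and yields [delta <= a^2], so the radicands in [rho] and
   [theta] are nonnegative. *)
pose L := L' + d0 / a; have da : 0 < d0 / a by rewrite divr_gt0.
have L0 : 0 < L by rewrite ltr_wpDl.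
pose delta := a * d0 / L.
have delta0 : 0 < delta by rewrite divr_gt0 // mulr_gt0.
have delta_le : delta <= a ^+ 2.
  rewrite /delta ler_pdivrMr // /L mulrDr.
  have -> : a ^+ 2 * (d0 / a) = a * d0 by field; exact: lt0r_neq0.
  by rewrite lerDr mulr_ge0 ?sqr_ge0.
have t0 : 0 <= a ^+ 2 - delta by lra.
have r0 : 0 < a ^+ 2 - delta / 2 by lra.
exists a, (Num.sqrt (a ^+ 2 - delta / 2)), (Num.sqrt (a ^+ 2 - delta)).
have rho_a : Num.sqrt (a ^+ 2 - delta / 2) < a.
  by rewrite -[ltRHS](ger0_norm (ltW a0)) -sqrtr_sqr ltr_sqrt ?exprn_gt0 //; lra.
split=> //; first by rewrite sqrtr_gt0.
  by rewrite sqrtr_ge0 ltr_sqrt //; lra.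
move=> z z0 xi hz; rewrite sqr_sqrtr // sqnB sqnZ nmC ger0_norm ?(ltW a0) //.
rewrite (sesZr (@hdot_ses n)) conj_realE reZ.
have z2a : nm z <= 2 * a.
  have := nm_dist z a%:C 0; rewrite !subr0 nmC ger0_norm ?(ltW a0) //; lra.
have h1 := hK _ z0 xi; have h2 := hL' _ z0 xi z2a; have h3 := response_energy z0 xi.
set u2 := nm (response z0 xi) ^+ 2 in h1 h2 h3; have u20 : 0 <= u2 by exact: sqr_ge0.
clearbody u2.
set t := re _ in h3 *.
have h4 : K * u2 <= a * t.
  apply: le_trans (_ : a * (d0 * u2) <= _); last by rewrite ler_pM2l.
  rewrite mulrA ler_wpM2r // /a mulrDl divfK ?gt_eqF // lerDl mul1r ltW //.
have h5 : delta * sqn xi <= a * t.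
  apply: le_trans (_ : a * (d0 * u2) <= _); last by rewrite ler_pM2l.
  rewrite /delta mulrAC ler_pdivrMr // -!mulrA ler_pM2l // ler_pM2l // mulrC.
  by apply: le_trans h2 _; rewrite ler_wpM2r // /L lerDl ltW.
move: h1 h4 h5; move: (sqn (transfer _ _)) (sqn xi) (K * u2) (a * t) => p q s w.
nra.
Qed.

Theorem unstable_dim_ge m (f : 'I_m -> X) B : unstable_family f B ->
  (forall z, 0 < re z -> saturated_at f z) -> (n <= m)%N.
Proof.
move=> fB sat; rewrite leqNgt; apply/negP => mn.
have [a [rho [theta [rho0 rho_a /andP[th0 th_rho] hT]]]] := transfer_circle.
have disc (z : C) : nm (z - a%:C) <= rho -> 0 < re z.
  move=> h; have := abs_re_le_nm (z - a%:C); rewrite reB /= => h2.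
  by have := ler_norm (- (re z - a)); rewrite normrN; lra.
(* As [m < n], some nonzero vector is orthogonal to all [beta (f i).1]; it is conjugated because
   [hdot] is antilinear in its second argument. *)
have [c c0 hc] := row_kernel_exists (\matrix_(l < n, i < m) beta (f i).1 0 l) mn.
pose eta : 'rV[C]_n := \row_l Num.conj (c 0 l).
have eta0 : eta != 0.
  apply: contra_neq c0 => h; apply/rowP => l; have /rowP/(_ l) := h.
  by rewrite !mxE => /eqP; rewrite fmorph_eq0 => /eqP.
(* This functional vanishes on the span of [f], so it does not distinguish the resolvent from the
   compressed one. *)
pose lf (x : X) : C := hdot (beta x.1) eta.
have lf_lin : linear (lf : X -> C^o).
  by move=> b x y; rewrite /lf /= (@beta_lin R P) (@hdot_ses n).1.
have lf_f i : lf (f i) = 0.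
  have /rowP/(_ i) := hc; rewrite !mxE => h; rewrite -[RHS]h.
  by apply: eq_bigr => l _; rewrite !mxE conjCK mulrC.
have lf_comb b : lf (comb f b) = 0.
  rewrite (lin_comb (F := C^o) _ _ lf_lin) /comb big1 // => i _.
  by rewrite /= lf_f scaler0.
have lf_bounded : bounded_map lf.
  apply: bounded_map_sum => l.
  have [K K0 hK] := bounded_map_mul (Num.conj (eta 0 l))
    (bounded_map_comp (@beta_bounded R P l) (bounded_map_fst V H)).
  by exists K => // x; rewrite mulrC; exact: hK.
pose D (z : C) : Prop := nm (z - a%:C) <= rho.
(* Off the disc [S] takes the default value [id]. *)
have /choice[S hS] : forall z : C, exists S : X -> X, D z ->
    bounded_map S /\ forall x, compressed_resolvent f z x (S x).
  move=> z; have [Dz|nDz] := boolP (nm (z - a%:C) <= rho); last by exists id => /(negP nDz).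
  have [S Sb h] := cres_exists fB (disc _ Dz) (sat _ (disc _ Dz)).
  by exists S.
have S_uniq (z : C) x y : D z -> compressed_resolvent f z x y -> y = S z x.
  by move=> Dz h; apply: (cres_unique fB (sat _ (disc _ Dz)) h); exact: (hS z Dz).2.
pose x : X := (comb e eta, 0).
(* On the circle [theta < rho] excludes eigenvalues, so the exact resolvent exists and [lf] may be
   evaluated on it. With [b = beta y.1], expanding [|w b - eta|^2 <= theta^2 |b|^2] gives the
   inequality. *)
have key (w : C) : nm w = rho -> sqn eta <= 2 * re (w * lf (S (a%:C + w) x)).
  move=> wr; set z : C := a%:C + w.
  have zw : z - a%:C = w by rewrite /z addrAC subrr add0r.
  have Dz : nm (z - a%:C) <= rho by rewrite zw wr.
  have z0 := disc _ Dz.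
  have tr xi : sqn (transfer z0 xi - a%:C *: xi) <= theta ^+ 2 * sqn xi by exact: hT.
  have inj (y : X) : graph y (z *: y) -> y = 0.
    move=> hy; have hy' : z *: y - z *: y = (comb e 0, 0).
      by rewrite subrr (lin_0 (comb_linear e)).
    have := transfer_graph z0 hy hy'; rewrite subr0 => hb.
    have b0 : beta y.1 = 0.
      apply/eqP/negPn/negP => /sqn_gt0 s0; have := tr (beta y.1).
      rewrite -hb -scalerBl zw sqnZ wr ler_pM2r // => h.
      have : rho <= theta by rewrite -ler_sqr ?nnegrE // ltW.
      by rewrite leNgt th_rho.
    have zn0 : z != 0 by apply: contraTneq (disc _ Dz) => ->; rewrite ltxx.
    have y1 : (z *: y).1 = 0 by rewrite (response_graph z0 hy hy') b0 response0.
    have y2 : y.2 = 0 by have [-> _] := hy; rewrite y1 (lin_0 (@pj_lin R P)).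
    apply: injective_projections => //=.
    by move/eqP: y1; rewrite scaler_eq0 (negbTE zn0) => /eqP.
  have [S' _ hS'] := exact_resolvent z0 inj.
  have gr := hS' x; set y := S' x in gr.
  have hy : z *: y - (z *: y - x) = x by rewrite opprB addrC subrK.
  have tg := transfer_graph z0 gr hy.
  have -> : lf (S z x) = lf y.
    have [b' yb] := resolvent_cres (sat z z0) gr ((hS z Dz).2 x).
    by rewrite -[y](subrK (S z x)) (lin_D lf_lin) yb lf_comb add0r.
  have := tr (beta y.1); rewrite -tg.
  have -> : z *: beta y.1 - eta - a%:C *: beta y.1 = w *: beta y.1 - eta.
    by rewrite addrAC -scalerBl zw.
  rewrite sqnB sqnZ wr -(sesZl (@hdot_ses n)) => h.
  have := sqn_ge0 (beta y.1); have : theta ^+ 2 <= rho ^+ 2 by rewrite ler_sqr ?nnegrE // ltW.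
  move: h; rewrite /lf (sesZl (@hdot_ses n)); nra.
have S_lin (z : C) : D z -> linear (S z).
  move=> Dz b u v; apply/esym/S_uniq => //.
  by apply: cres_lin; exact: (hS z Dz).2.
have S_id (z w : C) u : D z -> D w -> S z u - S w u = (w - z) *: S z (S w u).
  move=> Dz Dw; rewrite -(lin_Z (S_lin _ Dz)); apply: S_uniq => //.
  by apply: cres_identity; [exact: (hS z Dz).2 | exact: (hS w Dw).2].
have [K K0 hK] := lf_bounded; have q0 := sqn_gt0 eta0.
have K1 : 0 < 2 * (K + 1) by rewrite mulr_gt0 // ltr_wpDl.
(* The tolerance is chosen so that the mean [g'] satisfies [2 K |g'| < |eta|^2], whereas averaging
   [key] gives [|eta|^2 <= 2 re (lf g')]. *)
have [] := family_contour S_id (fun z Dz => (hS z Dz).1) x (ltW rho0)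
  (divr_gt0 q0 K1) (fun z hz => hz) (c := a%:C).
move=> N /(_ N (leqnn N)); rewrite ltr_pdivlMr // => hN.
set g' := avg _ _ _ in hN.
have lfg : lf g' = avg N (fun w => w * lf (S (a%:C + w) x) : C^o) rho.
  rewrite /g' -(avg_linear (F := C^o) _ _ _ lf_lin); congr avg.
  by apply: funext => w; rewrite (lin_Z lf_lin).
have h1 : sqn eta <= 2 * re (lf g').
  rewrite lfg /avg.
  have -> : (N.+1%:R^-1 : C) = (N.+1%:R^-1)%:C by rewrite fmorphV rmorph_nat.
  rewrite reZ re_sum mulrCA mulr_sumr mulrC -ler_pdivrMr ?invr_gt0 ?ltr0n // invrK.
  rewrite mulr_natr -[N.+1 in leLHS]card_ord -sumr_const; apply: ler_sum => i _.
  by apply: key; rewrite nmM nm_node mulr1 nmC ger0_norm // ltW.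
have h2 : re (lf g') <= K * nm g' by apply: le_trans (re_le_nm _) (hK _).
have := nm_ge0 g'; nra.
Qed.
End LowerBound.

(** * Riesz projections *)

Section GeneralizedEigenspaces.
Variable R : realType.
Local Notation C := R[i].

(** The generalized eigenspace is the kernel of the [m]-th power, whereas [N] is arbitrary. If [q]
    is the multiplicity of [z] in the characteristic polynomial, the Bezout identity for [(X - z)^N]
    and the cofactor, with Cayley-Hamilton, shows that the power [q <= m] already kills [c]. *)
Lemma sub_geigenspace m (B : 'M[C]_m) z (c : 'rV[C]_m) N :
  c *m (B - z%:M) ^+ N = 0 -> (c <= geigenspace B z)%MS.
Proof.
case: m => [|m] in B c *; first by rewrite [c]thinmx0 sub0mx.
move=> hN; rewrite geigenspaceE; apply/sub_kermxP.
have hornE k : (B - z%:M) ^+ k = horner_mx B (('X - z%:P) ^+ k).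
  by rewrite rmorphXn rmorphB /= horner_mx_X horner_mx_C.
have [q [h hz hq]] := multiplicity_XsubC (char_poly B) z.
rewrite monic_neq0 ?char_poly_monic //= in hz.
have q_le : (q <= m.+1)%N.
  have h0 : h != 0 by apply: contraNneq hz => ->; rewrite root0.
  have := congr1 (fun p : {poly C} => size p) hq.
  rewrite /= size_char_poly size_mul ?expf_neq0 ?polyXsubC_eq0 // size_exp_XsubC addnS /=.
  move=> e; have : (0 < size h)%N by rewrite size_poly_gt0.
  by move=> sh; rewrite -ltnS e -[q in leqLHS]add0n ltn_add2r.
have cop : coprimep (('X - z%:P) ^+ N) h.
  by apply: coprimep_expl; rewrite coprimep_sym coprimep_XsubC.
have [[u v] /= uv] := Bezout_eq1_coprimepP _ _ cop.
have kill (p : {poly C}) : ('X - z%:P) ^+ N %| p \/ char_poly B %| p ->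
    c *m horner_mx B p = 0.
  case=> /dvdpP[r ->].
    by rewrite mulrC rmorphM /= -hornE -[X in _ *m X]/(_ *m _) mulmxA hN mul0mx.
  by rewrite rmorphM /= Cayley_Hamilton mulr0 mulmx0.
have : c *m horner_mx B (('X - z%:P) ^+ q) = 0.
  have -> : ('X - z%:P) ^+ q = ('X - z%:P) ^+ q * u * ('X - z%:P) ^+ N + v * char_poly B.
    by rewrite hq -[LHS]mulr1 -uv; ring.
  by rewrite rmorphD mulmxDr !kill ?addr0 //; [right; exact: dvdp_mull | left; exact: dvdp_mull].
rewrite -hornE => hc.
have -> : (B - z%:M) ^+ m.+1 = (B - z%:M) ^+ q *m (B - z%:M) ^+ (m.+1 - q).
  by rewrite -[RHS]exprD subnKC.
by rewrite mulmxA hc mul0mx.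
Qed.

Lemma geigenspace_kill m (B : 'M[C]_m) z (c : 'rV[C]_m) :
  (c <= geigenspace B z)%MS -> c *m (B - z%:M) ^+ m = 0.
Proof.
case: m => [|m] in B c *; first by rewrite [c]thinmx0 mul0mx.
by rewrite geigenspaceE => /sub_kermxP.
Qed.

Lemma geigenspace_stable m (B : 'M[C]_m) z : (geigenspace B z *m B <= geigenspace B z)%MS.
Proof. exact: comm_mx_stable_geigenspace. Qed.

(** The characteristic polynomial splits and divides the product of [(X - a)^m] over its distinct
    roots [a]; hence the generalized eigenspaces, whose sum is direct, fill the space. *)
Lemma eigenvalues_seq m (B : 'M[C]_m) :
  exists2 s : seq C, uniq s & [/\ forall a, eigenvalue B a <-> a \in s &
    (\sum_(a <- s) \rank (geigenspace B a))%N = m].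
Proof.
case: m => [|m] in B *.
  exists [::] => //; split; last by rewrite big_nil.
  by move=> a; split=> // /eigenvalueP[v _]; rewrite thinmx0 eqxx.
have [t] := closed_field_poly_normal (char_poly B).
rewrite (monicP (char_poly_monic B)) scale1r => ht.
exists (undup t); first exact: undup_uniq.
split=> [a|].
  by rewrite eigenvalue_root_char ht root_prod_XsubC mem_undup.
pose a_ (i : 'I_(size (undup t))) := (undup t)`_i.
have a_inj : {in predT &, injective a_}.
  by move=> i j _ _ /eqP; rewrite nth_uniq ?undup_uniq // => /eqP/val_inj.
have dir := mxdirect_sum_geigenspace B a_inj.
have rk := mxdirectP dir; rewrite /= in rk.
have -> : (\sum_(a <- undup t) \rank (geigenspace B a) =
    \sum_(i < size (undup t)) \rank (geigenspace B (a_ i)))%N.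
  by rewrite (big_nth 0) big_mkord.
rewrite -rk; apply/eqP; rewrite eqn_leq rank_leq_col /= -[X in (X <= _)%N](mxrank1 C).
apply: mxrankS.
have cop : {in predT &, forall i j : 'I_(size (undup t)), j != i ->
    coprimep (('X - (a_ i)%:P) ^+ m.+1) (('X - (a_ j)%:P) ^+ m.+1)}.
  move=> i j _ _ ij; apply: coprimep_expl; apply: coprimep_expr.
  by rewrite coprimep_XsubC root_XsubC; apply: contra ij => /eqP/a_inj ->.
rewrite -(kermxpoly_prod B cop) kermxpoly_min ?submx1 //.
apply: dvdp_trans (mxminpoly_dvd_char B) _.
rewrite ht -prodr_undup_exp_count (big_nth 0) big_mkord.
apply: (big_ind2 (fun p q : {poly C} => p %| q)) => // [p q p' q'|i _]; first exact: dvdp_mul.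
apply: dvdp_exp2l; apply: leq_trans (count_size _ _) _.
have := congr1 (fun p : {poly C} => size p) ht.
by rewrite /= size_char_poly size_prod_XsubC => -[->].
Qed.
End GeneralizedEigenspaces.

Section Continuity.
Variable R : realType.
Local Notation C := R[i].

Lemma pos_complexE (a : C) : 0 < a -> exists2 b : R, 0 < b & a = b%:C.
Proof.
by case: a => a b; rewrite ltcE /= => /andP[/eqP -> a0]; exists a.
Qed.

Lemma continuous_bounded_map (E F : normedModType C) (f : E -> F) :
  linear f -> continuous f -> bounded_map f.
Proof.
move=> hf cf; pose f' : {linear E -> F} := HB.pack f (GRing.isLinear.Build _ _ _ _ f hf).
have /linear_boundedP : bounded_near f' (nbhs 0).
  by apply: continuous_linear_bounded; exact: cf.
move=> /pinfty_ex_gt0 [K /pos_complexE[k k0 ->] hK].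
exists k; first exact: ltW.
by move=> x; rewrite -lecR rmorphM /= -!nmE; exact: hK.
Qed.

Lemma bounded_map_continuous (E F : normedModType C) (f : E -> F) :
  linear f -> bounded_map f -> continuous f.
Proof.
move=> hf [K K0 hK] x; apply/cvgrPdist_lt => _ /pos_complexE[a a0 ->].
have K1 : 0 < K + 1 by rewrite ltr_wpDl.
apply/nbhs_ballP; exists (a / (K + 1))%:C; first by rewrite /= ltcR divr_gt0.
move=> y; rewrite -ball_normE /ball_ /= !nmE !ltcR => hy.
rewrite -(lin_B hf); apply: le_lt_trans (hK _) _.
apply: le_lt_trans (_ : (K + 1) * nm (x - y) < _).
  by rewrite ler_wpM2r ?nm_ge0 // lerDl.
by rewrite mulrC -ltr_pdivlMr.
Qed.
End Continuity.

Section RieszProjection.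
Variables (R : realType) (P : damped_pencil R).
Local Notation C := R[i].
Local Notation re := (@complex.Re R).
Local Notation V := (pV P).
Local Notation H := (pH P).
Local Notation X := (V * H)%type.
Variable A : operator X.
Hypothesis dom_graph : forall x, op_dom A x -> graph x (op_fun A x).
Hypothesis graph_dom : forall x y, graph x y -> op_dom A x /\ op_fun A x = y.

Lemma resolvent_graph z S : is_resolvent A z S -> forall x, graph (S x) (z *: S x - x).
Proof.
move=> [_ _ h _] x; have [dx e] := h x.
have -> : z *: S x - x = op_fun A (S x) by rewrite -{2}e opprB addrC subrK.
exact: dom_graph.
Qed.

Lemma resolvent_cancel z S x y : is_resolvent A z S -> graph x y -> S (z *: x - y) = x.
Proof. by move=> [_ _ _ h] /graph_dom[dx <-]; exact: h. Qed.

Lemma graph_kernel (z : C) (p q x : X) : (forall y : X, graph y (z *: y) -> y = 0) ->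
  graph p (z *: p - x) -> graph q (z *: q - x) -> p = q.
Proof.
move=> inj hp hq; apply/eqP; rewrite -subr_eq0; apply/eqP/inj.
have := graphB hp hq; congr graph.
by rewrite opprB addrA subrK scalerBr.
Qed.

Lemma bounded_is_resolvent z S : bounded_map S ->
  (forall x, graph (S x) (z *: S x - x)) ->
  (forall x : X, graph x (z *: x) -> x = 0) -> is_resolvent A z S.
Proof.
move=> Sb hS inj; have S_lin : linear S.
  move=> a x y; apply: (graph_kernel inj (hS _)).
  have := graph_lin a (hS x) (hS y); congr graph.
  rewrite scalerBr scalerDr addrACA -opprD; congr (_ + _ - _).
  by rewrite !scalerA mulrC.
split=> //; first exact: bounded_map_continuous.
  move=> x; have [dx ->] := graph_dom (hS x); split=> //.
  by rewrite opprB addrC subrK.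
move=> x dx; apply: (graph_kernel inj (hS _)).
by rewrite opprB addrC subrK; exact: dom_graph.
Qed.

Lemma resolventP z : resolvent_set A z -> is_resolvent A z (resolvent A z).
Proof. by move=> h; apply: (@getPex _ [set S | is_resolvent A z S]). Qed.

Lemma resolvent_bounded z S : is_resolvent A z S -> bounded_map S.
Proof. by move=> [h1 h2 _ _]; exact: continuous_bounded_map. Qed.

Lemma resolvent_identity z w x : resolvent_set A z -> resolvent_set A w ->
  resolvent A z x - resolvent A w x = (w - z) *: resolvent A z (resolvent A w x).
Proof.
move=> /resolventP hz /resolventP hw; have [lin _ _ _] := hz.
rewrite -(lin_Z lin).
rewrite -[LHS](resolvent_cancel hz (graphB (resolvent_graph hz x) (resolvent_graph hw x))).
have rearr (E : zmodType) (a b c t : E) : a - b - ((a - t) - (c - t)) = c - b.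
  by rewrite !opprB [c - t + _]addrA (subrK t c) [LHS]addrC addrA subrK.
by rewrite scalerBr rearr scalerBl.
Qed.

Section Compress.
Variables (m : nat) (f : 'I_m -> X) (B : 'M[C]_m).
Hypothesis fB : unstable_family f B.

(** The energy-orthogonal projection along the span of [f], from [bordering] with the identity as
    unperturbed solution; definiteness of the energy on the span makes the system injective. *)
Lemma energy_projection : exists2 c : X -> 'rV[C]_m,
  forall x i, energy (x - comb f (c x)) (f i) = 0 &
  bounded_map (fun x => x - comb f (c x)).
Proof.
pose con (y : X) : 'rV[C]_m := \row_i energy y (f i).
have con_lin : linear con.
  by move=> a u v; apply/rowP => i; rewrite !mxE (@energy_ses R P).1.
pose Y1 (q : 'rV[C]_m) : X := - comb f q.
have Y1_lin : linear Y1.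
  by move=> a u v; rewrite /Y1 (comb_linear f) opprD scalerN.
have con_bounded i : bounded_map (fun x => con x 0 i).
  have [K K0 hK] := bounded_form_map (f i) (@energy_bounded R P).
  by exists K => // x; rewrite mxE; exact: hK.
have T1_lin : linear (con \o Y1) by move=> a u v; rewrite /= Y1_lin con_lin.
have T1_inj q : (con \o Y1) q = 0 -> q = 0.
  move=> /= hq; apply: (unstable_orth fB) => i; have /rowP/(_ i) := hq.
  by rewrite !mxE (sesNl (@energy_ses R P)) => /eqP; rewrite oppr_eq0 => /eqP.
have [c hc hb] := bordering (bounded_map_id X) Y1_lin con_bounded T1_lin T1_inj.
exists c => [x i|]; last exact: hb.
have := hc x; rewrite /= -(lin_D con_lin) => /rowP/(_ i).
by rewrite !mxE.
Qed.

(** The span is invariant, so subtracting the component in it preserves the equation modulo the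
    span. Unlike [cres_exists], this covers points with [re z <= 0], which the disc of
    [separating_radius] may contain. *)
Lemma cres_of_resolvent (z : C) (S : X -> X) : bounded_map S ->
  (forall x, graph (S x) (z *: S x - x)) ->
  exists2 S' : X -> X, bounded_map S' & forall x, compressed_resolvent f z x (S' x).
Proof.
move=> Sb hS; have [c hc cb] := energy_projection.
exists (fun x => S x - comb f (c (S x))); first exact: bounded_map_comp cb Sb.
move=> x; split=> [i|]; first exact: hc.
exists (z *: c (S x) - c (S x) *m B).
have := graphB (hS x) (unstable_graph (c (S x)) fB); congr graph.
rewrite (lin_B (comb_linear f)) (lin_Z (comb_linear f)) scalerBr.
have rearr (E : zmodType) (p q r t : E) : p - t - q = p - r - t + (r - q).
  by rewrite [p - r - t]addrAC addrA subrK.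
exact: rearr.
Qed.

Lemma cres_span (z : C) c (y : X) : saturated_at f z -> compressed_resolvent f z (comb f c) y -> y = 0.
Proof.
move=> sat h; apply: (cres_unique fB sat h); split=> [i|].
  by rewrite (ses0l (@energy_ses R P)).
by exists c; rewrite scaler0 sub0r addNr; exact: graph0.
Qed.

Lemma cres_kernel (z : C) (x : X) : compressed_resolvent f z x 0 -> exists c, x = comb f c.
Proof.
move=> [_ [c hc]]; exists c; have := graph_fun hc (@graph0 R P).
by rewrite scaler0 sub0r => /eqP; rewrite addrC subr_eq0 => /eqP ->.
Qed.
End Compress.

Section Maximal.
Variables (m : nat) (f : 'I_m -> X) (B : 'M[C]_m).
Hypothesis fB : unstable_family f B.
Hypothesis f_sat : forall z, 0 < re z -> saturated_at f z.

Let indep : lin_indep f. Proof. by case: fB. Qed.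

Lemma eigenvector_graph z v : v *m B = z *: v -> graph (comb f v) (z *: comb f v).
Proof. by move=> hv; have := unstable_graph v fB; rewrite hv (lin_Z (comb_linear f)). Qed.

Lemma eigenvalue_spectrum z : eigenvalue B z -> spectrum A z /\ op_eigenvalue A z.
Proof.
move=> /eigenvalueP[v hv v0]; have hg := eigenvector_graph hv.
have x0 : comb f v != 0.
  by apply: contra_neq v0; exact: ((lin_indepP f).1 indep).
split; last by exists (comb f v); have [h1 h2] := graph_dom hg.
move=> [S hS]; have := resolvent_cancel hS hg; have [S_lin _ _ _] := hS.
by rewrite subrr (lin_0 S_lin) => h; rewrite -h eqxx in x0.
Qed.

(** By saturation an eigenvector of [A] at [z] lies in the span of [f], hence comes from one of [B];
    without it [exact_resolvent] provides the resolvent. *)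
Lemma spectrum_eigenvalue z : 0 < re z -> spectrum A z -> eigenvalue B z.
Proof.
move=> z0 sp; apply: contrapT => nz; apply: sp.
have inj (x : X) : graph x (z *: x) -> x = 0.
  move=> hx; have [c xc] : exists c, x = comb f c.
    by apply: (f_sat z0 (c := 0) hx); rewrite subrr (lin_0 (comb_linear f)).
  rewrite xc in hx *; have [->|c0] := eqVneq c 0; first by rewrite (lin_0 (comb_linear f)).
  case: nz; apply/eigenvalueP; exists c => //; apply: (comb_inj indep).
  by rewrite (lin_Z (comb_linear f)); apply: (graph_fun (unstable_graph c fB)).
have [S Sb hS] := exact_resolvent z0 inj.
by exists S; exact: bounded_is_resolvent.
Qed.

Section Eigenvalue.
Variable z : C.
Hypothesis z_eigen : eigenvalue B z.

Let z0 : 0 < re z. Proof. by case: fB => _ _; apply. Qed.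

Lemma spectral_gap : exists2 delta : R, 0 < delta &
  forall w, 0 < nm (w - z) < delta -> resolvent_set A w.
Proof.
have [s _ [hs _]] := eigenvalues_seq B.
have [delta d0 hd] : exists2 delta : R, 0 < delta &
    forall w, w \in s -> w != z -> delta <= nm (w - z).
  elim: s {hs} => [|w s [delta d0 IH]]; first by exists 1.
  have [->|wz] := eqVneq w z.
    by exists delta => // w'; rewrite inE => /orP[/eqP ->|]; [rewrite eqxx | exact: IH].
  have p0 : 0 < nm (w - z) by rewrite nm_gt0 subr_eq0.
  exists (Num.min delta (nm (w - z))); first by rewrite lt_min d0.
  move=> w'; rewrite inE => /orP[/eqP -> _|w's w'z]; rewrite ge_min ?lexx ?orbT //.
  by rewrite IH.
(* Within distance [re z] of [z] one stays in the half-plane, where the spectrum consists of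
   eigenvalues of [B]. *)
exists (Num.min delta (re z)); first by rewrite lt_min d0.
move=> w /andP[]; rewrite nm_gt0 subr_eq0 lt_min => wz /andP[w1 w2].
apply: contrapT => sp; have w0 : 0 < re w.
  have := abs_re_le_nm (w - z); rewrite reB => h.
  by have := ler_norm (- (re w - re z)); rewrite normrN; lra.
have /hs ws := spectrum_eigenvalue w0 sp.
by have := hd _ ws wz; lra.
Qed.

Lemma spectrum_isolated : isolated_eigenvalue A z.
Proof.
have [sp eig] := eigenvalue_spectrum z_eigen; split=> //.
have [delta d0 hd] := spectral_gap; split; first exact/mem_set.
exists (ball (z : C^o) delta%:C); first by apply: nbhsx_ballx; rewrite ltcR.
apply/seteqP; split=> [w [hw sw]|_ ->]; last first.
  by split=> //; apply: ballxx; rewrite ltcR.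
apply: contrapT => wz; apply: sw; apply: hd; rewrite nm_gt0 subr_eq0.
move: hw; rewrite -ball_normE /ball_ /= nmE ltcR nmB => ->; rewrite andbT.
by apply/eqP.
Qed.

Local Notation r := (separating_radius A z).

Lemma separating_radiusP : 0 < r /\ forall w, 0 < nm (w - z) <= r -> resolvent_set A w.
Proof.
have [delta d0 hd] := spectral_gap.
have [r0 hr] : 0 < r /\ forall w, 0 < `|w - z| <= r%:C -> resolvent_set A w.
  apply: (@getPex _ [set r | 0 < r /\ forall w, 0 < `|w - z| <= r%:C -> resolvent_set A w]).
  exists (delta / 2) => /=; split=> [|w]; first by rewrite divr_gt0.
  rewrite nmE ltcR lecR => /andP[h1 h2]; apply: hd; rewrite h1 /=.
  by apply: le_lt_trans h2 _; lra.
by split=> // w h; apply: hr; rewrite nmE ltcR lecR.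
Qed.

Let r0 : 0 < r. Proof. by have [] := separating_radiusP. Qed.
Let on_circle w : nm w = r -> resolvent_set A (z + w).
Proof.
by move=> h; have [_] := separating_radiusP; apply; rewrite addrC addKr h r0 lexx.
Qed.

Lemma riesz_lim x : seq_lim (fun k => avg k (fun w => w *: resolvent A (z + w) x) r)
  (riesz_projection A z x).
Proof.
pose D w := nm (w - z) = r.
have res w : D w -> resolvent_set A w.
  by move=> h; rewrite -[w](subrK z) addrC; exact: on_circle.
have S_id u w y : D u -> D w -> resolvent A u y - resolvent A w y =
    (w - u) *: resolvent A u (resolvent A w y).
  by move=> /res hu /res hw; exact: resolvent_identity.
have S_b u : D u -> bounded_map (resolvent A u).
  by move=> /res/resolventP; exact: resolvent_bounded.
(* The circle is the degenerate annulus with both radii [r]. *)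
have [|K K0 hK] := family_bound S_id S_b (c := z) (s0 := r) (s1 := r).
  by move=> w; rewrite -eq_le => /eqP.
have DE w : nm w = r -> D (z + w) by rewrite /D addrAC subrr add0r.
have hK' w : nm w = r -> forall y, nm (resolvent A (z + w) y) <= K * nm y.
  by move=> /DE h; apply: hK; rewrite h lexx.
apply: (circle_integral_avg (L := K ^+ 2 * nm x) (B := K * nm x)) => //.
- exact: seq_complete_prod (@nm_complete R V) (@nm_complete R H).
- by rewrite mulr_ge0 ?exprn_ge0 ?nm_ge0.
- by rewrite mulr_ge0 ?nm_ge0.
- move=> v w hv hw.
  have := family_lipschitz S_id x (DE _ hv) (DE _ hw) (hK' _ hv) (hK' _ hw) K0.
  by have -> : z + v - (z + w) = v - w by rewrite opprD addrACA subrr add0r.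
- by move=> v hv; exact: hK'.
Qed.

Local Notation Z := (geigenspace B z).
Local Notation p := (\rank Z).
Local Notation F := (row_base Z).

(** A basis of the root space of [A] at [z]; dividing out this space alone, not the whole span of
    [f], locates the range of the Riesz projection. *)
Definition root_vectors (i : 'I_p) : X := comb f (row i F).
Definition root_matrix : 'M[C]_p := F *m B *m pinvmx F.

Lemma comb_root c : comb root_vectors c = comb f (c *m F).
Proof. by rewrite comb_mul. Qed.

Lemma root_matrixE : root_matrix *m F = F *m B.
Proof.
rewrite mulmxKpV // eq_row_base.
by apply: submx_trans (geigenspace_stable B z); rewrite submxMr ?eq_row_base.
Qed.

Lemma root_kill (c : 'rV[C]_p) : c *m F *m (B - z%:M) ^+ m = 0.
Proof.
by apply: geigenspace_kill; apply: submx_trans (submxMl _ _) _; rewrite eq_row_base.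
Qed.

Lemma root_eigenvalue a : eigenvalue root_matrix a -> a = z.
Proof.
move=> /eigenvalueP[v hv v0]; apply/eqP; rewrite -subr_eq0; apply/negPn/negP => az.
have hF : v *m F *m (B - z%:M) = (a - z) *: (v *m F).
  by rewrite mulmxBr -mulmxA -root_matrixE mulmxA hv mul_mx_scalar -scalemxAl scalerBl.
have pow k : v *m F *m (B - z%:M) ^+ k = (a - z) ^+ k *: (v *m F).
  elim: k => [|k IH]; first by rewrite !expr0 scale1r mulmx1.
  rewrite exprS -[_ * _]/(_ *m _) mulmxA hF -scalemxAl IH scalerA -exprS //.
have := root_kill v; rewrite pow => /eqP; rewrite scaler_eq0 expf_eq0 (negbTE az) andbF /=.
by rewrite mulmx_free_eq0 ?row_base_free // (negbTE v0).
Qed.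

Lemma root_unstable : unstable_family root_vectors root_matrix.
Proof.
split=> [|i|a /root_eigenvalue -> //].
  apply/lin_indepP => c; rewrite comb_root => /((lin_indepP f).1 indep)/eqP.
  by rewrite mulmx_free_eq0 ?row_base_free // => /eqP.
rewrite comb_root -row_mul root_matrixE row_mul.
exact: unstable_graph.
Qed.

(** At [w = z], saturation of [f] puts [x] in the span of [f], and [B - z] maps its coefficients
    into the root space, to which they then belong. At [w <> z] the equation has a solution within
    the root space, because [root_matrix] has only the eigenvalue [z], and [w] being in the
    resolvent set makes it unique. *)
Lemma root_saturated w : nm (w - z) <= r -> saturated_at root_vectors w.
Proof.
move=> hw x y c xy; rewrite comb_root => hc; have [wz|wz] := eqVneq w z.
  rewrite wz in hc; have [c' xc] := f_sat z0 xy hc.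
  have yc : y = comb f (c' *m B) by rewrite xc in xy; exact: graph_fun xy (unstable_graph _ fB).
  have e : c' *m (B - z%:M) = - (c *m F).
    apply: (comb_inj indep); rewrite (lin_N (comb_linear f)) -hc xc yc mulmxBr.
    by rewrite (lin_B (comb_linear f)) mul_mx_scalar (lin_Z (comb_linear f)) opprB.
  have : (c' <= Z)%MS.
    (* One factor [B - z] leads into the root space and [m] more kill it, whence the exponent
       [m.+1]. *)
    apply: (@sub_geigenspace _ _ _ _ _ m.+1); rewrite exprS -[_ * _]/(_ *m _).
    by rewrite mulmxA e mulNmx root_kill oppr0.
  rewrite -(eq_row_base Z) => /submxP[c'' hc'']; exists c''.
  by rewrite comb_root -hc''.
have res : resolvent_set A w.
  by have [_] := separating_radiusP; apply; rewrite hw andbT nm_gt0 subr_eq0.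
have unit : w%:M - root_matrix \in unitmx.
  rewrite -row_free_unit -kermx_eq0; apply/rowV0P => v /sub_kermxP hv.
  apply/eqP/negPn/negP => v0; case/eqP: wz; apply: root_eigenvalue.
  apply/eigenvalueP; exists v => //; move/eqP: hv.
  by rewrite mulmxBr mul_mx_scalar subr_eq0 => /eqP.
pose c' := c *m invmx (w%:M - root_matrix); exists c'.
have hS := resolventP res.
rewrite -(resolvent_cancel hS xy) hc -comb_root.
rewrite -(resolvent_cancel hS (unstable_graph c' root_unstable)).
congr (resolvent A w _); rewrite -(lin_Z (comb_linear _)) -(lin_B (comb_linear _)).
by rewrite -mul_mx_scalar -mulmxBr mulmxKV.
Qed.

(** Let [S] be the resolvent compressed by the root space. [S z] kills the root vectors, modulo
    which the resolvent equals [S] on the circle; so [S z] takes the same value on the means of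
    both. Those of [S] tend to zero by [family_contour], hence [S z] kills the projection of [x],
    and the kernel of [S z] is the root space. *)
Lemma riesz_root x : exists c, riesz_projection A z x = comb root_vectors c.
Proof.
pose D (w : C) : Prop := nm (w - z) <= r.
have /choice[S hS] : forall w : C, exists S : X -> X, D w ->
    bounded_map S /\ forall u, compressed_resolvent root_vectors w u (S u).
  move=> w; have [Dw|nDw] := boolP (nm (w - z) <= r); last by exists id => /(negP nDw).
  suff [S Sb h] : exists2 S : X -> X, bounded_map S &
      forall u, compressed_resolvent root_vectors w u (S u) by exists S.
  have [wz|wz] := eqVneq w z.
    rewrite wz in Dw *; apply: (cres_exists root_unstable z0); exact: root_saturated.
  have res : resolvent_set A w.
    by have [_] := separating_radiusP; apply; rewrite Dw andbT nm_gt0 subr_eq0.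
  have hres := resolventP res.
  exact: (cres_of_resolvent root_unstable (resolvent_bounded hres) (resolvent_graph hres)).
have S_uniq (w : C) u y : D w -> compressed_resolvent root_vectors w u y -> y = S w u.
  by move=> Dw h; apply: (cres_unique root_unstable (root_saturated Dw) h); exact: (hS w Dw).2.
have S_id (v w : C) u : D v -> D w -> S v u - S w u = (w - v) *: S v (S w u).
  move=> Dv Dw.
  have S_lin : linear (S v).
    move=> b y y'; apply/esym/S_uniq => //.
    by apply: cres_lin; exact: (hS v Dv).2.
  rewrite -(lin_Z S_lin); apply: S_uniq => //.
  by apply: cres_identity; [exact: (hS v Dv).2 | exact: (hS w Dw).2].
have Dz : D z by rewrite /D subrr nm0 ltW.
have satz := root_saturated Dz.
have T_lin : linear (S z).
  by move=> b y y'; apply/esym/S_uniq => //; apply: cres_lin; exact: (hS z Dz).2.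
have [[K K0 hK] hT] := hS z Dz.
have T_span c : S z (comb root_vectors c) = 0.
  by apply: (cres_span root_unstable satz); exact: hT.
apply: (cres_kernel (z := z)); suff <- : S z (riesz_projection A z x) = 0 by exact: hT.
apply/eqP; rewrite -nm_eq0; apply/eqP/le_anti; rewrite nm_ge0 andbT.
apply/ler_addgt0Pr => eps eps0; rewrite add0r.
have K1 : 0 < 2 * (K + 1) by rewrite mulr_gt0 // ltr_wpDl.
have e1 := divr_gt0 eps0 K1.
have [N1 hN1] := riesz_lim x e1.
have [N2 hN2] := family_contour S_id (fun w Dw => (hS w Dw).1) x (ltW r0) e1
  (fun w hw => hw) (c := z).
pose N := maxn N1 N2.
have h1 := hN1 N (leq_maxl _ _); have h2 := hN2 N (leq_maxr _ _).
set u := avg N (fun w => w *: resolvent A (z + w) x) r in h1.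
set v := avg N _ r in h2.
have uv : S z u = S z v.
  rewrite /u /v -!(avg_linear _ _ _ T_lin); apply: eq_avg; first exact: ltW.
  move=> w wr; have Dw : D (z + w) by rewrite /D addrAC subrr add0r wr.
  rewrite !(lin_Z T_lin); congr (_ *: _).
  have [c hc] := resolvent_cres (root_saturated Dw)
    (resolvent_graph (resolventP (on_circle wr)) x) ((hS _ Dw).2 x).
  by rewrite -[resolvent _ _ _](subrK (S (z + w) x)) (lin_D T_lin) hc T_span add0r.
rewrite -[riesz_projection A z x](subrK u) (lin_D T_lin) uv.
apply: le_trans (nm_triangle _ _) _.
have h3 := hK (riesz_projection A z x - u); have h4 := hK v.
rewrite nmB in h1.
have : K * nm (riesz_projection A z x - u) <= K * (eps / (2 * (K + 1))).
  by apply: ler_wpM2l => //; exact: ltW.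
have : K * nm v <= K * (eps / (2 * (K + 1))) by apply: ler_wpM2l => //; exact: ltW.
have : K * (eps / (2 * (K + 1))) <= eps / 2.
  rewrite mulrA ler_pdivrMr //.
  have -> : eps / 2 * (2 * (K + 1)) = (K + 1) * eps by field.
  by rewrite ler_wpM2r ?lerDl // ltW.
lra.
Qed.

(** For [y' = (A - z) y] one has [w R(z + w) y = y + w^-1 (w R(z + w) y')]. On root vectors this
    iterates to a finite sum in powers of [w^-1], and over sufficiently many roots of unity the
    means of the negative powers vanish exactly. *)
Lemma riesz_fix c : riesz_projection A z (comb root_vectors c) = comb root_vectors c.
Proof.
have const (y : X) q k : (q <= k)%N ->
    avg k (fun w => w^-1 ^+ q *: y) r = (q == 0)%:R *: y.
  move=> qk; rewrite /avg -scaler_suml scalerA; congr (_ *: _).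
  under eq_bigr do rewrite invfM exprMn.
  rewrite -mulr_sumr; case: q qk => [|q] qk; last by rewrite sum_node_powV // !mulr0.
  under eq_bigr do rewrite expr0.
  by rewrite expr0 mul1r sumr_const card_ord mulVf // pnatr_eq0.
(* Induction on the order [s] of nilpotency; [s + q <= k] keeps all exponents that occur at most
   [k], as required by [sum_node_powV]. *)
have key s : forall c q k, c *m (B - z%:M) ^+ s = 0 -> (s + q <= k)%N ->
    avg k (fun w => w^-1 ^+ q *: (w *: resolvent A (z + w) (comb f c))) r =
    (q == 0)%:R *: comb f c.
  elim: s => [|s IH] c' q k hc qk.
    have -> : c' = 0 by rewrite expr0 mulmx1 in hc.
    rewrite (lin_0 (comb_linear f)) scaler0.
    transitivity (avg k (fun w : C => w^-1 ^+ 0 *: (0 : X)) r); last first.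
      by rewrite const // scaler0.
    apply: eq_avg; first exact: ltW.
    move=> w /on_circle/resolventP[S_lin _ _ _].
    by rewrite (lin_0 S_lin) !scaler0.
  set y := comb f c'; set y' := comb f (c' *m (B - z%:M)).
  have -> : avg k (fun w => w^-1 ^+ q *: (w *: resolvent A (z + w) y)) r =
      avg k (fun w => w^-1 ^+ q *: y +
        w^-1 ^+ q.+1 *: (w *: resolvent A (z + w) y')) r.
    apply: eq_avg; first exact: ltW.
    move=> w wr; have w0 : w != 0 by rewrite -nm_eq0 wr gt_eqF.
    have hS := resolventP (on_circle wr); have [S_lin _ _ _] := hS.
    have := resolvent_cancel hS (unstable_graph c' fB); rewrite -/y.
    have -> : (z + w) *: y - comb f (c' *m B) = w *: y - y'.
      rewrite /y' mulmxBr mul_mx_scalar (lin_B (comb_linear f)) (lin_Z (comb_linear f)).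
      by rewrite opprB scalerDl addrAC addrC.
    rewrite (lin_B S_lin) (lin_Z S_lin) => /eqP; rewrite subr_eq => /eqP ->.
    by rewrite scalerDr exprSr -!scalerA [w^-1 *: (w *: _)]scalerA mulVf // scale1r.
  rewrite avgD const; last by apply: leq_trans qk; rewrite leq_addl.
  rewrite IH ?scale0r ?addr0 //; last by rewrite addnS -addSn.
  by move: hc; rewrite exprS -[_ * _]/(_ *m _) mulmxA.
rewrite comb_root; have lim := riesz_lim (comb f (c *m F)).
apply: (seq_lim_unique lim) => eps eps0; exists m => k mk.
have -> : avg k (fun w => w *: resolvent A (z + w) (comb f (c *m F))) r = comb f (c *m F).
  have := key m (c *m F) 0%N k (root_kill c); rewrite addn0 => /(_ mk).
  rewrite eqxx scale1r => h; rewrite -[RHS]h; apply: eq_avg; first exact: ltW.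
  by move=> w _; rewrite expr0 scale1r.
by rewrite subrr nm0.
Qed.

Theorem range_riesz : range (riesz_projection A z) = range (comb root_vectors).
Proof.
apply/seteqP; split=> _ [x _ <-].
  by have [c ->] := riesz_root x; exists c.
by exists (comb root_vectors x) => //; exact: riesz_fix.
Qed.

Theorem alg_multE : alg_mult A z = p%:R%:E.
Proof.
by rewrite /alg_mult range_riesz dimension_span //; case: root_unstable.
Qed.
End Eigenvalue.
End Maximal.

Theorem unstable_spectrum : let S := spectrum A `&` @open_right_half_plane R in
  [/\ finite_set S,
      forall z, S z -> isolated_eigenvalue A z /\ (alg_mult A z < +oo)%E &
      N_plus A = (pn P)%:R%:E].
Proof.
move=> S; have [m [f [B [fB f_sat]]]] := @maximal_unstable R P.
have mn : m = pn P.
  by apply/eqP; rewrite eqn_leq (unstable_dim fB) (unstable_dim_ge fB f_sat).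
have [s s_uniq [sE s_sum]] := eigenvalues_seq B.
have SE : S = [set` s].
  apply/seteqP; split=> z /=.
    by move=> [sp z0]; apply/sE; exact: (spectrum_eigenvalue fB f_sat).
  move=> /sE zB; split; last by case: fB => _ _; apply.
  by have [] := eigenvalue_spectrum fB zB.
have mult z : S z -> alg_mult A z = (\rank (geigenspace B z))%:R%:E.
  by rewrite SE /= => /sE; exact: (alg_multE fB f_sat).
split; first by rewrite SE; exact: finite_seq.
  move=> z Sz; split; last by rewrite (mult z Sz) ltry.
  move: Sz; rewrite SE /= => /sE; exact: (spectrum_isolated fB f_sat).
rewrite /N_plus -/S -mn -s_sum.
rewrite esum_fset; last first.
- by move=> z /set_mem Sz; rewrite (mult z Sz) lee_fin.
- by rewrite SE; exact: finite_seq.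
transitivity (\sum_(z \in S) ((\rank (geigenspace B z))%:R : R)%:E)%E.
  by apply: eq_fsbigr => z /set_mem; exact: mult.
by rewrite SE -fsbig_seq // sumEFin natr_sum.
Qed.
End RieszProjection.

(** * From the structures of the statement to plain forms and the weak graph *)

Section Interface.
Variable R : realType.
Local Notation C := R[i].

Lemma sesquilinearP (E : lmodType C) (q : {bilinear E -> E -> C | *%R & Num.conj \; *%R}) :
  sesquilinear_form q.
Proof. by split=> [a x y z|z a x y]; [rewrite linearPl | rewrite linearPr]. Qed.

Lemma dot_sesquilinear (E : lmodType C) (q : {dot E for Num.conj}) : sesquilinear_form q.
Proof. by split=> [a x y z|z a x y]; [rewrite linearPl | rewrite linearPr]. Qed.

Lemma dot_herm (E : lmodType C) (q : {dot E for Num.conj}) u v : q u v = Num.conj (q v u).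
Proof. by rewrite hermC /= expr0 mul1r. Qed.

Lemma dot_norm (E : normedModType C) (q : {dot E for Num.conj}) :
  (forall u, `|u| ^+ 2 = q u u) -> forall u, q u u = (nm u ^+ 2)%:C.
Proof. by move=> h u; rewrite -h nmE -rmorphXn. Qed.

Lemma bounded_form_norm (E : normedModType C) (q : E -> E -> C) (K : R) :
  (forall u v, `|q u v| <= K%:C * `|u| * `|v|) -> bounded_form q.
Proof.
move=> h; exists `|K| => // u v; have := h u v.
rewrite !nmE -!rmorphM lecR /= => h'; apply: le_trans h' _.
by rewrite !ler_wpM2r ?nm_ge0 ?ler_norm.
Qed.

Lemma coercive_re (E : normedModType C) (q : E -> E -> C) (K : R) :
  (forall u, K%:C * `|u| ^+ 2 <= q u u) -> forall u, K * nm u ^+ 2 <= complex.Re (q u u).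
Proof.
by move=> h u; have := h u; rewrite nmE -rmorphXn -rmorphM lecE => /andP[_].
Qed.

(** For [h <> 0] density gives [w] with [|h - j w| < |h|], whereas
    [|h|^2 = (h, h - j w) <= |h| |h - j w|]. *)
Lemma dense_total (E F : normedModType C) (ip : {dot F for Num.conj}) (j : E -> F) :
  (forall h, `|h| ^+ 2 = ip h h) -> dense (range j) ->
  forall h, (forall w, ip h (j w) = 0) -> h = 0.
Proof.
move=> ipN dj h h0; apply: contrapT => /eqP h1; have n0 : 0 < nm h by rewrite nm_gt0.
have [||y [hb [w _ wy]]] := dj (ball h (nm h)%:C).
- by exists h; apply: ballxx; rewrite ltcR.
- exact: ball_open.
move: hb; rewrite -wy -ball_normE /ball_ /= nmE ltcR => hw.
have := cauchy_schwarz (dot_sesquilinear ip) (dot_herm ip) (dot_norm ipN) h (h - j w).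
rewrite (sesBr (dot_sesquilinear ip)) h0 subr0 (dot_norm ipN) nmC ger0_norm ?sqr_ge0 //.
by rewrite expr2 ler_pM2l // leNgt hw.
Qed.
End Interface.

Section Generator.
Variables (R : realType) (V H : normedModType R[i]).
Variables (ipH : {dot H for Num.conj}) (j : {linear V -> H}).
Variables d k g : {bilinear V -> V -> R[i] | *%R & Num.conj \; *%R}.
Hypothesis j_inj : injective j.
Hypothesis j_total : forall h, (forall w, ipH h (j w) = 0) -> h = 0.

Local Notation A := (generator ipH j d k g).
Local Notation weak x y :=
  (x.2 = j y.1 /\ forall w, ipH y.2 (j w) + k x.1 w + d y.1 w + g y.1 w = 0).

Lemma inverse_on_rangeK (T : pointedType) (U : Type) (f : T -> U) :
  injective f -> cancel f (inverse_on_range f).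
Proof. by move=> f_inj x; apply: f_inj; apply: (@getPex _ [set y | f y = f x]); exists x. Qed.

(** Totality of the range of [j] makes the inverse chosen in [generator] unambiguous. *)
Lemma antidual_embedding_inj : injective (antidual_embedding ipH j).
Proof.
move=> h h' e; apply/eqP; rewrite -subr_eq0; apply/eqP/j_total => w.
rewrite linearBl; apply/eqP; rewrite subr_eq0; apply/eqP.
exact: (congr1 (fun l => l w) e).
Qed.

Lemma generator_weak (x : V * H) : op_dom A x -> weak x (op_fun A x).
Proof.
move=> /= [v jv [h _ hv]]; rewrite -jv inverse_on_rangeK //; split=> // w.
rewrite -hv inverse_on_rangeK; last exact: antidual_embedding_inj.
rewrite linearNl /=; have /(congr1 (fun l => l w)) := hv.
rewrite /antidual_embedding /stiffness_damping => ->.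
by rewrite -!addrA addNr.
Qed.

Lemma weak_generator (x y : V * H) : weak x y -> op_dom A x /\ op_fun A x = y.
Proof.
move=> [h1 h2]; have hy : antidual_embedding ipH j (- y.2) = stiffness_damping d k g x.1 y.1.
  apply/funext => w; apply/eqP; rewrite /antidual_embedding /stiffness_damping linearNl /=.
  by rewrite eq_sym -addr_eq0 addrC !addrA h2.
split=> /=; first by exists y.1 => //; exists (- y.2).
rewrite h1 inverse_on_rangeK // -hy inverse_on_rangeK; last exact: antidual_embedding_inj.
by rewrite opprK -surjective_pairing.
Qed.
End Generator.

Theorem theorem2p2 (R : realType) (V H : completeNormedModType R[i])
    (ipV : {dot V for Num.conj}) (ipH : {dot H for Num.conj})
    (normV : forall u : V, `|u| ^+ 2 = ipV u u)
    (normH : forall h : H, `|h| ^+ 2 = ipH h h)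
    (j : {linear V -> H})
    (j_inj : injective j) (j_cont : continuous j) (j_dense : dense (range j))
    (d k g : {bilinear V -> V -> R[i] | *%R & Num.conj \; *%R}) (d0 Cd Ck Cg : R)
    (d_bound : forall u v : V, `|d u v| <= Cd%:C * `|u| * `|v|)
    (d_herm : forall u v : V, d u v = Num.conj (d v u))
    (d0_gt0 : 0 < d0)
    (d_coercive : forall u : V, d0%:C * `|u| ^+ 2 <= d u u)
    (k_herm : forall u v : V, k u v = Num.conj (k v u))
    (k_bound : forall u v : V, `|k u v| <= Ck%:C * `|u| * `|v|)
    (g_skew : forall u v : V, g u v = - Num.conj (g v u))
    (g_bound : forall u v : V, `|g u v| <= Cg%:C * `|u| * `|v|)
    (k_index : (neg_index k < +oo)%E) :
  let A := generator ipH j d k g in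
  let S := spectrum A `&` @open_right_half_plane R in
  [/\ finite_set S,
      forall z, S z -> isolated_eigenvalue A z /\ (alg_mult A z < +oo)%E &
      N_plus A = neg_index k].
Proof.
move=> A S.
have kS := sesquilinearP k.
have [n [e [kn e_orth e_max]]] := neg_index_basis kS k_herm k_index.
have jb : bounded_map j by apply: continuous_bounded_map => //; exact: linearP.
have j_total := dense_total normH j_dense.
pose P := DampedPencil
  (dot_sesquilinear ipV) (dot_herm ipV) (dot_norm normV)
  (dot_sesquilinear ipH) (dot_herm ipH) (dot_norm normH)
  (@linearP _ _ _ _ j) j_inj jb j_total
  (sesquilinearP d) d_herm d0_gt0 (coercive_re d_coercive) (bounded_form_norm d_bound)
  kS k_herm (bounded_form_norm k_bound)
  (sesquilinearP g) g_skew (bounded_form_norm g_bound) e_orth e_max.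
rewrite kn; apply: (@unstable_spectrum R P) => [x|x y]; first exact: generator_weak.
exact: weak_generator.
Qed.
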